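(* Let $M$ be an oriented smooth $2$-dimensional manifold, $\xi:E(\xi)\to M$ a real line bundle, and let $A\in\mathbf{Diff}_3(\xi)$ be a third order linear differential operator acting in sections of $\xi$ whose principal symbol $\sigma_{3,A}$ is regular. Then there is a unique connection $\nabla^\xi$ in the line bundle $\xi$ such that $$\sigma_{2,A}(\xi)=\lambda\, g_{-1/3}(\sigma_{3,A})$$ for some function (multiplier) $\lambda\in C^\infty(M)$, where $\sigma_{2,A}(\xi)$ is the subsymbol of $A$ defined by $\nabla^\xi$ and the Chern connection of $\sigma_{3,A}$.
   Context: $\mathbf{Diff}_k(\xi)$ is the module of linear differential operators of order $\le k$ acting on sections of $\xi$; $\Sigma_k(M)$ is the module of symmetric $k$-vector fields on $M$. The principal symbol $\mathrm{smbl}_k(A)$ of $A\in\mathbf{Diff}_k(\xi)$ is its class modulo $\mathbf{Diff}_{k-1}(\xi)$, viewed as an element of $\Sigma_k(M)$; $\sigma_{3,A}=\mathrm{smbl}_3(A)$. In local coordinates $(x,y)$ write $\sigma\in\Sigma_3(M)$ as $\sigma=a_1\partial_x^3+3a_2\partial_x^2\cdot\partial_y+3a_3\partial_x\cdot\partial_y^2+a_4\partial_y^3$. Put $\Delta(\sigma)=6a_1a_2a_3a_4-4(a_1a_3^3+a_4a_2^3)+3a_2^2a_3^2-a_1^2a_4^2$. The symbol $\sigma$ is regular if $\Delta(\sigma)\ne0$ everywhere (distinct roots). For regular $\sigma$ let $$g_{-1/3}(\sigma)=\Delta(\sigma)^{-1/3}\big((a_1a_3-a_2^2)\partial_x^2+(a_1a_4-a_2a_3)\partial_x\cdot\partial_y+(a_2a_4-a_3^2)\partial_y^2\big)\in\Sigma_2(M)$$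 (a coordinate-independent symmetric $2$-vector, the Wagner metric on covectors). Chern connection of a regular $\sigma$: the unique torsion-free affine connection $\nabla$ on $M$ with $d_\nabla\sigma=\omega\otimes\sigma$ for some $1$-form $\omega$. Quantization: given an affine connection $\nabla^M$ on $M$ and a connection $\nabla^\xi$ in $\xi$, let $d^s_{\nabla^M}$ be the degree-one derivation of the algebra of symmetric differential forms equal to $d$ on functions and to $\mathrm{Sym}\circ d_{\nabla^M}$ on $1$-forms. Let $d^s_{\nabla^\xi}$ be the derivation on $\xi$-valued symmetric forms with $d^s_{\nabla^\xi}(s\otimes\theta)=s\otimes d^s_{\nabla^M}\theta+d_{\nabla^\xi}(s)\cdot\theta$. For $\sigma\in\Sigma_k(M)$ define $\widehat\sigma\in\mathbf{Diff}_k(\xi)$ by $\widehat\sigma(s)=\frac1{k!}\langle\sigma,(d^s_{\nabla^\xi})^k(s)\rangle$, where the pairing of symmetric tensors is normalized by $\langle v_1\cdots v_k,p^k\rangle=k!\prod_jp(v_j)$, so that $\widehat\sigma$ has principal symbol $\sigma$. Subsymbol: with $\nabla^M$ the Chern connection of $\sigma_{3,A}$ and $\nabla^\xi$ a connection in $\xi$, $\sigma_{2,A}(\xi)=\mathrm{smbl}_2(A-\widehat{\sigma_{3,A}})\in\Sigma_2(M)$. *)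

(* Defs.v *)
From HB Require Import structures.
From mathcomp Require Import all_boot all_order all_algebra all_fingroup.
From mathcomp Require Import ring.
From mathcomp Require Import all_classical all_reals all_analysis.

Set Implicit Arguments.
Unset Strict Implicit.
Unset Printing Implicit Defensive.

Import Order.TTheory GRing.Theory Num.Theory.
Import numFieldNormedType.Exports.

Local Open Scope classical_set_scope.
Local Open Scope ring_scope.

Section PlaneCalculus.
Variable R : realType.
Implicit Types (U : set 'rV[R]_2) (f g : 'rV[R]_2 -> R).

Definition partial (i : 'I_2) f (p : 'rV[R]_2) : R := 'D_(delta_mx 0 i) f p.

(* [Ck k U f] and [smooth_plane U f] are only meaningful for open [U]. *)
Fixpoint Ck (k : nat) U f : Prop :=
  match k with
  | 0 => forall p, U p -> {for p, continuous f}
  | k'.+1 => (forall p, U p -> differentiable f p) /\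
             forall i, Ck k' U (partial i f)
  end.

Definition smooth_plane U f : Prop := forall k, Ck k U f.

Lemma near_open U f g p : open U -> U p -> (forall q, U q -> f q = g q) ->
  \forall q \near p, f q = g q.
Proof.
by move=> oU Up fg; move: oU; rewrite openE => /(_ _ Up); apply: filterS.
Qed.

Lemma near_eq_differentiable f g p : (\forall q \near p, f q = g q) ->
  differentiable f p -> differentiable g p.
Proof.
move=> nfg df; have fgp := nbhs_singleton nfg.
have E : g \o shift p = cst (g p) + 'd f p +o_ 0 id.
  apply/eqaddoP => e e0.
  have /eqaddoP/(_ e e0) H := diff_locally df.
  have nfg0 : \forall h \near (0 : 'rV[R]_2), f (h + p) = g (h + p).
    by rewrite (near_shift p) /=; apply: filterS nfg => q /=; rewrite sub0r addrNK.
  have Hg : \forall h \near (0 : 'rV[R]_2),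
      `|(g \o shift p - (cst (g p) + 'd f p)) h| <= e * `|h|.
    apply: filterS2 nfg0 H => h fg /=; rewrite -fgp !fctE /= fg; exact.
  exact: Hg.
have dg := diff_unique (diff_continuous df) E.
by apply/diff_locallyP; rewrite dg; split => //; apply: diff_continuous.
Qed.

Lemma Ck_eq k U f g : open U -> (forall q, U q -> f q = g q) ->
  Ck k U f -> Ck k U g.
Proof.
move=> oU; elim: k f g => [|k IH] f g fg /=.
  move=> cf p Up; have nfg := near_open oU Up fg.
  rewrite /prop_for /continuous_at -(fg _ Up).
  apply: cvg_trans (cf _ Up); exact: near_eq_cvg nfg.
move=> [df Cf]; split=> [p Up|i].
  exact: near_eq_differentiable (near_open oU Up fg) (df _ Up).
apply: IH (Cf i) => p Up; apply: near_eq_derive; exact: near_open oU Up fg.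
Qed.

Lemma CkS k U f : Ck k.+1 U f -> Ck k U f.
Proof.
elim: k f => [|k IH] f [df Cf]; first by move=> p /df/differentiable_continuous.
by split=> // i; apply: IH (Cf i).
Qed.

Lemma Ck_cst k U c : Ck k U (cst c).
Proof.
elim: k c => [|k IH] c /=; first by move=> p _; exact: cst_continuous.
split=> [p _|i]; first exact: differentiable_cst.
have -> : partial i (cst c) = cst 0 by apply/funext => p; exact: derive_cst.
exact: IH.
Qed.

Lemma Ck_add k U f g : open U -> Ck k U f -> Ck k U g -> Ck k U (f + g).
Proof.
move=> oU; elim: k f g => [|k IH] f g /=.
  by move=> cf cg p Up; apply: continuousD; [exact: cf|exact: cg].
move=> [df Cf] [dg Cg]; split=> [p Up|i].
  by apply: differentiableD; [exact: df|exact: dg].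
apply: Ck_eq (IH _ _ (Cf i) (Cg i)) => // p Up.
by rewrite /partial deriveD//; apply: diff_derivable; [exact: df|exact: dg].
Qed.

Lemma Ck_mul k U f g : open U -> Ck k U f -> Ck k U g -> Ck k U (f * g).
Proof.
move=> oU; elim: k f g => [|k IH] f g.
  by move=> cf cg p Up; apply: continuousM; [exact: cf|exact: cg].
move=> Hf Hg; have [[df Cf] [dg Cg]] := (Hf, Hg); split=> [p Up|i].
  by apply: differentiableM; [exact: df|exact: dg].
have := Ck_add oU (IH _ _ (CkS Hf) (Cg i)) (IH _ _ (CkS Hg) (Cf i)).
apply: Ck_eq => // p Up.
by rewrite /partial deriveM//; apply: diff_derivable; [exact: df|exact: dg].
Qed.

End PlaneCalculus.

Record chart (R : realType) (T : topologicalType) := Chart {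
  chart_dom : set T;
  coord : T -> 'rV[R]_2;
  icoord : 'rV[R]_2 -> T;
  open_chart_dom : open chart_dom;
  open_chart_codom : open (coord @` chart_dom);
  coordK : forall x, chart_dom x -> icoord (coord x) = x;
  continuous_coord : forall x, chart_dom x -> {for x, continuous coord};
  continuous_icoord : forall p, (coord @` chart_dom) p ->
    {for p, continuous icoord} }.

Section Charts.
Variables (R : realType) (T : topologicalType).
Implicit Types (c : chart R T) (U : set T).

Definition chart_img c U : set 'rV[R]_2 := coord c @` (chart_dom c `&` U).

Lemma open_chart_img c U : open U -> open (chart_img c U).
Proof.
move=> oU; rewrite openE => _ [x [cx Ux] <-]; rewrite /interior.
have cp : (coord c @` chart_dom c) (coord c x) by exists x.
have nI : \forall q \near coord c x, (coord c @` chart_dom c) q.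
  by have := @open_chart_codom _ _ c; rewrite openE; apply.
have nU : \forall q \near coord c x, U (icoord c q).
  apply: (continuous_icoord cp).
  by rewrite coordK//; move: oU; rewrite openE; apply.
apply: filterS2 nI nU => _ [y cy <-]; rewrite coordK// => Uy.
by exists y.
Qed.

Definition transition c c' (j : 'I_2) (p : 'rV[R]_2) : R :=
  coord c' (icoord c p) 0 j.

End Charts.

(* An oriented smooth surface, given by an atlas whose changes of coordinates
   are smooth and have positive Jacobian determinant; the atlas need not be
   maximal. *)
Record oriented_surface (R : realType) := OrientedSurface {
  surface_sort :> topologicalType;
  surface_hausdorff : hausdorff_space surface_sort;
  surface_second_countable : @second_countable surface_sort;
  atlas : set (chart R surface_sort);
  atlas_cover : forall x : surface_sort, exists2 c, atlas c & chart_dom c x;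
  atlas_smooth : forall c c', atlas c -> atlas c' -> forall j,
    smooth_plane (chart_img c (chart_dom c')) (transition c c' j);
  atlas_oriented : forall c c', atlas c -> atlas c' ->
    forall p, chart_img c (chart_dom c') p ->
    0 < \det (\matrix_(i, j) partial i (transition c c' j) p) }.

Section SmoothFunctions.
Variables (R : realType) (M : oriented_surface R).
Implicit Types (U : set M) (f g : M -> R).

(* Only meaningful for open [U]. *)
Definition smooth_on U f : Prop := forall c, atlas c ->
  smooth_plane (chart_img c U) (f \o icoord c).

Lemma smooth_on_cst U a : smooth_on U (cst a).
Proof. by move=> c _ k; exact: Ck_cst. Qed.

Lemma smooth_on_add U f g : open U ->
  smooth_on U f -> smooth_on U g -> smooth_on U (f + g).
Proof.
move=> oU sf sg c ac k.
exact: Ck_add (open_chart_img oU) (sf c ac k) (sg c ac k).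
Qed.

Lemma smooth_on_mul U f g : open U ->
  smooth_on U f -> smooth_on U g -> smooth_on U (f * g).
Proof.
move=> oU sf sg c ac k.
exact: Ck_mul (open_chart_img oU) (sf c ac k) (sg c ac k).
Qed.

Lemma smooth_on_sub U V f : open U -> open V -> U `<=` V ->
  smooth_on V f -> smooth_on U f.
Proof.
move=> oU oV UV sf c ac k; move: (sf c ac k).
have sI : chart_img c U `<=` chart_img c V.
  by move=> _ [x [cx Ux] <-]; exists x => //; split=> //; exact: UV.
elim: k (f \o icoord c) => [|k IH] h /=; first by move=> ch p /sI/ch.
by move=> [dh Ch]; split=> [p /sI/dh//|i]; apply: IH.
Qed.

Definition smooth_pred : {pred M -> R} := fun f => `[< smooth_on setT f >].

Lemma smooth_subring_closed : subring_closed smooth_pred.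
Proof.
split=> [|f g /asboolP sf /asboolP sg|f g /asboolP sf /asboolP sg].
- by apply/asboolP; exact: smooth_on_cst.
- apply/asboolP.
  have -> : f - g = f + cst (-1) * g.
    by apply/funext => x; rewrite /= !fctE mulN1r.
  apply: smooth_on_add => //; first exact: openT.
  by apply: smooth_on_mul => //; [exact: openT|exact: smooth_on_cst].
- by apply/asboolP; apply: smooth_on_mul => //; exact: openT.
Qed.

Record Cinf := MkCinf {
  Cinf_fun :> M -> R;
  Cinf_smooth : Cinf_fun \in smooth_pred }.
HB.instance Definition _ := [isSub for Cinf_fun].
HB.instance Definition _ := [Choice of Cinf by <:].
HB.instance Definition _ := GRing.SubChoice_isSubComPzRing.Build
  (M -> R) smooth_pred Cinf smooth_subring_closed.

Lemma cst_smooth_pred (a : R) : cst a \in smooth_pred.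
Proof. by apply/asboolP; exact: smooth_on_cst. Qed.

Definition cstC (a : R) : Cinf := MkCinf (cst_smooth_pred a).

End SmoothFunctions.

Section VectorFields.
Variables (R : realType) (M : oriented_surface R).
Local Notation C := (Cinf M).

(* Vector fields are the R-linear derivations of the algebra of smooth
   functions. *)
Record vfield := MkVfield {
  vfield_fun :> C -> C;
  vfieldD : forall f g, vfield_fun (f + g) = vfield_fun f + vfield_fun g;
  vfieldZ : forall a f, vfield_fun (cstC M a * f) = cstC M a * vfield_fun f;
  vfieldM : forall f g,
    vfield_fun (f * g) = vfield_fun f * g + f * vfield_fun g }.

Lemma vfieldP (X Y : vfield) : X =1 Y -> X = Y.
Proof.
case: X Y => [X a b c] [Y a' b' c'] /= /funext XY; subst Y.
by congr MkVfield; exact: Prop_irrelevance.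
Qed.

HB.instance Definition _ := gen_eqMixin vfield.
HB.instance Definition _ := gen_choiceMixin vfield.

Definition vfield0 : vfield.
Proof.
exists (fun=> 0).
- abstract by move=> *; rewrite addr0.
- abstract by move=> *; rewrite mulr0.
- abstract by move=> *; rewrite mul0r mulr0 addr0.
Defined.

Definition vfield_add (X Y : vfield) : vfield.
Proof.
exists (fun f => X f + Y f).
- abstract by move=> *; rewrite !vfieldD addrACA.
- abstract by move=> *; rewrite !vfieldZ mulrDr.
- abstract by move=> *; rewrite !vfieldM mulrDl mulrDr addrACA.
Defined.

Definition vfield_scale (h : C) (X : vfield) : vfield.
Proof.
exists (fun f => h * X f).
- abstract by move=> *; rewrite vfieldD mulrDr.
- abstract by move=> *; rewrite vfieldZ mulrCA.
- abstract by move=> f g; rewrite vfieldM mulrDr mulrA [h * (f * _)]mulrCA.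
Defined.

Definition vfield_opp X := vfield_scale (- 1) X.

Lemma vfield_addA : associative vfield_add.
Proof. by move=> X Y Z; apply/vfieldP => f /=; rewrite addrA. Qed.
Lemma vfield_addC : commutative vfield_add.
Proof. by move=> X Y; apply/vfieldP => f /=; rewrite addrC. Qed.
Lemma vfield_add0 : left_id vfield0 vfield_add.
Proof. by move=> X; apply/vfieldP => f /=; rewrite add0r. Qed.
Lemma vfield_addN : left_inverse vfield0 vfield_opp vfield_add.
Proof. by move=> X; apply/vfieldP => f /=; rewrite mulN1r addNr. Qed.
HB.instance Definition _ := GRing.isZmodule.Build vfield
  vfield_addA vfield_addC vfield_add0 vfield_addN.

Lemma vfield_scaleA a b X :
  vfield_scale a (vfield_scale b X) = vfield_scale (a * b) X.
Proof. by apply/vfieldP => f /=; rewrite mulrA. Qed.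
Lemma vfield_scale1 : left_id 1 vfield_scale.
Proof. by move=> X; apply/vfieldP => f /=; rewrite mul1r. Qed.
Lemma vfield_scaleDr : right_distributive vfield_scale +%R.
Proof. by move=> a X Y; apply/vfieldP => f /=; rewrite mulrDr. Qed.
Lemma vfield_scaleDl X : {morph vfield_scale^~ X : a b / a + b}.
Proof. by move=> a b; apply/vfieldP => f /=; rewrite mulrDl. Qed.
HB.instance Definition _ := GRing.Zmodule_isLmodule.Build C vfield
  vfield_scaleA vfield_scale1 vfield_scaleDr vfield_scaleDl.

Definition lie (X Y : vfield) : vfield.
Proof.
exists (fun f => X (Y f) - Y (X f)).
- abstract by move=> *; rewrite !vfieldD opprD addrACA.
- abstract by move=> *; rewrite !vfieldZ mulrBr.
- abstract by move=> *; rewrite !(vfieldM, vfieldD); ring.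
Defined.

Definition oneform := {linear vfield -> C^o}.

Definition differential_fun (f : C) (X : vfield) : C^o := X f.
Fact differential_is_linear f : linear (differential_fun f).
Proof. by []. Qed.
HB.instance Definition _ f := GRing.isLinear.Build C vfield C^o *:%R
  (differential_fun f) (differential_is_linear f).
Definition differential (f : C) : oneform := differential_fun f.

(* A connection in a vector bundle with module of sections [V]; affine
   connections are those with [V = vfield]. *)
Record connection (V : lmodType C) := MkConnection {
  nabla :> vfield -> V -> V;
  nabla_vfield : forall f X Y s,
    nabla (f *: X + Y) s = f *: nabla X s + nabla Y s;
  nablaD : forall X s t, nabla X (s + t) = nabla X s + nabla X t;
  nabla_leibniz : forall X f s,
    nabla X (f *: s) = X f *: s + f *: nabla X s }.

Section CovariantDerivative.
Variable N : connection vfield.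

Definition cov1_fun (X : vfield) (al : oneform) (Y : vfield) : C^o :=
  X (al Y) - al (N X Y).
Fact cov1_is_linear X al : linear (cov1_fun X al).
Proof.
move=> f Y Z; rewrite /cov1_fun nablaD nabla_leibniz !linearD !linearZ /=.
rewrite vfieldD vfieldM /GRing.scale /=; ring.
Qed.
HB.instance Definition _ X al := GRing.isLinear.Build C vfield C^o *:%R
  (cov1_fun X al) (cov1_is_linear X al).
Definition cov1 X al : oneform := cov1_fun X al.

End CovariantDerivative.

(* Symmetric k-vector fields are symmetric multilinear maps on 1-forms; the
   symmetric product v_1 .. v_k is the symmetrization, with weight 1/k!, of
   v_1 (x) .. (x) v_k, so that its value at (p, .., p) is the product of the
   p(v_j). *)
Record symvec (k : nat) := MkSymvec {
  symvec_fun :> ('I_k -> oneform) -> C;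
  symvec_sym : forall (p : 'S_k) al, symvec_fun (al \o p) = symvec_fun al;
  symvec_linear : forall al i f (b c : oneform),
    symvec_fun [eta al with i |-> (f \*: b \+ c : oneform)] =
    f * symvec_fun [eta al with i |-> b] + symvec_fun [eta al with i |-> c] }.

End VectorFields.

(* A smooth local frame: a vector field of bases of the one-dimensional
   fibers [E x], [x] in [frame_dom]. *)
Record frame (R : realType) (T : topologicalType) (E : T -> lmodType R) :=
  Frame {
  frame_dom : set T;
  frame_vec : forall x, E x;
  open_frame_dom : open frame_dom;
  frame_neq0 : forall x, frame_dom x -> frame_vec x != 0;
  frame_span : forall x (v : E x), frame_dom x ->
    exists a : R, v = a *: frame_vec x }.

(* The smooth structure of the total space is the one for which the given
   local frames are smooth. *)
Record line_bundle (R : realType) (M : oriented_surface R) := LineBundle {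
  fiber :> M -> lmodType R;
  frames : set (frame fiber);
  frames_cover : forall x : M, exists2 e, frames e & frame_dom e x;
  frames_smooth : forall e e', frames e -> frames e' ->
    exists2 h : M -> R, smooth_on (frame_dom e `&` frame_dom e') h &
      forall x, frame_dom e x -> frame_dom e' x ->
        frame_vec e' x = h x *: frame_vec e x }.

Section Sections.
Variables (R : realType) (M : oriented_surface R) (xi : line_bundle M).
Local Notation C := (Cinf M).

Definition smooth_section (s : forall x, xi x) : Prop :=
  forall e, frames e -> exists2 f : M -> R, smooth_on (frame_dom e) f &
    forall x, frame_dom e x -> s x = f x *: frame_vec e x.

Record lbsection := MkLbsection {
  lbsection_fun :> forall x, xi x;
  lbsection_smooth : smooth_section lbsection_fun }.

Lemma lbsectionP (s t : lbsection) : (forall x, s x = t x) -> s = t.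
Proof.
case: s t => [s a] [t a'] /= st.
have {}st : s = t by apply: functional_extensionality_dep.
by subst t; congr MkLbsection; exact: Prop_irrelevance.
Qed.

HB.instance Definition _ := gen_eqMixin lbsection.
HB.instance Definition _ := gen_choiceMixin lbsection.

Definition lbsection0 : lbsection.
Proof.
exists (fun=> 0).
abstract (move=> e _; exists (cst 0); first exact: smooth_on_cst;
  by move=> x _; rewrite scale0r).
Defined.

Definition lbsection_add (s t : lbsection) : lbsection.
Proof.
exists (fun x => s x + t x).
abstract (move=> e fe; have [f sf Ef] := lbsection_smooth s fe;
  have [g sg Eg] := lbsection_smooth t fe; exists (f + g);
    [apply: smooth_on_add => //; exact: open_frame_dom
    |by move=> x ex; rewrite Ef// Eg// -scalerDl]).
Defined.

Definition lbsection_scale (h : C) (s : lbsection) : lbsection.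
Proof.
exists (fun x => h x *: s x).
abstract (move=> e fe; have [f sf Ef] := lbsection_smooth s fe;
  have /asboolP sh := Cinf_smooth h; exists ((h : M -> R) * f);
    [apply: smooth_on_mul => //; [exact: open_frame_dom
      |apply: smooth_on_sub sh => //; [exact: open_frame_dom|exact: openT]]
    |by move=> x ex; rewrite Ef// scalerA]).
Defined.

Definition lbsection_opp s := lbsection_scale (- 1) s.

Lemma lbsection_addA : associative lbsection_add.
Proof. by move=> r s t; apply: lbsectionP => x /=; rewrite addrA. Qed.
Lemma lbsection_addC : commutative lbsection_add.
Proof. by move=> s t; apply: lbsectionP => x /=; rewrite addrC. Qed.
Lemma lbsection_add0 : left_id lbsection0 lbsection_add.
Proof. by move=> s; apply: lbsectionP => x /=; rewrite add0r. Qed.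
Lemma lbsection_addN : left_inverse lbsection0 lbsection_opp lbsection_add.
Proof. by move=> s; apply: lbsectionP => x /=; rewrite scaleN1r addNr. Qed.
HB.instance Definition _ := GRing.isZmodule.Build lbsection
  lbsection_addA lbsection_addC lbsection_add0 lbsection_addN.

Lemma lbsection_scaleA a b s :
  lbsection_scale a (lbsection_scale b s) = lbsection_scale (a * b) s.
Proof. by apply: lbsectionP => x /=; rewrite scalerA. Qed.
Lemma lbsection_scale1 : left_id 1 lbsection_scale.
Proof. by move=> s; apply: lbsectionP => x /=; rewrite scale1r. Qed.
Lemma lbsection_scaleDr : right_distributive lbsection_scale +%R.
Proof. by move=> a s t; apply: lbsectionP => x /=; rewrite scalerDr. Qed.
Lemma lbsection_scaleDl s : {morph lbsection_scale^~ s : a b / a + b}.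
Proof. by move=> a b; apply: lbsectionP => x /=; rewrite scalerDl. Qed.
HB.instance Definition _ := GRing.Zmodule_isLmodule.Build C lbsection
  lbsection_scaleA lbsection_scale1 lbsection_scaleDr lbsection_scaleDl.

End Sections.

Section SymmetricForms.
Variables (R : realType) (M : oriented_surface R).
Local Notation C := (Cinf M).
Local Notation vfield := (vfield M).

(* A [V]-valued symmetric form Theta of degree k is represented by the
   symmetric multilinear map whose restriction to the diagonal is the
   homogeneous polynomial Theta(X, .., X); the product of forms is thus the
   symmetrized tensor product, with weight 1/n!. *)
Definition kform (k : nat) (V : lmodType C) := ('I_k -> vfield) -> V.

Variables (N : connection vfield) (V : lmodType C) (D : connection V).

Definition covd k (X : vfield) (Theta : kform k V) : kform k V := fun Y =>
  D X (Theta Y) - \sum_(i < k) Theta [eta Y with i |-> N X (Y i)].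

(* d^s = Sym o d_nabla; that this is the derivation of symmetric forms
   extending d and Sym o d_nabla is checked by [symd_tensor] and
   [symd_mul_diag] below. *)
Definition symd k (Theta : kform k V) : kform k.+1 V := fun Y =>
  cstC M (k.+1%:R^-1) *:
    \sum_(i < k.+1) covd (Y i) Theta (fun j => Y (lift i j)).

Fixpoint symd_iter (s : V) (k : nat) : kform k V :=
  match k with
  | 0 => fun=> s
  | k'.+1 => symd (@symd_iter s k')
  end.

Lemma cstC_natV k : cstC M (k.+1%:R^-1) * k.+1%:R = 1.
Proof.
have natE n x : (n%:R : C) x = n%:R.
  by elim: n => [//|n IH]; rewrite -!natr1 -IH.
apply/val_inj/funext => x /=.
by have := natE k.+1 x => /= E; rewrite !fctE E mulVf ?pnatr_eq0.
Qed.

(* On the diagonal, [symd] is X |-> (nabla_X Theta)(X, .., X). *)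
Lemma symd_diag k (Theta : kform k V) X :
  symd Theta (fun=> X) = covd X Theta (fun=> X).
Proof.
rewrite /symd sumr_const card_ord -[X in _ *: X]scaler_nat scalerA.
by rewrite cstC_natV scale1r.
Qed.

End SymmetricForms.

Section ScalarForms.
Variables (R : realType) (M : oriented_surface R).
Local Notation C := (Cinf M).

(* Functions are differentiated by the trivial connection, so that
   [symd N trivial_connection] is the derivation of the algebra of symmetric
   differential forms. *)
Definition trivial_connection : connection (C^o : lmodType C).
Proof.
exists (fun (X : vfield M) f => X f : C^o).
- abstract by [].
- abstract by move=> X f g; exact: vfieldD.
- abstract by move=> X f g; rewrite /GRing.scale /= vfieldM.
Defined.

(* d^s (s (x) theta) = s (x) d^s theta + d_nabla(s) . theta *)
Lemma symd_tensor (N : connection (vfield M)) (V : lmodType C)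
    (D : connection V) k (theta : kform k C^o) (s : V) Y :
  symd N D (fun Z => theta Z *: s) Y =
  symd N trivial_connection theta Y *: s +
  cstC M (k.+1%:R^-1) *:
    \sum_(i < k.+1) theta (fun j => Y (lift i j)) *: D (Y i) s.
Proof.
rewrite /symd [_ *: \sum_(i < k.+1) _]/GRing.scale /= -scalerA -scalerDr.
congr (_ *: _); rewrite scaler_suml -big_split /=; apply: eq_bigr => i _.
by rewrite /covd nabla_leibniz scalerBl -scaler_suml addrAC.
Qed.

(* On the diagonal, where a symmetric form is a polynomial and the product of
   forms is the product of polynomials, d^s is a derivation. *)
Lemma symd_mul_diag (N : connection (vfield M)) j k
    (eta : kform j C^o) (theta : kform k C^o) X :
  symd N trivial_connection
    (fun Z => eta (Z \o @lshift j k) * theta (Z \o @rshift j k) : C^o) (fun=> X) =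
  symd N trivial_connection eta (fun=> X) * theta (fun=> X) +
  eta (fun=> X) * symd N trivial_connection theta (fun=> X).
Proof.
rewrite !symd_diag /covd /= vfieldM big_split_ord /=.
have El i : [eta (fun=> X) with lshift k i |-> N X X] \o @lshift j k =
    [eta (fun=> X) with i |-> N X X].
  by apply/funext => l /=; rewrite (inj_eq (@lshift_inj _ _)).
have Elr i : [eta (fun=> X) with lshift k i |-> N X X] \o @rshift j k = fun=> X.
  by apply/funext => l /=; rewrite eq_rlshift.
have Er i : [eta (fun=> X) with rshift j i |-> N X X] \o @rshift j k =
    [eta (fun=> X) with i |-> N X X].
  by apply/funext => l /=; rewrite (inj_eq (@rshift_inj _ _)).
have Erl i : [eta (fun=> X) with rshift j i |-> N X X] \o @lshift j k = fun=> X.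
  by apply/funext => l /=; rewrite eq_lrshift.
under eq_bigr do rewrite El Elr.
under [X in _ - (_ + X)]eq_bigr do rewrite Er Erl.
rewrite -mulr_suml -mulr_sumr; ring.
Qed.

End ScalarForms.

Section SymbolsAndQuantization.
Variables (R : realType) (M : oriented_surface R) (xi : line_bundle M).
Local Notation C := (Cinf M).
Local Notation Gamma := (lbsection xi).

Definition commutator (A : Gamma -> Gamma) (f : C) : Gamma -> Gamma :=
  fun s => A (f *: s) - f *: A s.

Fixpoint order_le (k : nat) (A : Gamma -> Gamma) : Prop :=
  match k with
  | 0 => forall f s, commutator A f s = 0
  | k'.+1 => forall f, order_le k' (commutator A f)
  end.

(* Diff_k(xi): R-linear operators of order at most k. *)
Definition diffop (k : nat) (A : Gamma -> Gamma) : Prop :=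
  (forall a s t, A (cstC M a *: s + t) = cstC M a *: A s + A t) /\
  order_le k A.

(* The class of A modulo Diff_(k-1) is determined by the iterated commutators
   [.. [A, f_1], .., f_k], which are multiplications by
   <smbl_k A, df_1 .. df_k> = k! (smbl_k A)(df_1, .., df_k); e.g. a D^k has
   symbol a D^k, since [.. [a D^k, f], .., f] = k! a (Df)^k. *)
Definition is_symbol k (A : Gamma -> Gamma) (sigma : symvec M k) : Prop :=
  diffop k A /\ forall (f : 'I_k -> C) (s : Gamma),
    foldl commutator A (codom f) s =
    (k`!%:R * sigma (fun i => differential (f i))) *: s.

(* t = <sigma, Theta>, computed at each point in any pair of dual bases; the
   factor k! is the one in <v_1 .. v_k, p^k> = k! p(v_1) .. p(v_k). *)
Definition is_pairing k (sigma : symvec M k) (Theta : kform k Gamma)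
    (t : Gamma) : Prop :=
  forall (x : M) (E : 'I_2 -> vfield M) (eps : 'I_2 -> oneform M),
    (forall i j, (eps i (E j) : C) x = (i == j)%:R) ->
    t x = \sum_(I : {ffun 'I_k -> 'I_2})
      (k`!%:R * sigma (eps \o I) x) *: Theta (E \o I) x.

(* Q = \widehat sigma *)
Definition is_quantization (NM : connection (vfield M)) (Nxi : connection Gamma)
    k (sigma : symvec M k) (Q : Gamma -> Gamma) : Prop :=
  forall s, exists2 t, is_pairing sigma (@symd_iter _ _ NM _ Nxi s k) t &
    Q s = cstC M (k`!%:R^-1) *: t.

End SymbolsAndQuantization.

Section CubicSymbols.
Variables (R : realType) (M : oriented_surface R).
Local Notation C := (Cinf M).

Definition torsion_free (N : connection (vfield M)) : Prop :=
  forall X Y, N X Y - N Y X = lie X Y.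

Definition cov_symvec (N : connection (vfield M)) k (X : vfield M)
    (sigma : symvec M k) (al : 'I_k -> oneform M) : C :=
  X (sigma al) - \sum_(i < k) sigma [eta al with i |-> cov1 N X (al i)].

Definition is_chern (sigma : symvec M 3) (N : connection (vfield M)) : Prop :=
  torsion_free N /\ exists omega : oneform M, forall X al,
    cov_symvec N X sigma al = omega X * sigma al.

(* Globally defined functions u_0, u_1 that coincide near x with the
   coordinates of the chart c. *)
Definition coordinates_at (c : chart R M) (x : M) (u : 'I_2 -> C) : Prop :=
  [/\ atlas c, chart_dom c x &
      \forall y \near x, forall i, u i y = coord c y 0 i].

(* The coefficient a_(m+1), m < 4, of
   sigma = a_1 D_x^3 + 3 a_2 D_x^2.D_y + 3 a_3 D_x.D_y^2 + a_4 D_y^3, i.e.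
   sigma evaluated at 3 - m copies of dx and m copies of dy. *)
Definition cubic_coef (sigma : symvec M 3) (u : 'I_2 -> C) (x : M) (m : nat) : R :=
  sigma (fun i : 'I_3 => differential (u (if (i < m)%N then 1 else 0))) x.

Definition quadratic_coef (g : symvec M 2) (u : 'I_2 -> C) (x : M)
    (i j : 'I_2) : R :=
  g (fun l : 'I_2 => differential (u (if l == 0 then i else j))) x.

Definition discr (a1 a2 a3 a4 : R) : R :=
  6 * a1 * a2 * a3 * a4 - 4 * (a1 * a3 ^+ 3 + a4 * a2 ^+ 3)
  + 3 * a2 ^+ 2 * a3 ^+ 2 - a1 ^+ 2 * a4 ^+ 2.

Definition cubic_discr (sigma : symvec M 3) u x : R :=
  let a := cubic_coef sigma u x in discr (a 0%N) (a 1%N) (a 2%N) (a 3%N).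

Definition regular (sigma : symvec M 3) : Prop :=
  forall c x u, coordinates_at c x u -> cubic_discr sigma u x != 0.

(* The inverse of the real cube root. *)
Definition inv_cbrt (d : R) : R := Num.sg d * (`|d| `^ (- 3^-1)).

(* g = g_(-1/3)(sigma); the coefficient of D_x.D_y in g is 2 g(dx, dy). *)
Definition is_wagner (sigma : symvec M 3) (g : symvec M 2) : Prop :=
  forall c x u, coordinates_at c x u ->
    let a := cubic_coef sigma u x in
    let d := inv_cbrt (cubic_discr sigma u x) in
    [/\ quadratic_coef g u x 0 0 = d * (a 0%N * a 2%N - a 1%N ^+ 2),
        2 * quadratic_coef g u x 0 1 = d * (a 0%N * a 3%N - a 1%N * a 2%N) &
        quadratic_coef g u x 1 1 = d * (a 1%N * a 3%N - a 2%N ^+ 2)].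

End CubicSymbols.

(* sigma2 = sigma_(2,A)(xi) *)
Definition is_subsymbol (R : realType) (M : oriented_surface R)
    (xi : line_bundle M) (A : lbsection xi -> lbsection xi)
    (Nxi : connection (lbsection xi)) (sigma2 : symvec M 2) : Prop :=
  exists (sigma3 : symvec M 3) (NM : connection (vfield M))
         (Q : lbsection xi -> lbsection xi),
    [/\ is_symbol A sigma3, is_chern sigma3 NM,
        is_quantization NM Nxi sigma3 Q & is_symbol (fun s => A s - Q s) sigma2].

(* Main.v *)
(** Replacing the connection D in xi by D + theta changes the symbol of order 2
    of the quantization of sigma by 3 sigma(., ., theta), so the condition on
    the subsymbol reads

      tau = 3 sigma(., ., theta) + lambda g_(-1/3)(sigma),

    where tau is the subsymbol for an arbitrary fixed D.  In coordinates, the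
    determinant of the symmetric 2-vectors sigma(., ., dx), sigma(., ., dy) and
    g_(-1/3)(sigma) is Delta^(2/3) / 2, which does not vanish: theta and lambda
    exist, are unique and, by Cramer's rule, smooth.  The Chern connection is the
    solution of a pointwise linear system given by the infinitesimal action of
    gl_2 on binary cubics, which is free on cubics with Delta <> 0. *)

From HB Require Import structures.
From mathcomp Require Import all_boot all_order all_algebra all_fingroup.
From mathcomp Require Import ring lra.
From mathcomp Require Import all_classical all_reals all_analysis.
Require Import Defs.

Set Implicit Arguments.
Unset Strict Implicit.
Unset Printing Implicit Defensive.

Import Order.TTheory GRing.Theory Num.Theory.
Import numFieldNormedType.Exports.

Local Open Scope classical_set_scope.
Local Open Scope ring_scope.

(** * Smooth functions on the plane *)

Section PlaneFunctions.
Variable R : realType.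
Local Notation plane := 'rV[R]_2.
Implicit Types (U V : set plane) (f g : plane -> R).

(** Vector fields, connections and operators are algebraic maps on global functions and sections, so
    nothing is local by definition. Locality is recovered by cutoffs: multiplying by a bump equal to
    1 at a point turns a local identity into a global one, to which derivations and linear maps
    apply. That a derivation has two components in a chart rests on Hadamard's lemma, hence the
    division of smooth functions by a coordinate on the plane. Global objects arise in two ways.
    Where the solution is determined at each point (Chern connection, quantization, Wagner metric,
    theta, lambda), the value at a point is taken from a solution around it, and uniqueness makes
    the result smooth. Where it is not (an auxiliary affine connection, a first connection in xi), a
    partition of unity is used. The quantization is never expanded in full: only its double
    commutators with functions f, h are. There the connection D of xi enters solely through 6
    sigma(df, dh, D s); the remaining term is of order zero, does not involve D, and cancels both in
    the triple commutator and when two connections are compared. *)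

Lemma CkSP k U f (h : 'I_2 -> plane -> R) : open U ->
  (forall p, U p -> differentiable f p) ->
  (forall i p, U p -> partial i f p = h i p) ->
  (forall i, Ck k U (h i)) -> Ck k.+1 U f.
Proof.
move=> oU df fh Ch; split=> // i.
by apply: Ck_eq (Ch i) => // q Uq; rewrite fh.
Qed.

Lemma Ck_sub k U V f : U `<=` V -> Ck k V f -> Ck k U f.
Proof.
move=> UV; elim: k f => [|k IH] f /=; first by move=> cf p /UV/cf.
by move=> [df Cf]; split=> [p /UV/df|i] //; exact: IH.
Qed.

Lemma CkS_diff k U f p : Ck k.+1 U f -> U p -> differentiable f p.
Proof. by case=> df _ /df. Qed.

Lemma CkS_partial k U f i : Ck k.+1 U f -> Ck k U (partial i f).
Proof. by case=> _; apply. Qed.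

Lemma Ck_local k U f :
  (forall p, U p -> exists V, V p /\ Ck k V f) -> Ck k U f.
Proof.
elim: k f => [|k IH] f H /=; first by move=> p /H[V [Vp]]; apply.
split=> [p /H[V [Vp [dV _]]]|i]; first exact: dV.
by apply: IH => p /H[V [Vp [_ CV]]]; exists V; split=> //; exact: CV.
Qed.

Lemma partial_coord (i j : 'I_2) (p : plane) :
  partial i (fun q : plane => q 0 j) p = (i == j)%:R.
Proof.
pose f (q : plane) : R := q 0 j.
have f_lin : linear f by move=> a x y; rewrite /f !mxE.
pose fM := GRing.isLinear.Build _ _ _ _ _ f_lin.
pose fL : {linear plane -> R} := HB.pack f fM.
rewrite /partial deriveE; last exact: differentiable_coord.
rewrite (_ : (fun q : plane => q 0 j) = fL) // diff_lin; last exact: coord_continuous.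
by rewrite /= /f mxE eqxx eq_sym.
Qed.

Lemma Ck_coord k U (j : 'I_2) : open U -> Ck k U (fun q => q 0 j).
Proof.
move=> oU; case: k => [p _|k]; first exact: coord_continuous.
apply: (@CkSP _ _ _ (fun i => cst (i == j)%:R)) => //.
- by move=> p _; exact: differentiable_coord.
- by move=> i p _; exact: partial_coord.
- by move=> i; exact: Ck_cst.
Qed.

Lemma Ck_opp k U f : open U -> Ck k U f -> Ck k U (- f).
Proof.
move=> oU Cf; have := Ck_mul oU (Ck_cst k U (-1)) Cf.
by apply: Ck_eq => // q _; rewrite !fctE mulN1r.
Qed.

Lemma Ck_sub_fun k U f g : open U -> Ck k U f -> Ck k U g -> Ck k U (f - g).
Proof. by move=> oU Cf Cg; apply: Ck_add => //; exact: Ck_opp. Qed.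

Lemma plane_decomp (T : Type) (phi : T -> plane) :
  phi = (fun x => phi x 0 0 *: delta_mx 0 0) + (fun x => phi x 0 1 *: delta_mx 0 1).
Proof.
apply/funext => x; rewrite !fctE; apply/rowP => j; rewrite !mxE eqxx /=.
by case: j => [[|[|//]] ?] /=; rewrite ?mulr1 ?mulr0 ?addr0 ?add0r; congr (phi x 0 _); apply/val_inj.
Qed.

Section Composition.
Variables (phi : plane -> plane).

Lemma continuous_components p :
  (forall j, {for p, continuous (fun q => phi q 0 j)}) ->
  {for p, continuous phi}.
Proof.
move=> H; rewrite (plane_decomp phi); apply: continuousD.
  by apply: (@continuousZl _ _ _ (fun q => phi q 0 0) (delta_mx 0 0) p); exact: H.
by apply: (@continuousZl _ _ _ (fun q => phi q 0 1) (delta_mx 0 1) p); exact: H.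
Qed.

Lemma differentiable_components p :
  (forall j, differentiable (fun q => phi q 0 j) p) -> differentiable phi p.
Proof.
move=> H; rewrite (plane_decomp phi); apply: differentiableD.
  exact: (@differentiableZl _ _ _ (fun q => phi q 0 0) (delta_mx 0 0) p).
exact: (@differentiableZl _ _ _ (fun q => phi q 0 1) (delta_mx 0 1) p).
Qed.

Lemma partial_comp f i p :
  (forall j, differentiable (fun q => phi q 0 j) p) ->
  differentiable f (phi p) ->
  partial i (f \o phi) p =
    \sum_j partial j f (phi p) * partial i (fun q => phi q 0 j) p.
Proof.
move=> dphi df; have dp := differentiable_components dphi.
rewrite /partial deriveE; last exact: differentiable_comp.
rewrite diff_comp //=.
rewrite [X in 'd f _ X](_ : _ = \sum_j 'D_(delta_mx 0 i) (fun q => phi q 0 j) p *: delta_mx 0 j).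
  rewrite linear_sum; apply: eq_bigr => j _.
  by rewrite linearZ /= -deriveE // /GRing.scale /= mulrC.
rewrite [LHS]row_sum_delta; apply: eq_bigr => j _; congr (_ *: _).
rewrite deriveE // -[fun q => _]/((fun v : plane => v 0 j) \o phi).
have := @diff_comp R plane plane R phi (fun v : plane => v 0 j) p dp (@differentiable_coord R 1 2 (phi p) 0 j).
move=> ->; rewrite [RHS]/=.
pose g (q : plane) : R := q 0 j.
have g_lin : linear g by move=> a x y; rewrite /g !mxE.
pose gM := GRing.isLinear.Build _ _ _ _ _ g_lin.
pose gL : {linear plane -> R} := HB.pack g gM.
rewrite (_ : (fun v : plane => v 0 j) = gL) // diff_lin //; exact: coord_continuous.
Qed.

Lemma Ck_comp k U V f : open U -> open V -> (forall q, U q -> V (phi q)) ->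
  (forall j, Ck k U (fun q => phi q 0 j)) -> Ck k V f -> Ck k U (f \o phi).
Proof.
move=> oU oV UV; elim: k f => [|k IH] f Cphi Cf.
  move=> p Up; apply: continuous_comp; last by apply: Cf; exact: UV.
  by apply: continuous_components => j; exact: Cphi.
have df p : V p -> differentiable f p by exact: CkS_diff Cf.
have dphi p : U p -> forall j, differentiable (fun q => phi q 0 j) p.
  by move=> Up j; exact: CkS_diff (Cphi j) Up.
apply: (@CkSP _ _ _ (fun i p => partial 0 f (phi p) * partial i (fun q => phi q 0 0) p
   + partial 1 f (phi p) * partial i (fun q => phi q 0 1) p)) => //.
- move=> p Up; apply: differentiable_comp; last by apply: df; exact: UV.
  exact/differentiable_components/dphi.
- move=> i p Up; rewrite partial_comp; [|exact: dphi|by apply: df; exact: UV].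
  by rewrite big_ord_recl big_ord1; congr (_ + _ * _); congr (partial _ _ _);
    rewrite ?lift0; try apply/funext => q; try congr (phi q 0 _); apply/val_inj.
- move=> i; apply: Ck_add => //; apply: Ck_mul => //.
  + by apply: IH; [move=> j; exact: CkS|exact: CkS_partial].
  + exact: CkS_partial.
  + by apply: IH; [move=> j; exact: CkS|exact: CkS_partial].
  + exact: CkS_partial.
Qed.

End Composition.

Section OneVariable.
Variables (phi dphi : R -> R).

Lemma differentiable_comp1 f p : differentiable f p ->
  is_derive (f p) 1 phi (dphi (f p)) -> differentiable (phi \o f) p.
Proof.
move=> df [dp _]; apply: differentiable_comp => //; exact/derivable1_diffP.
Qed.

Lemma partial_comp1 f i p : differentiable f p ->
  is_derive (f p) 1 phi (dphi (f p)) ->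
  partial i (phi \o f) p = dphi (f p) * partial i f p.
Proof.
move=> df dp; have [dp1 dp2] := dp.
have dphi1 : differentiable phi (f p) by exact/derivable1_diffP.
rewrite /partial deriveE; last exact: differentiable_comp.
rewrite diff_comp //= diff1E // -deriveE // derive1E dp2.
by rewrite /GRing.scale /= mulrC.
Qed.

End OneVariable.

Lemma Ck_inv k U f : open U -> (forall p, U p -> f p != 0) -> Ck k U f ->
  Ck k U (fun p => (f p)^-1).
Proof.
move=> oU f0; elim: k => [|k IH] Cf.
  by move=> p Up; apply: continuousV; [exact: f0|exact: Cf].
have Cf' := IH (CkS Cf); have df p := @CkS_diff _ _ _ p Cf.
have dV (x : R) : x != 0 -> is_derive x 1 (fun y : R => y^-1) (- (x^-1 * x^-1)).
  move=> x0; apply: DeriveDef.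
    exact: (@derivableV R R id x 1 x0 (@derivable_id R R x 1)).
  rewrite (@deriveV R R id x 1 x0 (@derivable_id R R x 1)).
  by rewrite derive_id /GRing.scale /= mulr1 -expr2 exprVn.
apply: (@CkSP _ _ _ (fun i => - ((fun p => (f p)^-1) * (fun p => (f p)^-1)) * partial i f)) => //.
- by move=> p Up; apply: (differentiable_comp1 (dphi := fun y => - (y^-1 * y^-1)) (df _ Up)); exact/dV/f0.
- move=> i p Up; rewrite (partial_comp1 (dphi := fun y => - (y^-1 * y^-1)) i (df _ Up) (dV _ (f0 _ Up))).
  by rewrite !fctE.
- move=> i; apply: Ck_mul => //; [by apply: Ck_opp => //; exact: Ck_mul|exact: CkS_partial].
Qed.

(** Differentiation replaces [a] by [a - 1], hence the induction on [k] for all exponents at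
    once. *)
Lemma Ck_powR k U f (a : R) : open U -> (forall p, U p -> 0 < f p) ->
  Ck k U f -> Ck k U (fun p => f p `^ a).
Proof.
move=> oU f0; elim: k a => [|k IH] a Cf.
  move=> p Up; apply: (@continuous_comp _ _ _ f (fun x => x `^ a) p (Cf p Up)).
  apply: differentiable_continuous; apply/derivable1_diffP.
  by have [] := is_derive1_powR a (f0 _ Up).
have df p := @CkS_diff _ _ _ p Cf.
have dP p (Up : U p) := is_derive1_powR a (f0 _ Up).
apply: (@CkSP _ _ _ (fun i => (cst a * (fun p => f p `^ (a - 1))) * partial i f)) => //.
- by move=> p Up; exact: (@differentiable_comp1 (fun x => x `^ a) (fun x => a * x `^ (a - 1)) f p (df _ Up) (dP _ Up)).
- move=> i p Up; exact: (@partial_comp1 (fun x => x `^ a) (fun x => a * x `^ (a - 1)) f i p (df _ Up) (dP _ Up)).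
- move=> i; apply: Ck_mul => //; last exact: CkS_partial.
  by apply: Ck_mul => //; [exact: Ck_cst|apply: IH; exact: CkS].
Qed.

(** This form has neither sign nor absolute value: the base [d * d] is positive wherever [d] does
    not vanish, so smoothness reduces to that of real powers of positive functions. *)
Lemma inv_cbrtE (d : R) : d != 0 -> inv_cbrt d = d * (d * d) `^ (- (2 / 3)).
Proof.
move=> d0; have n0 : 0 < `|d| by rewrite normr_gt0.
rewrite /inv_cbrt -expr2 -real_normK ?num_real // -powR_mulrn ?normr_ge0 //.
rewrite -powRrM {3}[d]numEsg -mulrA; congr (_ * _).
rewrite -{2}[`|d|]powRr1 ?normr_ge0 // -powRD; last by apply/implyP => _; rewrite gt_eqF.
by congr (_ `^ _); field.
Qed.

Lemma Ck_inv_cbrt k U f : open U -> (forall p, U p -> f p != 0) -> Ck k U f ->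
  Ck k U (fun p => inv_cbrt (f p)).
Proof.
move=> oU f0 Cf.
have C : Ck k U (f * (fun p => (f * f) p `^ (- (2 / 3)))).
  apply: Ck_mul => //; apply: Ck_powR => //; last exact: Ck_mul.
  by move=> p Up; rewrite !fctE -expr2 exprn_even_gt0 //= f0.
apply: Ck_eq C => // q Uq; rewrite inv_cbrtE ?f0 //.
Qed.

(** A quadratic bound is a little-o of [q - p]. This gives the derivative at the exceptional points
    of functions defined by cases: [flat] at 0, and divided Taylor remainders where the divisor
    vanishes. *)
Lemma quadratic_differentiable (V : normedModType R) (f : V -> R) (p : V) (C : R) :
  (\forall q \near p, `|f q| <= C * `|q - p| ^+ 2) ->
  differentiable f p /\ forall v, 'D_v f p = 0.
Proof.
move=> H; have fp : f p = 0.
  by have := nbhs_singleton H; rewrite subrr normr0 expr0n mulr0 normr_le0 => /eqP.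
have z_lin : linear (fun _ : V => 0 : R) by move=> a x y; rewrite scaler0 addr0.
pose zM := GRing.isLinear.Build _ _ _ _ _ z_lin.
pose z : {linear V -> R} := HB.pack (fun _ : V => 0 : R) zM.
have cz : continuous z by exact: cst_continuous.
have E : f \o shift p = cst (f p) + z +o_ 0 id.
  apply/eqaddoP => e e0.
  have H0 : \forall h \near (0 : V), `|f (h + p)| <= C * `|h| ^+ 2.
    rewrite (near_shift p) /=; apply: filterS H => q /=.
    by rewrite sub0r addrNK.
  have H1 : \forall h \near (0 : V), `|C| * `|h| <= e.
    have [->|C0] := eqVneq C 0; first by near=> h; rewrite normr0 mul0r ltW.
    near=> h; rewrite mulrC -ler_pdivlMr ?normr_gt0 // ltW //.
    by near: h; apply: nbhs0_lt; rewrite divr_gt0 // normr_gt0.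
  near=> h; rewrite /= !fctE /= fp addr0 subr0.
  apply: le_trans (_ : C * `|h| ^+ 2 <= _); first by near: h.
  apply: le_trans (_ : `|C| * `|h| ^+ 2 <= _).
    by rewrite ler_wpM2r ?sqr_ge0 // ler_norm.
  by rewrite expr2 mulrA ler_wpM2r //; near: h.
have dz := diff_unique cz E.
have df : differentiable f p by apply/diff_locallyP; rewrite dz.
by split=> // v; rewrite deriveE // dz.
Unshelve. all: by end_near. Qed.

(* x^-n exp(-1/x), extended by 0 to x <= 0; its derivative is a combination
   of functions of the same family. *)
Definition flat (n : nat) (x : R) : R :=
  if 0 < x then x^-1 ^+ n * expR (- x^-1) else 0.

Lemma flat_ge0 n x : 0 <= flat n x.
Proof.
by rewrite /flat; case: ifP => // x0; rewrite mulr_ge0 ?expR_ge0 ?exprn_ge0 ?invr_ge0 ?ltW.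
Qed.

Lemma flat_gt0 n x : 0 < x -> 0 < flat n x.
Proof. by move=> x0; rewrite /flat x0 mulr_gt0 ?expR_gt0 ?exprn_gt0 ?invr_gt0. Qed.

Lemma flat_le0 n x : x <= 0 -> flat n x = 0.
Proof. by move=> x0; rewrite /flat ltNge x0. Qed.

(** With t = 1/x, the exponential series gives exp t >= t^(n+2)/(n+2)!, that is t^n exp(-t) <=
    (n+2)! x^2. *)
Lemma flat_bound n x : flat n x <= (n.+2)`!%:R * x ^+ 2.
Proof.
rewrite /flat; case: ifP => x0; last by rewrite mulr_ge0 ?sqr_ge0.
set t := x^-1; have t0 : 0 < t by rewrite invr_gt0.
have H : t ^+ n.+2 / n.+2`!%:R <= expR t.
  by apply: le_trans (expR_ge1Dxn n.+1 (ltW t0)); rewrite lerDr.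
rewrite expRN ler_pdivrMr ?expR_gt0 //.
have -> : t ^+ n = n.+2`!%:R * x ^+ 2 * (t ^+ n.+2 / n.+2`!%:R).
  have x1 : x != 0 by rewrite gt_eqF.
  have : (n.+2`!%:R : R) != 0 by rewrite pnatr_eq0 -lt0n fact_gt0.
  move: (n.+2`!%:R : R) => c c0.
  have -> : t ^+ n.+2 = t ^+ n * t ^+ 2 by rewrite -exprD addn2.
  by move: (t ^+ n) => u; rewrite /t; field; rewrite c0.
by rewrite ler_wpM2l // mulr_ge0 // sqr_ge0.
Qed.

Lemma is_derive_flat n (x : R) :
  is_derive x 1 (flat n) (flat n.+2 x - n%:R * flat n.+1 x).
Proof.
have [x0|x0|->] := ltgtP x 0.
- rewrite !flat_le0 ?ltW // mulr0 subr0.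
  apply: (@near_eq_is_derive _ _ _ (cst 0)).
  by near=> y; rewrite flat_le0 // ltW //; near: y; exact: lt_nbhsl.
- have x1 : x != 0 by rewrite gt_eqF.
  have dV : is_derive x 1 (fun y : R => y^-1) (- (x^-1 ^+ 2)).
    apply: DeriveDef.
      exact: (@derivableV R R id x 1 x1 (@derivable_id R R x 1)).
    rewrite (@deriveV R R id x 1 x1 (@derivable_id R R x 1)).
    by rewrite derive_id /GRing.scale /= mulr1 exprVn.
  have dE : is_derive x 1 (fun y : R => expR (- y^-1)) (expR (- x^-1) * x^-1 ^+ 2).
    have := @is_derive1_comp _ expR (- (fun y : R => y^-1)) x _ _ (is_derive_expR (- x^-1)) (is_deriveN dV).
    by rewrite opprK.
  have nE : \forall y \near x, ((fun y : R => y^-1) ^+ n * (fun y : R => expR (- y^-1))) y = flat n y.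
    near=> y; rewrite /flat ifT ?fctE //; near: y; exact: lt_nbhsr.
  have H := near_eq_is_derive nE (is_deriveM (is_deriveX n dV) dE).
  apply: is_derive_eq; rewrite /flat x0 /GRing.scale /= !fctE.
  case: n {nE H} => [|n] /=; first by rewrite !mul0r mulr0 addr0 subr0 expr0; ring.
  rewrite !exprS; ring.
(* At the junction x = 0, [flat_bound] is the quadratic estimate that makes the derivative
   vanish. *)
- rewrite !flat_le0 // mulr0 subr0.
  have [|d0 D0] := @quadratic_differentiable R (flat n) 0 (n.+2)`!%:R.
    by near=> y; rewrite subr0 real_normK ?num_real // ger0_norm ?flat_ge0 ?flat_bound.
  by apply: DeriveDef; [exact: diff_derivable|exact: D0].
Unshelve. all: by end_near. Qed.

Lemma Ck_flat k U f n : open U -> Ck k U f -> Ck k U (flat n \o f).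
Proof.
move=> oU; elim: k n => [|k IH] n Cf.
  move=> p Up; apply: continuous_comp; first exact: Cf.
  apply: differentiable_continuous; apply/derivable1_diffP.
  by have [] := is_derive_flat n (f p).
have df p := @CkS_diff _ _ _ p Cf.
pose d := fun x => flat n.+2 x - n%:R * flat n.+1 x.
apply: (@CkSP _ _ _ (fun i => (flat n.+2 \o f - cst n%:R * (flat n.+1 \o f)) * partial i f)) => //.
- by move=> p Up; exact: (@differentiable_comp1 _ d f p (df _ Up) (is_derive_flat _ _)).
- by move=> i p Up; rewrite (@partial_comp1 _ d f i p (df _ Up) (is_derive_flat _ _)).
- move=> i; apply: Ck_mul => //; last exact: CkS_partial.
  apply: Ck_sub_fun => //; first by apply: IH; exact: CkS.
  by apply: Ck_mul => //; [exact: Ck_cst|apply: IH; exact: CkS].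
Qed.

End PlaneFunctions.

(** * Boxes, bump functions and symmetry of second derivatives *)

Section Boxes.
Variable R : realType.
Local Notation plane := 'rV[R]_2.
Implicit Types (U V : set plane) (f g : plane -> R).

(** A ball of the sup norm, kept coordinatewise because the arguments below move one coordinate at a
    time, and moving it towards the center stays in the box. *)
Definition box (p : plane) (e : R) : set plane :=
  [set q | forall j, `|q 0 j - p 0 j| < e].

Lemma boxE p e : 0 < e -> box p e = ball p e.
Proof.
move=> e0; apply/seteqP; split=> q; rewrite /box /ball /=.
  by move=> H; split=> // i j; rewrite ord1 /ball /= distrC; exact: H.
by case=> _ H j; have := H 0 j; rewrite /ball /= distrC.
Qed.

Lemma box_center p e : 0 < e -> box p e p.
Proof. by move=> e0 j; rewrite subrr normr0. Qed.

Lemma nbhs_box p U : nbhs p U -> exists2 e, 0 < e & box p e `<=` U.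
Proof. by move/nbhs_ballP => [e /= e0 H]; exists e => //; rewrite boxE. Qed.

Lemma box_nbhs p e : 0 < e -> nbhs p (box p e).
Proof. by move=> e0; rewrite boxE //; exact: nbhsx_ballx. Qed.

Lemma open_box p e : open (box p e).
Proof.
have [e0|e0] := ltP 0 e; first by rewrite boxE //; exact: ball_open.
rewrite (_ : box p e = set0); first exact: open0.
apply/seteqP; split=> // q /(_ 0) /= H.
by have := le_lt_trans (normr_ge0 _) H; rewrite ltNge e0.
Qed.

Lemma open_subbox U p : open U -> U p -> exists2 e, 0 < e & box p e `<=` U.
Proof. by move=> oU Up; apply: nbhs_box; move: oU; rewrite openE; apply. Qed.

(** The usual smooth step, taken in s^2 to avoid the absolute value: it is 1 for |s| <= r/3 and 0
    for |s| >= r/2. *)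
Definition plateau (r : R) (s : R) : R :=
  flat 0 ((r / 2) ^+ 2 - s ^+ 2) /
  (flat 0 ((r / 2) ^+ 2 - s ^+ 2) + flat 0 (s ^+ 2 - (r / 3) ^+ 2)).

(** Since r/3 < r/2, at least one of the two arguments of [flat] is positive. *)
Lemma plateau_den (r s : R) : 0 < r ->
  0 < flat 0 ((r / 2) ^+ 2 - s ^+ 2) + flat 0 (s ^+ 2 - (r / 3) ^+ 2).
Proof.
move=> r0; have [H|H] := ltP (s ^+ 2) ((r / 2) ^+ 2).
  by rewrite ltr_pwDl ?flat_ge0 // flat_gt0 // subr_gt0.
rewrite ltr_wpDl ?flat_ge0 // flat_gt0 // subr_gt0 (lt_le_trans _ H) //.
by nra.
Qed.

Lemma plateau1 (r s : R) : 0 < r -> `|s| <= r / 3 -> plateau r s = 1.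
Proof.
move=> r0 sr; have := plateau_den s r0; rewrite /plateau.
rewrite [X in _ + X]flat_le0; first by rewrite addr0 => H; rewrite divff // gt_eqF.
by rewrite subr_le0 -[s ^+ 2]real_normK ?num_real // ler_pXn2r // ?nnegrE; lra.
Qed.

Lemma plateau0 (r s : R) : 0 < r -> r / 2 <= `|s| -> plateau r s = 0.
Proof.
move=> r0 sr; rewrite /plateau flat_le0 ?mul0r //.
by rewrite subr_le0 -[s ^+ 2]real_normK ?num_real // ler_pXn2r // ?nnegrE; lra.
Qed.

Lemma plane_bump (p : plane) (r : R) : 0 < r -> exists rho : plane -> R,
  [/\ smooth_plane setT rho,
      forall q : plane, (forall j, `|q 0 j - p 0 j| <= r / 3) -> rho q = 1 &
      forall (q : plane) j, r / 2 <= `|q 0 j - p 0 j| -> rho q = 0].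
Proof.
move=> r0; exists (fun q : plane => plateau r (q 0 0 - p 0 0) * plateau r (q 0 1 - p 0 1)).
split.
- have H j k : Ck k setT (fun q : plane => plateau r (q 0 j - p 0 j)).
    have oT := @openT plane.
    pose s : plane -> R := (fun q : plane => q 0 j) - cst (p 0 j).
    have Cs : Ck k setT s by apply: Ck_sub_fun => //; [exact: Ck_coord|exact: Ck_cst].
    have C1 : Ck k setT (flat 0 \o (cst ((r / 2) ^+ 2) - s * s)).
      by apply: Ck_flat => //; apply: Ck_sub_fun => //; [exact: Ck_cst|exact: Ck_mul].
    have C2 : Ck k setT (flat 0 \o (s * s - cst ((r / 3) ^+ 2))).
      by apply: Ck_flat => //; apply: Ck_sub_fun => //; [exact: Ck_mul|exact: Ck_cst].
    have C3 := Ck_add oT C1 C2.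
    have C3' : Ck k setT (fun q => ((flat 0 \o (cst ((r / 2) ^+ 2) - s * s)) q +
        (flat 0 \o (s * s - cst ((r / 3) ^+ 2))) q)^-1).
      by apply: (Ck_inv oT _ C3) => q _; apply: lt0r_neq0; exact: plateau_den.
    by apply: Ck_eq (Ck_mul oT C1 C3') => // q _.
  by move=> k; exact: (Ck_mul openT (H 0 k) (H 1 k)).
- by move=> q H; rewrite !plateau1 ?mulr1.
- move=> q j; case: (@eqP _ j 0) => [->|j0] H; first by rewrite plateau0 ?mul0r.
  have j1 : j = 1.
    by apply/val_inj; case: j j0 {H} => [[|[|//]] jlt] j0 //; case: j0; apply/val_inj.
  by rewrite [X in _ * X]plateau0 ?mulr0 -?j1.
Qed.

Lemma mvt_from0 (phi dphi : R -> R) (t : R) :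
  (forall s : R, `|s| <= `|t| -> is_derive s 1 phi (dphi s)) ->
  exists2 s : R, `|s| <= `|t| & phi t - phi 0 = dphi s * t.
Proof.
move=> H.
have cont (a b : R) : (forall s : R, s \in `[a, b] -> `|s| <= `|t|) ->
    {within `[a, b], continuous phi}.
  move=> ab; apply: derivable_within_continuous => x /ab /H dx.
  by case: dx.
have [t0|t0] := leP 0 t.
  have sub s : s \in `[0, t] -> `|s| <= `|t|.
    by rewrite in_itv /= => /andP[s0 st]; rewrite !ger0_norm.
  have [|c ct E] := @MVT_segment _ phi dphi 0 t t0 _ (cont _ _ sub).
    by move=> x xt; apply/H/sub/subset_itv_oo_cc.
  by exists c; [exact: sub|rewrite E subr0].
have sub s : s \in `[t, 0] -> `|s| <= `|t|.
  by rewrite in_itv /= => /andP[s0 st]; rewrite (ler0_norm st) (ler0_norm (ltW t0)) lerN2.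
have [|c ct E] := @MVT_segment _ phi dphi t 0 (ltW t0) _ (cont _ _ sub).
  by move=> x xt; apply/H/sub/subset_itv_oo_cc.
by exists c; [exact: sub|rewrite -opprB E sub0r mulrN opprK].
Qed.

Lemma is_derive_line f i (p : plane) (s : R) :
  differentiable f (p + s *: delta_mx 0 i) ->
  is_derive s 1 (fun s => f (p + s *: delta_mx 0 i)) (partial i f (p + s *: delta_mx 0 i)).
Proof.
move=> df; set v : plane := delta_mx 0 i.
have dl : is_diff s (fun s : R => p + s *: v) (fun h => h *: v).
  have -> : (fun s : R => p + s *: v) = cst p + (fun s => s *: v) by [].
  by have := is_diffD (is_diff_cst p s) (is_diff_scalel s v); rewrite add0r.
have [dl1 dl2] := dl.
have dc : differentiable (fun s : R => f (p + s *: v)) s.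
  exact: (@differentiable_comp _ _ _ _ (fun s : R => p + s *: v) f).
apply: DeriveDef; first exact/derivable1_diffP.
rewrite deriveE // (@diff_comp _ _ _ _ (fun s : R => p + s *: v) f) //=.
by rewrite dl2 scale1r /partial deriveE.
Qed.

(** Schwarz's theorem. The second difference of [f] over a square of side h is symmetric in the two
    directions; two applications of the mean value theorem, in either order, write it as h^2 times a
    mixed derivative at some point of the box. Continuity of both mixed derivatives at [p] then puts
    their values at [p] within any e > 0. *)
Lemma partial_comm f i j (p : plane) U : open U -> U p -> Ck 2 U f ->
  partial i (partial j f) p = partial j (partial i f) p.
Proof.
move=> oU Up Cf; have [->//|ij] := eqVneq i j.
have df q : U q -> differentiable f q by exact: CkS_diff Cf.
have dfi l q : U q -> differentiable (partial l f) q.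
  exact: CkS_diff (CkS_partial l Cf).
have cf l m : {for p, continuous (partial l (partial m f))}.
  exact: (CkS_partial l (CkS_partial m Cf)) Up.
apply/eqP; rewrite -subr_eq0 -normr_le0; apply/ler_addgt0Pl => e e0; rewrite addr0.
have nU : nbhs p U by move: oU; rewrite openE; apply.
have e2 : 0 < e / 2 by rewrite divr_gt0.
have /cvgrPdist_lt /(_ _ e2) c1 := cf i j.
have /cvgrPdist_lt /(_ _ e2) c2 := cf j i.
have [d d0 dU] := nbhs_box (filterI nU (filterI c1 c2)).
pose h := d / 2; have h0 : 0 < h by rewrite divr_gt0.
have hd : h < d by rewrite /h; lra.
have dbl (k l : 'I_2) : k != l -> exists2 q, box p d q &
    f (p + h *: delta_mx 0 k + h *: delta_mx 0 l) - f (p + h *: delta_mx 0 k)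
    - f (p + h *: delta_mx 0 l) + f p = partial l (partial k f) q * h * h.
  move=> kl; pose phi s := f (p + h *: delta_mx 0 l + s *: delta_mx 0 k) - f (p + s *: delta_mx 0 k).
  pose dphi s := partial k f (p + h *: delta_mx 0 l + s *: delta_mx 0 k) - partial k f (p + s *: delta_mx 0 k).
  have inB (s t : R) : `|s| <= h -> `|t| <= h -> box p d (p + s *: delta_mx 0 l + t *: delta_mx 0 k).
    move=> sh th m; rewrite !mxE eqxx /=.
    have -> : p 0 m + s * (m == l)%:R + t * (m == k)%:R - p 0 m = s * (m == l)%:R + t * (m == k)%:R by ring.
    have [->|mk] := eqVneq m k.
      by rewrite (negbTE kl) mulr0 add0r mulr1 (le_lt_trans th).
    rewrite mulr0 addr0; apply: le_lt_trans hd.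
    by case: eqP => _; rewrite ?mulr1 ?mulr0 ?normr0 // ltW.
  have inB0 (s : R) : `|s| <= h -> box p d (p + s *: delta_mx 0 k).
    by move=> sh; have := inB 0 s; rewrite scale0r addr0 normr0; apply; rewrite // ltW.
  have [|s sh E1] := @mvt_from0 phi dphi h.
    move=> s; rewrite (gtr0_norm h0) => sh; rewrite /phi /dphi.
    have hh : `|h| <= h by rewrite gtr0_norm.
    have H1 := is_derive_line (df _ (dU _ (inB h s hh sh)).1).
    have H2 := is_derive_line (df _ (dU _ (inB0 s sh)).1).
    exact: (is_deriveB H1 H2).
  rewrite (gtr0_norm h0) in sh.
  pose psi t := partial k f (p + s *: delta_mx 0 k + t *: delta_mx 0 l).
  pose dpsi t := partial l (partial k f) (p + s *: delta_mx 0 k + t *: delta_mx 0 l).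
  have [|t th E2] := @mvt_from0 psi dpsi h.
    move=> t; rewrite (gtr0_norm h0) => th; apply: is_derive_line; apply: dfi.
    rewrite addrAC; exact: (dU _ (inB _ _ th sh)).1.
  rewrite (gtr0_norm h0) in th.
  exists (p + s *: delta_mx 0 k + t *: delta_mx 0 l); first by rewrite addrAC; exact: inB.
  rewrite -[partial l _ _]/(dpsi t) -E2 /psi scale0r addr0.
  rewrite [p + s *: _ + _]addrAC -[X in X * h]/(dphi s) -E1 /phi scale0r !addr0.
  rewrite [p + h *: delta_mx 0 l + _]addrAC.
  by move: (f _) (f _) (f _) (f _) => a b c d'; ring.
have [q1 q1d E1] := dbl i j ij; have ji : j != i by rewrite eq_sym.
have [q2 q2d E2] := dbl j i ji.
have E : partial j (partial i f) q1 = partial i (partial j f) q2.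
  apply: (mulIf (lt0r_neq0 h0)); apply: (mulIf (lt0r_neq0 h0)).
  by apply: etrans (esym E1) (etrans _ E2); rewrite [p + h *: delta_mx 0 j + _]addrAC [X in X + f p]addrAC.
have /= H1 := (dU _ q2d).2.1; have /= H2 := (dU _ q1d).2.2.
rewrite -E in H1.
rewrite -[X in `|X|](subrKA (partial j (partial i f) q1)).
apply: le_trans (ler_normD _ _) _; rewrite [X in _ + X]distrC.
by apply: ltW; rewrite (splitr e); exact: ltrD H1 H2.
Qed.

End Boxes.

Section SmoothPlane.
Variable R : realType.
Local Notation plane := 'rV[R]_2.
Implicit Types (U V : set plane) (f g : plane -> R).

Lemma smooth_plane_diff U f p : smooth_plane U f -> U p -> differentiable f p.
Proof. by move=> /(_ 1) /CkS_diff; apply. Qed.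

Lemma smooth_plane_partial U f i : smooth_plane U f -> smooth_plane U (partial i f).
Proof. by move=> sf k; apply: CkS_partial; exact: sf. Qed.

Lemma smooth_plane_is_derive U f p i : smooth_plane U f -> U p ->
  is_derive p (delta_mx 0 i) f (partial i f p).
Proof.
move=> sf Up; apply: DeriveDef => //.
by apply: diff_derivable; exact: smooth_plane_diff sf Up.
Qed.

End SmoothPlane.

(** * Smooth division by a coordinate, and Hadamard's lemma *)

Section Division.
Variables (R : realType) (p : 'rV[R]_2) (r : R) (i : 'I_2).
Local Notation plane := 'rV[R]_2.
Local Notation B := (box p r).
Implicit Types (f g : plane -> R) (q : plane).

Let oB : open B. Proof. exact: open_box. Qed.

Let t q : R := q 0 i - p 0 i.
Let proj q : plane := q - t q *: delta_mx 0 i.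
Let D n f := iter n (partial i) f.
Let T n f q := \sum_(k < n) t q ^+ k / k`!%:R * D k f (proj q).
Let Rm n f q := f q - T n f q.
(* [h n f] is the n-th Taylor remainder in x_i divided by t^n.  It is smooth
   because its derivative along x_i is [h n (partial i f) - n h n.+1 f]. *)
Let h n f q := if t q == 0 then D n f (proj q) / n`!%:R else Rm n f q / t q ^+ n.

Let projE q j : proj q 0 j = if j == i then p 0 i else q 0 j.
Proof.
rewrite /proj /t !mxE eqxx /=; case: eqP => [->|_]; rewrite ?mulr1 ?mulr0 ?subr0 //; ring.
Qed.

Let proj_box (q0 : plane) e q : q0 0 i = p 0 i -> box q0 e q -> box q0 e (proj q).
Proof.
move=> q0p H j; rewrite projE; case: eqP => [->|_]; last exact: H.
by rewrite q0p subrr normr0 (le_lt_trans _ (H i)).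
Qed.

Let projB q : B q -> B (proj q).
Proof. exact: proj_box. Qed.

Let t_smooth : smooth_plane B t.
Proof.
move=> k; apply: Ck_sub_fun; [exact: open_box| |exact: Ck_cst].
by apply: Ck_coord; exact: open_box.
Qed.

Let proj_smooth j : smooth_plane B (fun q => proj q 0 j).
Proof.
move=> k; case: (eqVneq j i) => ji.
  apply: (@Ck_eq R k B (cst (p 0 i)) _ oB); last exact: Ck_cst.
  by move=> q _; rewrite projE ji eqxx.
apply: (@Ck_eq R k B (fun q : plane => q 0 j) _ oB); last by apply: Ck_coord.
by move=> q _; rewrite projE (negbTE ji).
Qed.

Let comp_proj_smooth f : smooth_plane B f -> smooth_plane B (f \o proj).
Proof.
move=> sf k; apply: (Ck_comp (V := B)); try exact: open_box.
- exact: projB.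
- by move=> j; exact: proj_smooth.
- exact: sf.
Qed.

Let partial_t q j : B q -> partial j t q = (j == i)%:R.
Proof.
move=> Bq; have : is_derive q (delta_mx 0 j) t ((j == i)%:R - 0).
  apply: is_deriveB; rewrite -(partial_coord j i q); apply: DeriveDef => //.
  by apply: diff_derivable; exact: differentiable_coord.
by case=> _; rewrite subr0.
Qed.

Let partial_proj f q j : smooth_plane B f -> B q ->
  partial j (f \o proj) q = if j == i then 0 else partial j f (proj q).
Proof.
move=> sf Bq; rewrite partial_comp; first last.
- by apply: smooth_plane_diff sf _; exact: projB.
- by move=> l; exact: smooth_plane_diff (@proj_smooth l) Bq.
have E l : partial j (fun q => proj q 0 l) q = if l == i then 0 else (j == l)%:R.
  case: eqP => [->|/eqP li].
    rewrite (_ : (fun q => proj q 0 i) = cst (p 0 i)); first exact: derive_cst.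
    by apply/funext => q'; rewrite projE eqxx.
  rewrite (_ : (fun q => proj q 0 l) = fun q : plane => q 0 l) ?partial_coord //.
  by apply/funext => q'; rewrite projE (negbTE li).
under eq_bigr do rewrite E.
case: (eqVneq j i) => [->|ji].
  by rewrite big1 // => l _; case: eqVneq => [_|il]; rewrite ?mulr0 // eq_sym (negbTE il) mulr0.
rewrite (bigD1 j) //= (negbTE ji) eqxx mulr1 big1 ?addr0 // => l lj.
by case: ifP => _; rewrite ?mulr0 // [j == l]eq_sym (negbTE lj) mulr0.
Qed.

Let D_smooth n f : smooth_plane B f -> smooth_plane B (D n f).
Proof. by move=> sf; elim: n => //= n IH; exact: smooth_plane_partial. Qed.

Let D_comm n f j q : smooth_plane B f -> B q ->
  D n (partial j f) q = partial j (D n f) q.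
Proof.
move=> sf; elim: n q => //= n IH q Bq.
rewrite {1}/partial (near_eq_derive _ (near_open oB Bq IH)).
apply: partial_comm Bq _; first exact: open_box.
exact: D_smooth.
Qed.

Let T_smooth n f : smooth_plane B f -> smooth_plane B (T n f).
Proof.
move=> sf k; rewrite /T; elim: n => [|n IH].
  apply: (@Ck_eq R k B (cst 0) _ oB); last exact: Ck_cst.
  by move=> q _; rewrite big_ord0.
have C1 : Ck k B (fun q => t q ^+ n / n`!%:R).
  elim: n {IH} (n`!%:R : R) => [|n IH] c.
    by under eq_fun do rewrite expr0; exact: Ck_cst.
  apply: (@Ck_eq R k B _ _ oB _ (Ck_mul oB (t_smooth k) (IH c))).
  by move=> q _; rewrite fctE exprS mulrA.
apply: (@Ck_eq R k B _ _ oB _ (Ck_add oB IH (Ck_mul oB C1 (comp_proj_smooth (D_smooth n sf) k)))).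
by move=> q _; rewrite big_ord_recr.
Qed.

Let Rm_smooth n f : smooth_plane B f -> smooth_plane B (Rm n f).
Proof.
move=> sf k; apply: Ck_sub_fun; [exact: open_box|exact: sf|exact: T_smooth].
Qed.

Let is_derive_pow q j n : B q ->
  is_derive q (delta_mx 0 j) (fun q => t q ^+ n) (n%:R * t q ^+ n.-1 * (j == i)%:R).
Proof.
move=> Bq; have H := smooth_plane_is_derive j t_smooth Bq.
rewrite partial_t // in H.
by have := is_deriveX n H; rewrite exprfctE.
Qed.

Let is_derive_term n f q j : smooth_plane B f -> B q ->
  is_derive q (delta_mx 0 j) (fun q => t q ^+ n / n`!%:R * D n f (proj q))
   (if j == i then n%:R * t q ^+ n.-1 / n`!%:R * D n f (proj q)
    else t q ^+ n / n`!%:R * D n (partial j f) (proj q)).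
Proof.
move=> sf Bq; have H1 := is_derive_pow j n Bq.
have H2 := smooth_plane_is_derive j (comp_proj_smooth (D_smooth n sf)) Bq.
have H3 := is_deriveM (is_deriveM H1 (@is_derive_cst R plane R (n`!%:R^-1) q (delta_mx 0 j))) H2.
apply: (is_derive_eq H3); rewrite (partial_proj j (D_smooth n sf) Bq).
rewrite /GRing.scale /= !fctE /=; case: eqP => [_|_].
  by rewrite !mulr0 !add0r mulr1; ring.
by rewrite !mulr0 !addr0 D_comm //; [ring|exact: projB].
Qed.

Let partial_T n f q j : smooth_plane B f -> B q ->
  is_derive q (delta_mx 0 j) (T n f)
    (if j == i then T n.-1 (partial i f) q else T n (partial j f) q).
Proof.
move=> sf Bq; elim: n => [|n IH].
  have T0 g : T 0 g = cst 0 by apply/funext => q'; rewrite /T big_ord0.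
  rewrite [0.-1]/= !T0 if_same; exact: is_derive_cst.
have -> : T n.+1 f = T n f + (fun q => t q ^+ n / n`!%:R * D n f (proj q)).
  by apply/funext => q'; rewrite /T big_ord_recr.
apply: (is_derive_eq (is_deriveD IH (is_derive_term n j sf Bq))).
case: eqP => [_|_] /=; last by rewrite /T big_ord_recr.
case: n {IH} => [|n]; first by rewrite /= /T !big_ord0 !mul0r addr0.
rewrite /= /T big_ord_recr; congr (_ + _).
have -> : partial i (D n f) = D n (partial i f) by rewrite /D -iterS iterSr.
congr (_ * _); rewrite factS natrM.
have : (n`!%:R : R) != 0 by rewrite pnatr_eq0 -lt0n fact_gt0.
have : (n.+1%:R : R) != 0 by rewrite pnatr_eq0.
move: (n`!%:R : R) (n.+1%:R : R) (t q ^+ n) => a b c b0 a0.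
by field; rewrite a0 b0.
Qed.

Let partial_Rm n f q j : smooth_plane B f -> B q ->
  partial j (Rm n f) q = if j == i then Rm n.-1 (partial i f) q else Rm n (partial j f) q.
Proof.
move=> sf Bq.
have [_] := is_deriveB (smooth_plane_is_derive j sf Bq) (partial_T n j sf Bq).
by rewrite /partial /Rm => ->; case: eqP => [->|].
Qed.

(** On the line t = 0 the remainder of positive order vanishes, and its derivative along x_i is the
    remainder of one order less of [partial i f]; the mean value theorem on the segment from
    [proj q] to [q] thus gains a factor t at each step of the induction. Continuity at [q0] starts
    it. *)
Let Rm_bound n f q0 : smooth_plane B f -> B q0 -> t q0 = 0 ->
  exists C d, [/\ 0 < d, 0 <= C, box q0 d `<=` B &
    forall q, box q0 d q -> `|Rm n f q| <= C * `|t q| ^+ n].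
Proof.
move=> + Bq0 tq0; elim: n f => [|n IH] f sf.
  have /cvgrPdist_lt /(_ _ ltr01) c1 := sf 0%N _ Bq0.
  have nB : nbhs q0 B by move: oB; rewrite openE; apply.
  have [d d0 dU] := nbhs_box (filterI nB c1).
  exists (`|f q0| + 1), d; split=> //.
    by move=> q /dU[].
  move=> q /dU[_ /= H]; rewrite /Rm /T big_ord0 subr0 expr0 mulr1.
  rewrite -[f q](subrKC (f q0)) (le_trans (ler_normD _ _)) // lerD2l ltW //.
  by rewrite distrC.
have [C [d [d0 C0 dB H]]] := IH _ (smooth_plane_partial i sf).
exists C, d; split=> // q dq.
have q0p : q0 0 i = p 0 i by apply/eqP; rewrite -subr_eq0 -/(t q0) tq0.
pose l s : plane := proj q + s *: delta_mx 0 i.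
have lE s j : l s 0 j = if j == i then p 0 i + s else q 0 j.
  rewrite /l mxE projE !mxE eqxx /=.
  by case: eqP => [_|_]; rewrite ?mulr1 ?mulr0 ?addr0.
have tl s : t (l s) = s by rewrite /t lE eqxx addrC addKr.
have lt' : l (t q) = q by rewrite /l /proj subrK.
have ld s : `|s| <= `|t q| -> box q0 d (l s).
  move=> st j; rewrite lE; case: eqP => [ji|_]; last exact: dq.
  by rewrite ji q0p addrC addKr (le_lt_trans st) // /t -q0p; exact: dq.
have [|s st E] := @mvt_from0 _ (fun s => Rm n.+1 f (l s)) (fun s => Rm n (partial i f) (l s)) (t q).
  move=> s st; have Bl : B (l s) by apply/dB/ld.
  have := is_derive_line (smooth_plane_diff (@Rm_smooth n.+1 f sf) Bl).
  by rewrite -/(l s) partial_Rm // eqxx.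
have E0 : Rm n.+1 f (l 0) = 0.
  rewrite /Rm /T big_ord_recl tl expr0 big1 ?addr0 => [|k _].
    rewrite fact0 divr1 mul1r /= /D /=.
    by rewrite (_ : proj (l 0) = l 0) ?subrr // /proj tl scale0r subr0.
  by rewrite lift0 expr0n /= !mul0r.
rewrite lt' E0 subr0 in E; rewrite E normrM exprSr mulrA.
rewrite ler_wpM2r // (le_trans (H _ (ld _ st))) // tl.
by rewrite ler_wpM2l // lerXn2r // ?nnegrE.
Qed.

Let fact_neq0 n : (n`!%:R : R) != 0.
Proof. by rewrite pnatr_eq0 -lt0n fact_gt0. Qed.

(** On the line t = 0, [h n f] is split as F + K: F consists of the next two Taylor terms divided by
    t^n and is smooth, while K is the remainder of order n + 2 divided by t^n, hence O(t^2), and has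
    zero differential by [quadratic_differentiable]. *)
Let h_derive0 n f q : smooth_plane B f -> B q -> t q = 0 ->
  differentiable (h n f) q /\ forall j, partial j (h n f) q =
    if j == i then h n (partial i f) q - n%:R * h n.+1 f q else h n (partial j f) q.
Proof.
move=> sf Bq t0.
pose F := (fun q => n`!%:R^-1 * D n f (proj q)) + (fun q => n.+1`!%:R^-1 * (t q * D n.+1 f (proj q))).
pose K q' := h n f q' - F q'.
have hE : h n f = F + K by apply/funext => q'; rewrite /K !fctE; ring.
have sF : smooth_plane B F.
  move=> k; apply: Ck_add => //.
    exact: (Ck_mul oB (Ck_cst k B _) (comp_proj_smooth (D_smooth n sf) k)).
  apply: (Ck_mul oB (Ck_cst k B _)).
  exact: (Ck_mul oB (t_smooth k) (comp_proj_smooth (D_smooth n.+1 sf) k)).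
have [C [d [d0 C0 dB H]]] := Rm_bound n.+2 sf Bq t0.
have KE q' : K q' = if t q' == 0 then 0 else Rm n.+2 f q' / t q' ^+ n.
  rewrite /K /h /F !fctE; case: eqP => [->|/eqP t1]; first by ring.
  rewrite /Rm /T !big_ord_recr /= !exprS.
  have : t q' ^+ n != 0 by rewrite expf_neq0.
  have := fact_neq0 n; have := fact_neq0 n.+1.
  move: (t q' ^+ n) (n`!%:R : R) (n.+1`!%:R : R) => a b c c0 b0 a0.
  by field; rewrite a0 b0 c0.
have [|dK K0] := @quadratic_differentiable R plane K q C.
  apply: filterS (box_nbhs q d0) => q' dq; rewrite KE; case: eqP => [_|/eqP t1].
    by rewrite normr0 mulr_ge0 ?sqr_ge0.
  rewrite normrM normfV normrX ler_pdivrMr ?exprn_gt0 ?normr_gt0 //.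
  apply: le_trans (H _ dq) _; rewrite -mulrA ler_wpM2l // -addn2 exprD mulrC.
  rewrite ler_wpM2r ?exprn_ge0 // lerXn2r // ?nnegrE //.
  have -> : t q' = (q' - q) 0 i.
    by rewrite !mxE /t; move: t0; rewrite /t => /subr0_eq ->.
  by rewrite /Num.norm /= mx_normrE; apply: (le_bigmax _ (fun x : 'I_1 * 'I_2 => `|(q' - q) x.1 x.2|) (0, i)).
have dF := smooth_plane_diff sF Bq.
split=> [|j]; first by rewrite hE; exact: differentiableD.
have -> : partial j (h n f) q = partial j F q.
  by rewrite hE /partial deriveD ?K0 ?addr0 //; exact: diff_derivable.
have H1 := smooth_plane_is_derive j (comp_proj_smooth (D_smooth n sf)) Bq.
have H2 := smooth_plane_is_derive j (comp_proj_smooth (D_smooth n.+1 sf)) Bq.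
have H3 := smooth_plane_is_derive j t_smooth Bq.
have [_] := is_deriveD (is_deriveM (@is_derive_cst R plane R (n`!%:R^-1) q (delta_mx 0 j)) H1)
  (is_deriveM (@is_derive_cst R plane R (n.+1`!%:R^-1) q (delta_mx 0 j)) (is_deriveM H3 H2)).
rewrite -/(partial j F q) => ->.
rewrite !partial_proj ?partial_t //; try exact: D_smooth.
rewrite /GRing.scale /= t0 /h t0 eqxx !mulr0 !mul0r !addr0 !add0r.
case: eqP => [_|_]; last by rewrite !mulr0 addr0 (D_comm n j sf (projB Bq)) mulrC.
have -> : D n (partial i f) = D n.+1 f by rewrite /D -iterSr.
rewrite -[partial i (D n f)]/(D n.+1 f) mulr0 add0r mulr1 factS natrM.
have : (n.+1%:R : R) != 0 by rewrite pnatr_eq0.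
have := fact_neq0 n; rewrite -natr1 /=.
move: (D n.+1 f (proj q)) (n`!%:R : R) (n%:R : R) => a b c b0 c0.
by field; rewrite c0 b0.
Qed.

Let h_derive1 n f q : smooth_plane B f -> B q -> t q != 0 ->
  differentiable (h n f) q /\ forall j, partial j (h n f) q =
    if j == i then h n (partial i f) q - n%:R * h n.+1 f q else h n (partial j f) q.
Proof.
move=> sf Bq t0.
have nt : \forall q' \near q, ((fun q => (t q)^-1) ^+ n * Rm n f) q' = h n f q'.
  have ct : {for q, continuous t} by exact: t_smooth 0%N _ Bq.
  have : \forall q' \near q, t q' != 0.
    have := @cvgr_neq0 _ _ _ (nbhs q) _ t (t q) ct t0; exact.
  by apply: filterS => q' t1; rewrite /h (negbTE t1) !fctE exprVn mulrC.
have dt j := smooth_plane_is_derive j t_smooth Bq.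
have dV j : is_derive q (delta_mx 0 j) (fun q => (t q)^-1) (- (t q) ^- 2 * (j == i)%:R).
  have := dt j; rewrite partial_t // => -[d1 d2].
  apply: DeriveDef; first by move: d1; exact: derivableV.
  by rewrite deriveV // d2.
have dVd : differentiable (fun q => (t q)^-1) q.
  by apply: differentiableV => //; exact: smooth_plane_diff t_smooth Bq.
have dR := smooth_plane_diff (Rm_smooth n sf) Bq.
split.
  apply: near_eq_differentiable nt _; apply: differentiableM => //.
  case: n {sf dR} => [|m]; last exact: differentiableX.
  exact: differentiable_cst.
move=> j; rewrite /partial -(near_eq_derive _ nt).
have [_ ->] := is_deriveM (is_deriveX n (dV j)) (smooth_plane_is_derive j (Rm_smooth n sf) Bq).
rewrite partial_Rm // /GRing.scale /= /h (negbTE t0) !fctE.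
case: eqP => [_|_]; last first.
  by rewrite !mulr0 addr0 exprVn mulrC.
case: n {nt dR} => [|m]; first by rewrite !expr0 mulr0n /= invr1; ring.
(* Both remainders are brought to order m + 1, after which the claim is an identity of rational
   functions in t. *)
have -> : Rm m (partial i f) q = Rm m.+1 (partial i f) q + t q ^+ m / m`!%:R * D m.+1 f (proj q).
  by rewrite /Rm /T big_ord_recr /D -iterSr /=; ring.
have -> : Rm m.+2 f q = Rm m.+1 f q - t q ^+ m.+1 / m.+1`!%:R * D m.+1 f (proj q).
  by rewrite /Rm /T [X in _ - X = _]big_ord_recr /=; ring.
rewrite /= !exprVn !exprS factS natrM.
have : t q ^+ m != 0 by rewrite expf_neq0.
have : (m.+1%:R : R) != 0 by rewrite pnatr_eq0.
have := fact_neq0 m.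
move: (t q ^+ m) (m`!%:R : R) (m.+1%:R : R) => a b c b0 c0 a0.
by field; rewrite a0 t0 b0 c0.
Qed.

Let h_smooth n f : smooth_plane B f -> smooth_plane B (h n f).
Proof.
move=> + k; elim: k n f => [|k IH] n f sf.
  move=> q Bq; apply: differentiable_continuous.
  by have [t0|t0] := eqVneq (t q) 0; [case: (h_derive0 n sf Bq t0)|case: (h_derive1 n sf Bq t0)].
pose d j := if j == i then h n (partial i f) - cst n%:R * h n.+1 f else h n (partial j f).
apply: (@CkSP _ _ _ _ d) => //.
- move=> q Bq.
  by have [t0|t0] := eqVneq (t q) 0; [case: (h_derive0 n sf Bq t0)|case: (h_derive1 n sf Bq t0)].
- move=> j q Bq; rewrite /d.
  by have [t0|t0] := eqVneq (t q) 0; [case: (h_derive0 n sf Bq t0)|case: (h_derive1 n sf Bq t0)]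
    => _ ->; case: ifP.
- move=> j; rewrite /d; case: ifP => _; last by apply: IH; exact: smooth_plane_partial.
  apply: Ck_sub_fun => //; first by apply: IH; exact: smooth_plane_partial.
  by apply: Ck_mul => //; [exact: Ck_cst|exact: IH].
Qed.

Lemma smooth_division f : smooth_plane B f -> exists2 g, smooth_plane B g &
  forall q, B q -> f q = f (q - (q 0 i - p 0 i) *: delta_mx 0 i) + (q 0 i - p 0 i) * g q.
Proof.
move=> sf; exists (h 1 f); first exact: h_smooth.
move=> q Bq; rewrite -/(t q) -/(proj q) /h; case: eqP => [t0|/eqP t0].
  by rewrite t0 mul0r addr0 /proj t0 scale0r subr0.
by rewrite /Rm /T big_ord1 expr0 fact0 divr1 mul1r expr1 mulrC divfK // subrKC.
Qed.

End Division.

(** Division along the first axis, then division along the second of the restriction to the line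
    where the first coordinate is that of [p]. Through this expansion a derivation is determined by
    its values on the coordinates. *)
Lemma smooth_hadamard (R : realType) (p : 'rV[R]_2) (r : R) (f : 'rV[R]_2 -> R) :
  smooth_plane (box p r) f -> exists2 g : 'I_2 -> 'rV[R]_2 -> R,
    forall i, smooth_plane (box p r) (g i) &
    forall q, box p r q -> f q = f p + \sum_i (q 0 i - p 0 i) * g i q.
Proof.
move=> sf; have [g0 s0 E0] := smooth_division 0 sf.
have oB : open (box p r) by exact: open_box.
pose pr (q : 'rV[R]_2) := q - (q 0 0 - p 0 0) *: delta_mx 0 0.
have prE q j : pr q 0 j = if j == 0 then p 0 0 else q 0 j.
  by rewrite /pr !mxE eqxx /=; case: eqP => [->|_]; rewrite ?mulr1 ?mulr0 ?subr0 ?subKr.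
have prB q : box p r q -> box p r (pr q).
  move=> H j; rewrite prE; case: eqP => [->|_]; last exact: H.
  by rewrite subrr normr0 (le_lt_trans _ (H 0)).
have sfp : smooth_plane (box p r) (f \o pr).
  move=> k; apply: (Ck_comp (V := box p r)) => // j.
  have [->|j0] := eqVneq j 0.
    apply: (@Ck_eq R k _ (cst (p 0 0)) _ oB); last exact: Ck_cst.
    by move=> q _; rewrite prE eqxx.
  apply: (@Ck_eq R k _ (fun q : 'rV[R]_2 => q 0 j) _ oB); last exact: Ck_coord.
  by move=> q _; rewrite prE (negbTE j0).
have [g1 s1 E1] := smooth_division 1 sfp.
exists (fun i => if i == 0 then g0 else g1); first by move=> i; case: ifP.
move=> q Bq; rewrite (E0 _ Bq) -/(pr q) -[f (pr q)]/((f \o pr) q) (E1 _ Bq) /=.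
rewrite big_ord_recl big_ord1 /=.
have -> : lift ord0 ord0 = 1 :> 'I_2 by apply/val_inj.
rewrite (_ : pr _ = p); first by rewrite -addrA [X in _ + X]addrC.
apply/rowP => j; rewrite prE; case: eqP => [->//|/eqP j0].
have -> : j = 1 by apply/val_inj; case: j j0 => [[|[|//]] ?].
by rewrite !mxE eqxx mulr1 subKr.
Qed.

(** * Smooth functions and local frames on a surface *)

Section SmoothManifold.
Variables (R : realType) (M : oriented_surface R).
Local Notation C := (Cinf M).
Local Notation plane := 'rV[R]_2.
Implicit Types (x y : M) (U W : set M) (F G : M -> R) (c : chart R M).

Lemma open_preim_coord c (V : set plane) : open V ->
  open [set y | chart_dom c y /\ V (coord c y)].
Proof.
move=> oV; rewrite openE => y [cy Vy]; rewrite /interior.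
have nd : \forall z \near y, chart_dom c z.
  by have := @open_chart_dom _ _ c; rewrite openE; apply.
have nV : \forall z \near y, V (coord c z).
  by apply: (continuous_coord cy); move: oV; rewrite openE; apply.
by apply: filterS2 nd nV.
Qed.

Lemma icoord_dom c p : (coord c @` chart_dom c) p -> chart_dom c (icoord c p).
Proof. by move=> [y cy <-]; rewrite coordK. Qed.

Lemma icoordK c p : (coord c @` chart_dom c) p -> coord c (icoord c p) = p.
Proof. by move=> [y cy <-]; rewrite coordK. Qed.

Definition smooth_at x F := exists W, [/\ open W, W x & smooth_on W F].

Lemma smooth_on_local W F : (forall x, W x -> smooth_at x F) -> smooth_on W F.
Proof.
move=> H c ac k; apply: Ck_local => _ [x [cx Wx] <-].
have [W' [oW W'x sF]] := H _ Wx; exists (chart_img c W'); split; last exact: sF.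
by exists x.
Qed.

Lemma smooth_atP F : (forall x, smooth_at x F) -> F \in @smooth_pred R M.
Proof. by move=> H; apply/asboolP; apply: smooth_on_local => x _. Qed.

Lemma Cinf_smooth_at (f : C) x : smooth_at x f.
Proof. by exists setT; split=> //; [exact: openT|have /asboolP := Cinf_smooth f]. Qed.

(** One chart is enough because the changes of coordinates are smooth. *)
Lemma smooth_at_chart c (V : set plane) x F : atlas c -> chart_dom c x ->
  open V -> V (coord c x) -> smooth_plane V (F \o icoord c) -> smooth_at x F.
Proof.
move=> ac cx oV Vx sF; set Q := [set y | chart_dom c y /\ V (coord c y)].
have oQ : open Q by exact: open_preim_coord.
exists Q; split=> // c' ac' k.
have oU := @open_chart_img _ _ c' _ oQ.
have H : Ck k (chart_img c' Q) ((F \o icoord c) \o (fun q => coord c (icoord c' q))).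
  apply: (Ck_comp (V := V)) => //.
  - by move=> _ [y [c'y [cy Vy]] <-]; rewrite coordK.
  - move=> j; apply: Ck_sub (atlas_smooth ac' ac j k).
    by move=> _ [y [c'y [cy _]] <-]; exists y.
apply: Ck_eq H => // _ [y [c'y [cy _]] <-] /=.
by rewrite !coordK.
Qed.

Lemma near_openP x (P : M -> Prop) : (\forall y \near x, P y) ->
  exists Q, [/\ open Q, Q x & forall y, Q y -> P y].
Proof.
have := nbhsE x => E; rewrite /prop_near1 E => -[Q [oQ Ox] H]; by exists Q.
Qed.

Lemma smooth_at_near x F G : (\forall y \near x, F y = G y) ->
  smooth_at x F -> smooth_at x G.
Proof.
move=> /near_openP [Q [oQ Ox FG]] [W [oW Wx sF]].
exists (W `&` Q); split=> //; first exact: openI.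
have sF' : smooth_on (W `&` Q) F.
  exact: (smooth_on_sub (openI oW oQ) oW (@subIsetl _ _ _) sF).
move=> c ac k; apply: Ck_eq (sF' c ac k); first exact/open_chart_img/openI.
by move=> _ [y [cy [_ Oy]] <-] /=; rewrite coordK //; exact: FG.
Qed.

Lemma smooth_at_cst x a : smooth_at x (cst a).
Proof. by exists setT; split=> //; [exact: openT|exact: smooth_on_cst]. Qed.

Lemma smooth_at_mul x F G : smooth_at x F -> smooth_at x G -> smooth_at x (F * G).
Proof.
move=> [U [oU Ux sF]] [V [oV Vx sG]]; have oI := openI oU oV.
exists (U `&` V); split=> //; apply: smooth_on_mul => //.
  exact: (smooth_on_sub oI oU (@subIsetl _ _ _) sF).
exact: (smooth_on_sub oI oV (@subIsetr _ _ _) sG).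
Qed.

Lemma smooth_on_inv W F : open W -> (forall y, W y -> F y != 0) ->
  smooth_on W F -> smooth_on W (fun y => (F y)^-1).
Proof.
move=> oW F0 sF c ac k; apply: Ck_inv (sF c ac k); first exact: open_chart_img.
by move=> _ [y [cy Wy] <-] /=; rewrite coordK //; exact: F0.
Qed.

Lemma smooth_on_inv_cbrt W F : open W -> (forall y, W y -> F y != 0) ->
  smooth_on W F -> smooth_on W (fun y => inv_cbrt (F y)).
Proof.
move=> oW F0 sF c ac k; apply: Ck_inv_cbrt (sF c ac k); first exact: open_chart_img.
by move=> _ [y [cy Wy] <-] /=; rewrite coordK //; exact: F0.
Qed.

Lemma Cinf_smooth_on U (f : C) : open U -> smooth_on U f.
Proof.
move=> oU; have /asboolP := Cinf_smooth f.
by apply: smooth_on_sub => //; exact: openT.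
Qed.

Lemma open_near U x : open U -> U x -> \forall y \near x, U y.
Proof. by rewrite openE => oU /oU. Qed.

Lemma closed_box_compact (p : plane) (e : R) :
  compact [set q : plane | forall j, `|q 0 j - p 0 j| <= e].
Proof.
have := @rV_compact _ _ (fun j : 'I_2 => `[p 0 j - e, p 0 j + e]%classic).
move=> /(_ (fun j => @segment_compact R (p 0 j - e) (p 0 j + e))); congr compact.
apply/seteqP; split=> q H j; have := H j; rewrite /= in_itv /= ler_distl;
  by [].
Qed.

(** A bump on the plane carried over by a chart and extended by 0. The last clause asks for
    vanishing near, and not only at, each point outside [U]: products with functions that are smooth
    on [U] alone then extend by 0. *)
Lemma cutoff x U : open U -> U x -> exists (b : C) (Q : set M),
  [/\ open Q, Q x, Q `<=` U, forall y, Q y -> b y = 1 &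
      forall y, ~ U y -> \forall z \near y, b z = 0].
Proof.
move=> oU Ux; have [c ac cx] := atlas_cover x.
set p := coord c x.
have [r r0 rU] : exists2 r, 0 < r & box p r `<=` chart_img c U.
  by apply: open_subbox; [exact: open_chart_img|exists x].
have [rho [srho rho1 rho0]] := plane_bump p r0.
pose B y := if pselect (chart_dom c y) then rho (coord c y) else 0.
pose K0 : set plane := [set q : plane | forall j, `|q 0 j - p 0 j| <= r / 2].
have K0box : K0 `<=` box p r.
  by move=> q H j; apply: le_lt_trans (H j) _; lra.
have K0r q : K0 q -> (coord c @` chart_dom c) q.
  by move=> /K0box /rU [y [cy _] <-]; exists y.
(* This compact set is closed because M is Hausdorff, so the extension by 0 is smooth beyond the
   chart domain as well. *)
have cK : closed (icoord c @` K0).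
  apply: compact_closed; first exact: surface_hausdorff.
  apply: continuous_compact; last exact: closed_box_compact.
  apply: continuous_in_subspaceT => q /set_mem /K0r; exact: continuous_icoord.
have KU y : (icoord c @` K0) y -> chart_dom c y /\ U y.
  by move=> [q /K0box/rU [z [cz Uz] <-] <-]; rewrite coordK.
have B0 y : ~ (icoord c @` K0) y -> B y = 0.
  move=> nK; rewrite /B; case: pselect => // cy.
  have /existsNP [j /negP] : ~ K0 (coord c y).
    by move=> K0y; apply: nK; exists (coord c y); rewrite ?coordK.
  by rewrite -ltNge => /ltW; exact: rho0.
have B0n y : ~ (icoord c @` K0) y -> \forall z \near y, B z = 0.
  move=> nK; have oK := closed_openC cK.
  by apply: filterS (open_near oK nK) => z; exact: B0.
have sB y : smooth_at y B.
  case: (pselect (chart_dom c y)) => cy.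
    apply: (smooth_at_chart ac cy (@open_chart_codom _ _ c)); first by exists y.
    move=> k; have := srho k; move/(@Ck_sub _ _ (coord c @` chart_dom c)) => H.
    apply: Ck_eq (H _) => //; first exact: open_chart_codom.
    by move=> q cq; rewrite /= /B; case: pselect => [?|nd]; [rewrite icoordK|case: nd; exact: icoord_dom].
  have nK : ~ (icoord c @` K0) y by move=> /KU [].
  apply: smooth_at_near (smooth_at_cst y 0).
  by apply: filterS (B0n _ nK) => z.
pose Q := [set y | chart_dom c y /\ box p (r / 3) (coord c y)].
exists (MkCinf (smooth_atP sB)), Q; split.
- by apply: open_preim_coord; exact: open_box.
- by split=> //; apply: box_center; rewrite divr_gt0.
- move=> y [cy By].
  have /rU [z [cz Uz] E] : box p r (coord c y).
    by move=> j; apply: lt_trans (By j) _; lra.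
  by rewrite -(coordK cy) -E coordK.
- move=> y [cy By] /=; rewrite /B; case: pselect => // ?.
  by apply: rho1 => j; apply: ltW; exact: By.
- by move=> y nU; apply: B0n => /KU [].
Qed.

Lemma cutoff_ext (b : C) U F : open U ->
  (forall y, ~ U y -> \forall z \near y, b z = 0) -> smooth_on U F ->
  exists g : C, forall y, g y = if pselect (U y) then b y * F y else 0.
Proof.
move=> oU b0 sF; pose G y := if pselect (U y) then b y * F y else 0.
suff sG y : smooth_at y G by exists (MkCinf (smooth_atP sG)).
case: (pselect (U y)) => Uy.
  apply: (@smooth_at_near _ ((b : M -> R) * F)).
    by apply: filterS (open_near oU Uy) => z Uz; rewrite /G; case: pselect.
  by apply: smooth_at_mul; [exact: Cinf_smooth_at|exists U].
apply: smooth_at_near (smooth_at_cst y 0).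
apply: filterS (b0 _ Uy) => z bz; rewrite /G.
by case: pselect => // ?; rewrite bz mul0r.
Qed.

Lemma local_ext x U F : open U -> U x -> smooth_on U F ->
  exists (g : C) (Q : set M), [/\ open Q, Q x, Q `<=` U & forall y, Q y -> g y = F y].
Proof.
move=> oU Ux sF; have [b [Q [oQ Ox OU b1 b0]]] := cutoff oU Ux.
have [g Eg] := cutoff_ext oU b0 sF; exists g, Q; split=> // y Oy.
by rewrite Eg; case: pselect => [?|nd]; [rewrite b1 // mul1r|case: nd; exact: OU].
Qed.

(** The gluing pattern used throughout: [F x] is a choice made around x, and only its value at x is
    kept. Near x the kept values are those of the single smooth function [F x]. *)
Lemma glueC (F : M -> C) : (forall x, \forall y \near x, F y y = F x y) ->
  exists g : C, forall x, g x = F x x.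
Proof.
move=> H; suff sG x : smooth_at x (fun y => F y y) by exists (MkCinf (smooth_atP sG)).
apply: smooth_at_near (Cinf_smooth_at (F x) x).
by apply: filterS (H x) => y ->.
Qed.

Lemma CinfP (f g : C) : (forall x, f x = g x) -> f = g.
Proof. by move=> fg; apply/val_inj/funext. Qed.

Lemma Cinf0E x : (0 : C) x = 0. Proof. by []. Qed.

Lemma Cinf1E x : (1 : C) x = 1. Proof. by []. Qed.

Lemma CinfDE (f g : C) x : (f + g) x = f x + g x. Proof. by []. Qed.

Lemma CinfNE (f : C) x : (- f) x = - f x. Proof. by []. Qed.

Lemma CinfME (f g : C) x : (f * g) x = f x * g x. Proof. by []. Qed.

Lemma Cinf_sumE I (r : seq I) (P : pred I) (F : I -> C) x :
  (\sum_(i <- r | P i) F i) x = \sum_(i <- r | P i) F i x.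
Proof. by elim/big_rec2: _ => // i a f _ <-. Qed.

Lemma cstCE a x : cstC M a x = a. Proof. by []. Qed.

Definition CinfE := (Cinf0E, Cinf1E, CinfDE, CinfNE, CinfME, Cinf_sumE, cstCE).

Lemma vfield_cst (X : vfield M) a : X (cstC M a) = 0.
Proof.
have X1 : X 1 = 0.
  by have := vfieldM X 1 1; rewrite !mulr1 mul1r -[X in X = _]addr0 => /addrI.
by rewrite -[cstC M a]mulr1 vfieldZ X1 mulr0.
Qed.

Lemma vfield_zero (X : vfield M) : X 0 = 0.
Proof. by have := vfieldD X 0 0; rewrite addr0 -[X in X = _]addr0 => /addrI. Qed.

Lemma vfieldN (X : vfield M) f : X (- f) = - X f.
Proof. by apply/eqP; rewrite -addr_eq0 -vfieldD addNr vfield_zero. Qed.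

(** With a cutoff b equal to 1 at y, b f = b g holds globally; the Leibniz rule applied to both
    sides leaves the claim at y. *)
Lemma vfield_local (X : vfield M) (f g : C) y :
  (\forall z \near y, f z = g z) -> X f y = X g y.
Proof.
move=> /near_openP [Q [oQ Oy fg]].
have [b [Q' [_ Q'y Q'Q b1 b0]]] := cutoff oQ Oy.
have E : b * f = b * g.
  apply: CinfP => z /=; rewrite !fctE; case: (pselect (Q z)) => Oz; first by rewrite fg.
  by have /nbhs_singleton -> := b0 _ Oz; rewrite !mul0r.
have := congr1 (fun h : C => X h y) E; rewrite /= !vfieldM /= !fctE b1 // !mul1r.
by rewrite fg // => /addrI.
Qed.

(** Global functions and fields that behave as coordinates and coordinate fields only over [W]. The
    second clause expresses at each point that a derivation has two components. *)
Definition frame_on W (u : 'I_2 -> C) (E : 'I_2 -> vfield M) :=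
  (forall y, W y -> forall i j, E i (u j) y = (i == j)%:R) /\
  (forall (X : vfield M) f y, W y -> X f y = \sum_i X (u i) y * E i f y).

Section ChartFields.
Variables (c : chart R M) (ac : atlas c) (b : C).
Hypothesis b0 : forall y, ~ chart_dom c y -> \forall z \near y, b z = 0.

Lemma smooth_partial i (f : C) :
  smooth_on (chart_dom c) (fun y => partial i (f \o icoord c) (coord c y)).
Proof.
apply: smooth_on_local => y cy.
have oc := @open_chart_codom _ _ c.
apply: (smooth_at_chart ac cy oc); first by exists y.
move=> k; have /asboolP sf := Cinf_smooth f.
have sf' : smooth_plane (coord c @` chart_dom c) (f \o icoord c).
  move=> l; apply: Ck_sub (sf c ac l).
  by move=> _ [z cz <-]; exists z.
apply: Ck_eq (smooth_plane_partial i sf' k) => // q cq /=.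
by rewrite icoordK.
Qed.

Lemma chart_field_exists i : exists E : vfield M, forall f y,
  E f y = if pselect (chart_dom c y) then b y * partial i (f \o icoord c) (coord c y) else 0.
Proof.
have H f := cutoff_ext (@open_chart_dom _ _ c) b0 (smooth_partial i f).
have [E HE] := choice H.
have sf (f : C) y : chart_dom c y -> derivable (f \o icoord c) (coord c y) (delta_mx 0 i).
  move=> cy; have /asboolP sf := Cinf_smooth f.
  apply: diff_derivable; apply: smooth_plane_diff (sf c ac) _.
  by exists y.
have ED f g : E (f + g) = E f + E g.
  apply: CinfP => y; rewrite /= !fctE !HE; case: pselect => [cy|?]; last by rewrite addr0.
  by rewrite -mulrDr; congr (_ * _); rewrite /partial -deriveD //; exact: sf.
have EM f g : E (f * g) = E f * g + f * E g.
  apply: CinfP => y; rewrite /= ?fctE /= ?fctE !HE; case: pselect => [cy|?]; last by rewrite mul0r mulr0 addr0.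
  have := @deriveM _ _ (f \o icoord c) (g \o icoord c) _ _ (sf f y cy) (sf g y cy).
  rewrite /partial => ->; rewrite /= coordK // /GRing.scale /=.
  by move: ('D_ _ _ _) ('D_ _ _ _) => d1 d2; ring.
have Ec a : E (cstC M a) = 0.
  apply: CinfP => y; rewrite HE; case: pselect => // cy.
  rewrite (_ : partial _ _ _ = 0) ?mulr0 //; exact: derive_cst.
have EZ a f : E (cstC M a * f) = cstC M a * E f by rewrite EM Ec mul0r add0r.
by exists (MkVfield ED EZ EM).
Qed.

End ChartFields.

Lemma coord_smooth c j : atlas c -> smooth_on (chart_dom c) (fun y => coord c y 0 j).
Proof.
move=> ac; apply: smooth_on_local => y cy; have oc := @open_chart_codom _ _ c.
apply: (smooth_at_chart ac cy oc); first by exists y.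
move=> k; apply: Ck_eq (Ck_coord k j oc) => // q cq /=.
by rewrite icoordK.
Qed.

(** Coordinates and coordinate fields of the chart are multiplied by a cutoff and extended by 0; [W]
    is the open set where the cutoff is 1. Hadamard's expansion of f at each point of [W] gives the
    second clause of [frame_on]. *)
Lemma frame_exists x c : atlas c -> chart_dom c x -> exists W u E,
  [/\ open W, W x, frame_on W u E & forall y, W y -> coordinates_at c y u].
Proof.
move=> ac cx; have oc := @open_chart_dom _ _ c.
have [b [Q [oQ Ox Oc b1 b0]]] := cutoff oc cx.
have [u Hu] := choice (fun j : 'I_2 => cutoff_ext oc b0 (coord_smooth j ac)).
have [E HE] := choice (chart_field_exists ac b0).
have uE y j : Q y -> u j y = coord c y 0 j.
  by move=> Oy; rewrite Hu; case: pselect => [?|nd]; [rewrite b1 // mul1r|case: nd; exact: Oc].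
have EE i f y : Q y -> E i f y = partial i (f \o icoord c) (coord c y).
  by move=> Oy; rewrite HE; case: pselect => [?|nd]; [rewrite b1 // mul1r|case: nd; exact: Oc].
have Eu y i j : Q y -> E i (u j) y = (i == j)%:R.
  move=> Oy; rewrite EE // -(partial_coord i j (coord c y)) /partial.
  apply: near_eq_derive.
  have oI := @open_chart_img _ _ c _ oQ.
  have : chart_img c Q (coord c y) by exists y => //; split=> //; exact: Oc.
  move: oI; rewrite openE => /[apply]; apply: filterS => _ [z [cz Oz] <-] /=.
  by rewrite coordK // uE.
exists Q, u, E; split=> //; last first.
  move=> y Oy; split=> //; first exact: Oc.
  by apply: filterS (open_near oQ Oy) => z Oz i; rewrite uE.
split=> [y Oy i j|X f y Oy]; first exact: Eu.
set p := coord c y.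
have [r r0 rO] : exists2 r, 0 < r & box p r `<=` chart_img c Q.
  apply: open_subbox; first exact: open_chart_img.
  by exists y => //; split=> //; exact: Oc.
have sf : smooth_plane (box p r) (f \o icoord c).
  move=> k; have /asboolP sf := Cinf_smooth f; apply: Ck_sub (sf c ac k).
  by move=> q /rO [z [cz _] <-]; exists z.
have [g sg Hg] := smooth_hadamard sf.
pose U := [set z | chart_dom c z /\ box p r (coord c z)].
have oU : open U by apply: open_preim_coord; exact: open_box.
have Uy : U y by split; [exact: Oc|exact: box_center].
have UO z : U z -> Q z.
  by move=> [cz /rO [w [cw Ow] E0]]; rewrite -(coordK cz) -E0 coordK.
have sG i : smooth_on U (fun z => g i (coord c z)).
  apply: smooth_on_local => z [cz Bz].
  apply: (smooth_at_chart ac cz (@open_box _ p r)) => // k.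
  apply: Ck_eq (sg i k); first exact: open_box.
  by move=> q /rO [w [cw _] <-] /=; rewrite coordK.
have [G HG] := choice (fun i => local_ext oU Uy (sG i)).
have [Q0 [oO0 O0y O0U G0]] := HG 0; have [Q1 [oO1 O1y O1U G1]] := HG 1.
have nf : \forall z \near y, f z = (cstC M (f y) + (u 0 - cstC M (u 0 y)) * G 0 + (u 1 - cstC M (u 1 y)) * G 1) z.
  apply: filterS2 (open_near oO0 O0y) (open_near oO1 O1y) => z Oz0 Oz1.
  have [cz Bz] := O0U _ Oz0.
  rewrite /= !fctE /= G0 // G1 // !uE //; try exact/UO/O0U.
  have := Hg _ Bz; rewrite /= /p !coordK //; last exact: Oc.
  rewrite big_ord_recl big_ord1 addrA => ->.
  by have -> : lift ord0 ord0 = 1 :> 'I_2 by apply/val_inj.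
(* Taken at [X] this gives [X f y] in terms of the [G i y]; taken at [E i] it identifies [G i y]
   with [E i f y]. *)
have XG (Y : vfield M) : Y f y = Y (u 0) y * G 0 y + Y (u 1) y * G 1 y.
  rewrite (vfield_local Y nf) !vfieldD !vfieldM !vfieldD vfield_cst.
  rewrite !vfieldN !vfield_cst !CinfE; ring.
rewrite big_ord_recl big_ord1 /=.
have -> : lift ord0 ord0 = 1 :> 'I_2 by apply/val_inj.
by rewrite XG !(XG (E _)) !Eu //= !mul1r !mul0r addr0 add0r.
Qed.

End SmoothManifold.

(** * Partitions of unity and connections in a line bundle *)

Section PartitionOfUnity.
Variables (R : realType) (M : oriented_surface R).
Local Notation C := (Cinf M).

(** The number [m x] both ends the sum at x and bounds the indices that are alive near x, which
    keeps every sum finite. The second alternative covers the indices to which no suitable basic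
    open set is attached. *)
Definition partition_on (Q : M -> set M) (w : nat -> C) (m : M -> nat) :=
  [/\ forall n, (exists z, forall y, w n y != 0 -> Q z y) \/ (forall y, w n y = 0),
      forall x, \sum_(n < m x) w n x = 1 &
      forall x, \forall y \near x, forall n, (m x <= n)%N -> w n y = 0].

(* w_n = b_n (1 - b_0) .. (1 - b_(n-1)) is locally finite as soon as the
   interiors of the sets b_n = 1 cover M: no paracompactness is needed. *)
Lemma partition_of_unity (Q : M -> set M) :
  (forall x, open (Q x)) -> (forall x, Q x x) ->
  exists w m, partition_on Q w m.
Proof.
move=> oQ Qx; have [B /countable_injP [code inj_code] [oB bB]] := surface_second_countable M.
pose good (U : set M) (b : C) := (exists z, forall y, b y != 0 -> Q z y) /\ forall y, U y -> b y = 1.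
have [b Hb] : exists b : nat -> C, forall n,
    ((exists z, forall y, b n y != 0 -> Q z y) \/ (forall y, b n y = 0)) /\
    forall U, B U -> code U = n -> (exists b, good U b) -> forall y, U y -> b n y = 1.
  suff H n : exists b : C,
    ((exists z, forall y, b y != 0 -> Q z y) \/ (forall y, b y = 0)) /\
    forall U, B U -> code U = n -> (exists b, good U b) -> forall y, U y -> b y = 1.
    by have [f Hf] := choice H; exists f.
  have [[U [BU Un [b [bQ b1]]]]|none] :=
      pselect (exists U, [/\ B U, code U = n & exists b, good U b]).
    exists b; split; first by left.
    move=> U' BU' U'n _ y; suff -> : U' = U by exact: b1.
    by apply: inj_code; rewrite ?inE // Un.
  exists 0; split; first by right.
  by move=> U BU Un gU; case: none; exists U.
(* A basic open set around x inside the region where a cutoff of [Q x] is 1 admits a suitable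
   function, so the one chosen for its code equals 1 on it. *)
have cover (x : M) : exists n, \forall y \near x, b n y = 1.
  have [c [Z [oZ Zx ZQ c1 c0]]] := cutoff (oQ x) (Qx x).
  have [U /= [BU Ux] UZ] := bB x _ (open_near oZ Zx).
  exists (code U).
  have gU : exists b, good U b.
    exists c; split; last by move=> y /UZ /c1.
    exists x => y cy; have [//|nQ] := pselect (Q x y).
    by have /nbhs_singleton cy0 := c0 _ nQ; rewrite cy0 eqxx in cy.
  by apply: filterS (open_near (oB _ BU) Ux) => y Uy; exact: (Hb _).2 Uy.
have [m Hm] := choice cover.
pose w n : C := b n * \prod_(k < n) (1 - b k).
have prod0 (y : M) n k : (k < n)%N -> b k y = 1 -> (\prod_(k < n) (1 - b k)) y = 0.
  elim: n => // n IH; rewrite ltnS leq_eqVlt => /orP[/eqP -> bk|kn bk].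
    by rewrite big_ord_recr CinfME CinfDE CinfNE Cinf1E [nat_of_ord _]/= bk subrr mulr0.
  by rewrite big_ord_recr CinfME IH // mul0r.
(* The sum telescopes: w_k is the difference of the products with k and with k + 1 factors. *)
have sumE n (y : M) : \sum_(k < n) w k y = 1 - (\prod_(k < n) (1 - b k)) y.
  elim: n => [|n IH]; first by rewrite !big_ord0 CinfE subrr.
  have E : (\prod_(k < n.+1) (1 - b k)) y = (\prod_(k < n) (1 - b k)) y * (1 - b n y).
    by rewrite big_ord_recr CinfME CinfDE CinfNE Cinf1E.
  rewrite E big_ord_recr IH [w _ y]CinfME /=; ring.
(* The vanishing factor, of index [m x], occurs in the product over k < n only for n > [m x]; hence
   the successor. *)
exists w, (fun x => (m x).+1); split.
- move=> n; have [[[z Hz]|H0] _] := Hb n.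
    left; exists z => y wy; apply: Hz; apply: contraNneq wy => by0.
    by rewrite CinfME by0 mul0r.
  by right=> y; rewrite CinfME H0 mul0r.
- move=> x; rewrite sumE (prod0 _ _ (m x)) ?subr0 //.
  exact: nbhs_singleton (Hm x).
- move=> x; apply: filterS (Hm x) => y by1 n mn.
  by rewrite /w CinfME (prod0 _ _ (m x)) ?mulr0.
Qed.

Section Sums.
Variables (Q : M -> set M) (w : nat -> C) (m : M -> nat).
Hypothesis pw : partition_on Q w m.

(** The number of summands varies with y; near x both [m y] and [m x] are bounds beyond which all
    weights vanish at y, so the sums agree. *)
Lemma partition_sum_near (T : M -> nat -> R) x : \forall y \near x,
  \sum_(n < m y) w n y * T y n = \sum_(n < m x) w n y * T y n.
Proof.
case: pw => _ _ w0; apply: filterS (w0 x) => y wx.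
have wy n : (m y <= n)%N -> w n y = 0 by exact: nbhs_singleton (w0 y) n.
have ext N N' : (forall n, (N <= n)%N -> w n y = 0) -> (N <= N')%N ->
    \sum_(n < N) w n y * T y n = \sum_(n < N') w n y * T y n.
  move=> H NN'; rewrite -(subnKC NN') big_split_ord /= [X in _ + X]big1 ?addr0 //.
  by move=> i _; rewrite H ?mul0r // leq_addr.
case: (leqP (m y) (m x)) => [|/ltnW] H; first exact: ext.
by apply/esym; exact: ext.
Qed.

Lemma partition_glueC (F : nat -> C) :
  exists g : C, forall x, g x = \sum_(n < m x) w n x * F n x.
Proof.
have [|g Hg] := @glueC _ M (fun x => \sum_(n < m x) w n * F n).
  move=> x; apply: filterS (partition_sum_near (fun y n => F n y) x) => y.
  by rewrite !CinfE.
by exists g => x; rewrite Hg CinfE.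
Qed.

Lemma partition_eq (T T' : nat -> R) x : (forall n, w n x != 0 -> T n = T' n) ->
  \sum_(n < m x) w n x * T n = \sum_(n < m x) w n x * T' n.
Proof.
move=> H; apply: eq_bigr => n _; have [->|wn] := eqVneq (w n x) 0; first by rewrite !mul0r.
by rewrite H.
Qed.

Lemma partition_cst (a : R) x : \sum_(n < m x) w n x * a = a.
Proof. by rewrite -mulr_suml; case: pw => _ -> _; rewrite mul1r. Qed.

End Sums.
End PartitionOfUnity.

(** * Values of sections, and existence of a connection *)

Section SectionValues.
Variables (R : realType) (M : oriented_surface R) (xi : line_bundle M).
Local Notation C := (Cinf M).
Local Notation Gamma := (lbsection xi).

(** A choice of basis fiber by fiber, with no continuity claimed. It only serves to read identities
    between sections as identities between real numbers at each point, where [ring] applies. *)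
Definition fiber_basis (y : M) : xi y :=
  frame_vec (projT1 (cid2 (frames_cover xi y))) y.

Lemma fiber_basis_spec y : exists e, [/\ @frames _ _ xi e, frame_dom e y & fiber_basis y = frame_vec e y].
Proof.
by rewrite /fiber_basis; case: (cid2 _) => e fe ey; exists e.
Qed.

Lemma fiber_basis_neq0 y : fiber_basis y != 0.
Proof. by have [e [_ ey ->]] := fiber_basis_spec y; exact: frame_neq0. Qed.

Lemma fiber_basis_span y (v : xi y) : exists a : R, v = a *: fiber_basis y.
Proof. by have [e [_ ey ->]] := fiber_basis_spec y; exact: frame_span. Qed.

Definition fcoord y (v : xi y) : R := projT1 (cid (fiber_basis_span v)).

Lemma fcoordE y (v : xi y) : v = fcoord v *: fiber_basis y.
Proof. by rewrite /fcoord; case: cid. Qed.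

Lemma fcoordP y (v : xi y) a : v = a *: fiber_basis y -> fcoord v = a.
Proof.
move=> E; have := fcoordE v; rewrite {1}E => /eqP.
rewrite -subr_eq0 -scalerBl scaler_eq0 (negbTE (fiber_basis_neq0 y)) orbF subr_eq0.
by move=> /eqP.
Qed.

Lemma fcoord_inj y (v v' : xi y) : fcoord v = fcoord v' -> v = v'.
Proof. by move=> E; rewrite (fcoordE v) E -fcoordE. Qed.

Lemma fcoordZ y a (v : xi y) : fcoord (a *: v) = a * fcoord v.
Proof. by apply: fcoordP; rewrite {1}(fcoordE v) scalerA. Qed.

Lemma fcoordD y (v v' : xi y) : fcoord (v + v') = fcoord v + fcoord v'.
Proof. by apply: fcoordP; rewrite {1}(fcoordE v) {1}(fcoordE v') scalerDl. Qed.

Lemma fcoord_eq0 y (v : xi y) : (fcoord v == 0) = (v == 0).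
Proof.
apply/eqP/eqP => [v0|->]; first by rewrite (fcoordE v) v0 scale0r.
by apply: fcoordP; rewrite scale0r.
Qed.

Definition sval_at (y : M) (s : Gamma) : R := fcoord (s y).

Lemma sv0 y : sval_at y 0 = 0.
Proof. by apply/eqP; rewrite fcoord_eq0. Qed.

Lemma svD y s t : sval_at y (s + t) = sval_at y s + sval_at y t.
Proof. exact: fcoordD. Qed.

Lemma svZ y (f : C) s : sval_at y (f *: s) = f y * sval_at y s.
Proof. exact: fcoordZ. Qed.

Lemma svN y s : sval_at y (- s) = - sval_at y s.
Proof. by apply/eqP; rewrite -addr_eq0 -svD addNr sv0. Qed.

Lemma sv_sum y I (r : seq I) (P : pred I) (F : I -> Gamma) :
  sval_at y (\sum_(i <- r | P i) F i) = \sum_(i <- r | P i) sval_at y (F i).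
Proof.
by elim/big_rec2: _ => [|i a s _ <-]; [exact: sv0|exact: svD].
Qed.

Lemma sv_ext s t : (forall y, sval_at y s = sval_at y t) -> s = t.
Proof. by move=> H; apply: lbsectionP => y; apply: fcoord_inj; exact: H. Qed.

Lemma glue_section (F : M -> Gamma) :
  (forall x, \forall y \near x, sval_at y (F y) = sval_at y (F x)) ->
  exists t : Gamma, forall x, sval_at x t = sval_at x (F x).
Proof.
move=> H.
suff st : smooth_section (fun x => F x x) by exists (MkLbsection st).
move=> e fe.
have [f Hf] : exists f : M -> R, forall x, frame_dom e x -> F x x = f x *: frame_vec e x.
  suff : forall x, exists a : R, frame_dom e x -> F x x = a *: frame_vec e x.
    by move=> H1; have [f Hf] := choice H1; exists f.
  move=> x; have [ex|nex] := pselect (frame_dom e x); last by exists 0.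
  by have [a Ha] := frame_span (F x x) ex; exists a.
exists f => //; apply: smooth_on_local => x ex.
have [g sg Hg] := lbsection_smooth (F x) fe.
apply: (@smooth_at_near _ _ _ g); last by exists (frame_dom e); split=> //; exact: open_frame_dom.
apply: filterS2 (open_near (@open_frame_dom _ _ _ e) ex) (H x) => y ey /fcoord_inj E.
move: E; rewrite Hf // Hg // => /eqP.
rewrite -subr_eq0 -scalerBl scaler_eq0 (negbTE (frame_neq0 ey)) orbF subr_eq0.
by move=> /eqP.
Qed.

(** A frame and the coefficients of sections in it are cut off so as to be defined on all of M. The
    function [h s] is the coefficient of [s] only over [Z], and [h] is additive and linear only
    there. *)
Lemma local_section x : exists (Z : set M) (e : Gamma) (h : Gamma -> C),
  [/\ open Z, Z x, forall y, Z y -> sval_at y e != 0 &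
      forall y s, Z y -> sval_at y s = h s y * sval_at y e].
Proof.
have [e0 fe ex] := frames_cover xi x; have oe := @open_frame_dom _ _ _ e0.
have [b [Z [oZ Zx Ze b1 b0]]] := cutoff oe ex.
have se : smooth_section (fun y => if pselect (frame_dom e0 y) then b y *: frame_vec e0 y else 0 : xi y).
  move=> e' fe'; have [h sh Eh] := frames_smooth fe' fe.
  exists (fun y => if pselect (frame_dom e0 y) then b y * h y else 0).
    apply: smooth_on_local => y e'y; have oe' := @open_frame_dom _ _ _ e'.
    have [ey|ney] := pselect (frame_dom e0 y); last first.
      apply: smooth_at_near (smooth_at_cst y 0); apply: filterS (b0 _ ney) => z bz.
      by case: pselect => // ?; rewrite bz mul0r.
    apply: (@smooth_at_near _ _ _ ((b : M -> R) * h)).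
      by apply: filterS (open_near oe ey) => z ez; case: pselect.
    apply: smooth_at_mul; first exact: Cinf_smooth_at.
    by exists (frame_dom e' `&` frame_dom e0); split=> //; exact: openI.
  move=> y e'y; case: pselect => [ey|?]; last by rewrite scale0r.
  by rewrite Eh // scalerA.
pose e := MkLbsection se.
have eE y : Z y -> e y = frame_vec e0 y.
  move=> Zy; rewrite /e /=; case: pselect => [?|nd]; first by rewrite b1 // scale1r.
  by case: nd; exact: Ze.
have [h Hh] : exists h : Gamma -> C, forall (s : Gamma) y, Z y -> s y = h s y *: e y.
  suff H (s : Gamma) : exists g : C, forall y, Z y -> s y = g y *: e y.
    by have [h Hh] := choice H; exists h.
  have [f sf Hf] := lbsection_smooth s fe.
  have [g Hg] := cutoff_ext oe b0 sf; exists g => y Zy.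
  rewrite eE // Hf ?Hg; last exact: Ze.
  by case: pselect => [?|nd]; [rewrite b1 // mul1r|case: nd; exact: Ze].
exists Z, e, h; split=> //.
  by move=> y Zy; rewrite /sval_at fcoord_eq0 eE //; apply: frame_neq0; exact: Ze.
by move=> y s Zy; rewrite /sval_at Hh // fcoordZ.
Qed.

(** Makes operators linear over functions local: they take the same value on [b *: s] and [b *: t],
    and b is 1 at y. *)
Lemma sv_near_ext y s t : (\forall z \near y, sval_at z s = sval_at z t) ->
  exists b : C, b y = 1 /\ b *: s = b *: t.
Proof.
move=> /near_openP [Q [oQ Qy st]]; have [b [Z [oZ Zy ZQ b1 b0]]] := cutoff oQ Qy.
exists b; split; first exact: b1.
apply: sv_ext => z; rewrite !svZ; have [Qz|nQ] := pselect (Q z); first by rewrite st.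
by have /nbhs_singleton -> := b0 _ nQ; rewrite !mul0r.
Qed.

(** Around each point the flat connection that kills the local section, X(h s) e, is available. A
    combination of connections with weights of sum 1 is again a connection. *)
Lemma connection_exists : exists D : connection Gamma, True.
Proof.
have [Z HZ] := choice local_section.
have oZ x : open (Z x) by have [e [h []]] := HZ x.
have Zx x : Z x x by have [e [h []]] := HZ x.
have [w [m pw]] := partition_of_unity oZ Zx.
have loc n : exists Dn : vfield M -> Gamma -> Gamma, forall y, w n y != 0 ->
    [/\ forall f X Y s, sval_at y (Dn (f *: X + Y) s) = f y * sval_at y (Dn X s) + sval_at y (Dn Y s),
        forall X s t, sval_at y (Dn X (s + t)) = sval_at y (Dn X s) + sval_at y (Dn X t) &
        forall X f s, sval_at y (Dn X (f *: s)) = X f y * sval_at y s + f y * sval_at y (Dn X s)].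
  case: (pw) => /(_ n) [[z' Hz']|w0] _ _; last by exists (fun _ _ => 0) => y; rewrite w0 eqxx.
  have [e [h [_ _ e0 Hh]]] := HZ z'.
  exists (fun X s => X (h s) *: e) => y /Hz' Zy.
  (* [h] is compatible with sums and products only over [Z z']; since vector fields are local, this
     is enough at y. *)
  have hE s (g : C) : (forall v, Z z' v -> sval_at v s = g v * sval_at v e) ->
      forall X : vfield M, X (h s) y = X g y.
    move=> H X; apply: vfield_local; apply: filterS (open_near (oZ z') Zy) => v Zv.
    by apply: (mulIf (e0 _ Zv)); rewrite -(H _ Zv) (Hh _ s Zv).
  split=> [f X Y s|X s t|X f s]; rewrite !svZ.
  - by rewrite [(f *: X + Y) _]/(f * X (h s) + Y (h s)) CinfDE CinfME; ring.
  - rewrite (hE (s + t) (h s + h t)) ?vfieldD ?CinfDE ?mulrDl // => v Zv.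
    by rewrite svD (Hh v s Zv) (Hh v t Zv) CinfDE mulrDl.
  - rewrite (hE (f *: s) (f * h s)) => [|v Zv]; last by rewrite svZ (Hh v s Zv) CinfME mulrA.
    by rewrite vfieldM CinfDE !CinfME (Hh _ s Zy); ring.
have [D0 HD0] := choice loc.
have gl X s : exists t : Gamma, forall x, sval_at x t = \sum_(n < m x) w n x * sval_at x (D0 n X s).
  have [|t Ht] := @glue_section (fun x => \sum_(n < m x) w n *: D0 n X s).
    move=> x; apply: filterS (partition_sum_near pw (fun y n => sval_at y (D0 n X s)) x) => y E.
    by rewrite !sv_sum; under eq_bigr do rewrite svZ; rewrite E; under [RHS]eq_bigr do rewrite svZ.
  by exists t => x; rewrite Ht sv_sum; under eq_bigr do rewrite svZ.
have [D' HD'] := choice (fun Xs : vfield M * Gamma => gl Xs.1 Xs.2).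
pose D X s := D' (X, s).
have HD X s x : sval_at x (D X s) = \sum_(n < m x) w n x * sval_at x (D0 n X s) by exact: (HD' (X, s)).
have D1 f X Y s : D (f *: X + Y) s = f *: D X s + D Y s.
  apply: sv_ext => x; rewrite svD svZ !HD mulr_sumr -big_split /=.
  transitivity (\sum_(n < m x) w n x * (f x * sval_at x (D0 n X s) + sval_at x (D0 n Y s))).
    by apply: (@partition_eq _ _ w m (fun n => sval_at x (D0 n (f *: X + Y) s)) (fun n => f x * sval_at x (D0 n X s) + sval_at x (D0 n Y s)) x) => n /HD0 [].
  by apply: eq_bigr => n _; ring.
have D2 X s t : D X (s + t) = D X s + D X t.
  apply: sv_ext => x; rewrite svD !HD -big_split /=.
  transitivity (\sum_(n < m x) w n x * (sval_at x (D0 n X s) + sval_at x (D0 n X t))).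
    by apply: (@partition_eq _ _ w m (fun n => sval_at x (D0 n X (s + t))) (fun n => sval_at x (D0 n X s) + sval_at x (D0 n X t)) x) => n /HD0 [].
  by apply: eq_bigr => n _; ring.
have D3 X f s : D X (f *: s) = X f *: s + f *: D X s.
  (* The inhomogeneous term of the Leibniz rule is the one place where the weights must sum to 1. *)
  apply: sv_ext => x; rewrite svD !svZ !HD -[X f x * _](partition_cst pw _ x).
  rewrite mulr_sumr -big_split /=.
  transitivity (\sum_(n < m x) w n x * (X f x * sval_at x s + f x * sval_at x (D0 n X s))).
    by apply: (@partition_eq _ _ w m (fun n => sval_at x (D0 n X (f *: s))) (fun n => X f x * sval_at x s + f x * sval_at x (D0 n X s)) x) => n /HD0 [].
  by apply: eq_bigr => n _; ring.
by exists (MkConnection D1 D2 D3).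
Qed.

End SectionValues.

(** * Symmetric tensors in a frame *)

Section OneForms.
Variables (R : realType) (M : oriented_surface R).
Local Notation C := (Cinf M).
Local Notation vfield := (vfield M).
Local Notation oneform := (oneform M).

Lemma oneformP (a b : oneform) : (forall X, a X = b X) -> a = b.
Proof.
move=> ab; have {ab} : (a : vfield -> C) = b by apply/funext.
case: a b => [a [[a1] [a2]]] [b [[b1] [b2]]] /= E; subst b.
by congr GRing.Linear.Pack; congr GRing.Linear.Class; [congr Algebra.isNmodMorphism.Axioms_|congr GRing.isScalable.Axioms_]; exact: Prop_irrelevance.
Qed.

Lemma mk_oneform (f : vfield -> C) :
  (forall g X Y, f (g *: X + Y) = g * f X + f Y) ->
  exists a : oneform, forall X, a X = f X.
Proof.
move=> H; have fl : linear (f : vfield -> C^o) by move=> g X Y; exact: H.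
pose fM := GRing.isLinear.Build _ _ _ _ _ fl.
pose fL : {linear vfield -> C^o} := HB.pack (f : vfield -> C^o) fM.
by exists fL.
Qed.

Definition lc (f : C) (a b : oneform) : oneform := f \*: a \+ b.

Lemma lcE f a b X : lc f a b X = f * a X + b X.
Proof. by []. Qed.

Lemma oneform_lin (a : oneform) f X Y : a (f *: X + Y) = f * a X + a Y.
Proof. by rewrite linearP. Qed.

Lemma oneformD (a : oneform) X Y : a (X + Y) = a X + a Y.
Proof. exact: linearD. Qed.

Lemma oneformZ (a : oneform) f X : a (f *: X) = f * a X.
Proof. exact: linearZ. Qed.

Lemma differentialE (f : C) (X : vfield) : differential f X = X f.
Proof. by []. Qed.

Lemma vfield_scaleE f (X : vfield) g : (f *: X) g = f * X g.
Proof. by []. Qed.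

Lemma vfield_addE (X Y : vfield) g : (X + Y) g = X g + Y g.
Proof. by []. Qed.

Lemma ord2E (i : 'I_2) : i = 0 \/ i = 1.
Proof. by case: i => [[|[|//]] ?]; [left|right]; apply/val_inj. Qed.

Lemma sum2 (V : nmodType) (F : 'I_2 -> V) : \sum_i F i = F 0 + F 1.
Proof.
by rewrite big_ord_recl big_ord1; congr (_ + F _); apply/val_inj.
Qed.

Section Expansion.
Variables (W : set M) (u : 'I_2 -> C) (E : 'I_2 -> vfield).
Hypotheses (oW : open W) (fW : frame_on W u E).
Variables (y : M) (Wy : W y).

Lemma frame_delta i j : E i (u j) y = (i == j)%:R.
Proof. by case: fW => + _; apply. Qed.

Lemma frame_eval (X : vfield) f : X f y = X (u 0) y * E 0 f y + X (u 1) y * E 1 f y.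
Proof. by case: fW => _ /(_ X f y Wy) ->; rewrite sum2. Qed.

(** The expansion of [X] in the frame holds only over [W]; multiplied by b^2 it becomes an identity
    of global fields, to which [psi] applies, and b is 1 at y. *)
Lemma vfield_expand (psi : vfield -> R) :
  (forall f X Y, psi (f *: X + Y) = f y * psi X + psi Y) ->
  forall X, psi X = X (u 0) y * psi (E 0) + X (u 1) y * psi (E 1).
Proof.
move=> lin X; have [b [Z [_ Zy _ b1 b0]]] := cutoff oW Wy.
have psi0 : psi 0 = 0 by apply: (addrI (psi 0)); have := lin 1 0 0; rewrite scale1r addr0 CinfE mul1r addr0 => <-.
have key : (b * b) *: X = (b * X (u 0)) *: (b *: E 0) + ((b * X (u 1)) *: (b *: E 1) + 0).
  apply: vfieldP => f; apply: CinfP => z; rewrite addr0.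
  rewrite !(vfield_addE, vfield_scaleE) !CinfE.
  have [Wz|nW] := pselect (W z); last by have /nbhs_singleton -> := b0 _ nW; rewrite !mul0r addr0.
  by case: fW => _ /(_ X f z Wz) ->; rewrite sum2; ring.
have sc f Y : psi (f *: Y) = f y * psi Y by rewrite -[f *: Y]addr0 lin psi0 addr0.
have := congr1 psi key; rewrite sc !lin !sc psi0 !CinfE (b1 _ Zy) => E1.
by rewrite -[LHS]mul1r -[X in X * _]mul1r E1; ring.
Qed.

(** Dual to [vfield_expand]. A second cutoff is needed at each point w of [W], where the value of
    [a] on [X] is computed by expanding [X] itself. *)
Lemma oneform_expand (psi : oneform -> R) :
  (forall f a b, psi (lc f a b) = f y * psi a + psi b) ->
  forall a, psi a = a (E 0) y * psi (differential (u 0)) + a (E 1) y * psi (differential (u 1)).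
Proof.
move=> lin a; have [b [Z [_ Zy _ b1 b0]]] := cutoff oW Wy.
have [z Hz] : exists z : oneform, forall X, z X = 0.
  by apply: mk_oneform => g X Y; rewrite mulr0 addr0.
have psi0 : psi z = 0.
  apply: (addrI (psi z)); rewrite addr0.
  have -> : z = lc 1 z z by apply: oneformP => X; rewrite lcE !Hz mulr0 addr0.
  have -> : lc 1 z z = z by apply: oneformP => X; rewrite lcE !Hz mulr0 addr0.
  rewrite -[in RHS](_ : lc 1 z z = z); last by apply: oneformP => X; rewrite lcE !Hz mulr0 addr0.
  by rewrite lin CinfE mul1r.
have key : lc b a z = lc (b * a (E 0)) (differential (u 0)) (lc (b * a (E 1)) (differential (u 1)) z).
  apply: oneformP => X; rewrite !lcE !Hz !addr0; apply: CinfP => w.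
  rewrite !CinfE; have [Ww|nW] := pselect (W w); last by have /nbhs_singleton -> := b0 _ nW; rewrite !mul0r addr0.
  have [b' [Z' [_ Z'w _ b'1 b'0]]] := cutoff oW Ww.
  have bX : b' *: X = (b' * X (u 0)) *: E 0 + (b' * X (u 1)) *: E 1.
    apply: vfieldP => f; apply: CinfP => v.
    rewrite !(vfield_addE, vfield_scaleE) !CinfE.
    have [Wv|nWv] := pselect (W v); last by have /nbhs_singleton -> := b'0 _ nWv; rewrite !mul0r addr0.
    by case: fW => _ /(_ X f v Wv) ->; rewrite sum2; ring.
  have := congr1 (fun Y => a Y w) bX.
  rewrite oneformD !oneformZ !CinfE (b'1 _ Z'w) !mul1r => ->.
  by rewrite !differentialE; ring.
have := congr1 psi key; rewrite !lin psi0 !CinfE (b1 _ Zy) !addr0 !mul1r.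
by [].
Qed.

End Expansion.
End OneForms.

Section Tuples.
Variable T : Type.

Definition tri (a b c : T) : 'I_3 -> T := fun i => nth a [:: a; b; c] i.
Definition duo (a b : T) : 'I_2 -> T := fun i => nth a [:: a; b] i.

Definition o30 : 'I_3 := @Ordinal 3 0 isT.
Definition o31 : 'I_3 := @Ordinal 3 1 isT.
Definition o32 : 'I_3 := @Ordinal 3 2 isT.

Lemma ord3P (P : 'I_3 -> Prop) : P o30 -> P o31 -> P o32 -> forall i, P i.
Proof.
move=> P0 P1 P2 [[|[|[|//]]] lti].
- by rewrite (_ : Ordinal lti = o30) //; exact: val_inj.
- by rewrite (_ : Ordinal lti = o31) //; exact: val_inj.
- by rewrite (_ : Ordinal lti = o32) //; exact: val_inj.
Qed.

Lemma ord2P (P : 'I_2 -> Prop) : P 0 -> P 1 -> forall i, P i.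
Proof. by move=> P0 P1 i; case: (ord2E i) => ->. Qed.

Lemma tri_eta al : al = tri (al o30) (al o31) (al o32).
Proof. by apply/funext; apply: ord3P. Qed.

Lemma duo_eta al : al = duo (al 0) (al 1).
Proof. by apply/funext; apply: ord2P. Qed.

Lemma tri_set0 a b c d : ([eta tri a b c with o30 |-> d] : 'I_3 -> T) = tri d b c.
Proof. by apply/funext; apply: ord3P. Qed.
Lemma tri_set1 a b c d : ([eta tri a b c with o31 |-> d] : 'I_3 -> T) = tri a d c.
Proof. by apply/funext; apply: ord3P. Qed.
Lemma tri_set2 a b c d : ([eta tri a b c with o32 |-> d] : 'I_3 -> T) = tri a b d.
Proof. by apply/funext; apply: ord3P. Qed.
Lemma duo_set0 a b d : ([eta duo a b with 0 |-> d] : 'I_2 -> T) = duo d b.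
Proof. by apply/funext; apply: ord2P. Qed.
Lemma tri_swap01 a b c : tri a b c \o tperm o30 o31 = tri b a c.
Proof. by apply/funext; apply: ord3P; rewrite /= ?tpermL ?tpermR ?tpermD. Qed.
Lemma tri_swap12 a b c : tri a b c \o tperm o31 o32 = tri a c b.
Proof. by apply/funext; apply: ord3P; rewrite /= ?tpermL ?tpermR ?tpermD. Qed.
Lemma duo_swap a b : duo a b \o tperm 0 1 = duo b a.
Proof. by apply/funext; apply: ord2P; rewrite /= ?tpermL ?tpermR. Qed.

Lemma sum3 (V : nmodType) (F : 'I_3 -> V) : \sum_i F i = F o30 + F o31 + F o32.
Proof.
rewrite !big_ord_recr big_ord0 /= add0r.
by congr (F _ + F _ + F _); apply/val_inj.
Qed.

End Tuples.

Section SymVectors.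
Variables (R : realType) (M : oriented_surface R).
Local Notation C := (Cinf M).
Local Notation vfield := (vfield M).
Local Notation oneform := (oneform M).

Definition s3 (s : symvec M 3) a b c : C := s (tri a b c).
Definition s2 (s : symvec M 2) a b : C := s (duo a b).

Lemma s3_lin (s : symvec M 3) f a a' b c : s3 s (lc f a a') b c = f * s3 s a b c + s3 s a' b c.
Proof. by have := symvec_linear s (tri a b c) o30 f a a'; rewrite !tri_set0. Qed.
Lemma s3_sym01 (s : symvec M 3) a b c : s3 s a b c = s3 s b a c.
Proof. by rewrite /s3 -(symvec_sym s (tperm o30 o31)) tri_swap01. Qed.
Lemma s3_sym12 (s : symvec M 3) a b c : s3 s a b c = s3 s a c b.
Proof. by rewrite /s3 -(symvec_sym s (tperm o31 o32)) tri_swap12. Qed.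
Lemma s2_lin (s : symvec M 2) f a a' b : s2 s (lc f a a') b = f * s2 s a b + s2 s a' b.
Proof. by have := symvec_linear s (duo a b) 0 f a a'; rewrite !duo_set0. Qed.
Lemma s2_sym (s : symvec M 2) a b : s2 s a b = s2 s b a.
Proof. by rewrite /s2 -(symvec_sym s (tperm 0 1)) duo_swap. Qed.

Lemma mk_symvec2 (B : oneform -> oneform -> C) :
  (forall a b, B a b = B b a) ->
  (forall f a a' b, B (lc f a a') b = f * B a b + B a' b) ->
  exists s : symvec M 2, forall al, s al = B (al 0) (al 1).
Proof.
move=> Bs Bl; pose s (al : 'I_2 -> oneform) := B (al 0) (al 1).
have sym (p : 'S_2) al : s (al \o p) = s al.
  rewrite /s /=; have := @perm_inj _ p 0 1.
  by case: (ord2E (p 0)) => ->; case: (ord2E (p 1)) => -> // /(_ erefl).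
have lin al i f (b c : oneform) : s [eta al with i |-> (f \*: b \+ c : oneform)] =
    f * s [eta al with i |-> b] + s [eta al with i |-> c].
  rewrite /s; case: (ord2E i) => -> /=; first exact: Bl.
  by rewrite ![B (al 0) _]Bs; exact: Bl.
by exists (MkSymvec sym lin).
Qed.

Lemma symvec_eq k (s t : symvec M k) : (forall al, s al = t al) -> s = t.
Proof.
case: s t => [s a b] [t a' b'] /= /funext st; subst t.
by congr MkSymvec; exact: Prop_irrelevance.
Qed.

Lemma cubic_coefE (s : symvec M 3) u x :
  [/\ cubic_coef s u x 0 = s3 s (differential (u 0)) (differential (u 0)) (differential (u 0)) x,
      cubic_coef s u x 1 = s3 s (differential (u 1)) (differential (u 0)) (differential (u 0)) x,
      cubic_coef s u x 2 = s3 s (differential (u 1)) (differential (u 1)) (differential (u 0)) x &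
      cubic_coef s u x 3 = s3 s (differential (u 1)) (differential (u 1)) (differential (u 1)) x].
Proof.
split; rewrite /cubic_coef /s3; congr (symvec_fun s _ x); apply/funext; exact: ord3P.
Qed.

(** The polarization of the binary cubic with coefficients A_0, 3 A_1, 3 A_2, A_3. The pairs of
    arguments need not be covectors: the components of a covariant derivative are also inserted. *)
Definition cub (A : nat -> R) (a0 a1 b0 b1 c0 c1 : R) : R :=
  a0 * b0 * c0 * A 0%N + (a1 * b0 * c0 + a0 * b1 * c0 + a0 * b0 * c1) * A 1%N
  + (a1 * b1 * c0 + a1 * b0 * c1 + a0 * b1 * c1) * A 2%N + a1 * b1 * c1 * A 3%N.

Section Frame.
Variables (W : set M) (u : 'I_2 -> C) (E : 'I_2 -> vfield).
Hypotheses (oW : open W) (fW : frame_on W u E).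
Variables (y : M) (Wy : W y).
Local Notation d i := (differential (u i)).

Lemma s3_expand (s : symvec M 3) (a b c : oneform) : s3 s a b c y =
  cub (cubic_coef s u y) (a (E 0) y) (a (E 1) y) (b (E 0) y) (b (E 1) y) (c (E 0) y) (c (E 1) y).
Proof.
rewrite /cub; have [-> -> -> ->] := cubic_coefE s u y.
have L1 b' c' f a1 a2 : s3 s (lc f a1 a2) b' c' y = f y * s3 s a1 b' c' y + s3 s a2 b' c' y.
  by rewrite s3_lin.
have E1 a' b' c' := @oneform_expand R M W u E oW fW y Wy (fun a => s3 s a b' c' y) (L1 b' c') a'.
rewrite (E1 a b c) !(s3_sym01 s (d _) b c) !(E1 b) !(s3_sym12 s _ (d _) c) !(s3_sym01 s _ c) !(E1 c).
rewrite !(s3_sym12 s (d 0) (d 0) (d 1)) !(s3_sym01 s (d 0) (d 1)) !(s3_sym12 s (d 1) (d 0) (d 1)).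
ring.
Qed.

Lemma s2_expand (s : symvec M 2) (a b : oneform) : s2 s a b y =
  a (E 0) y * b (E 0) y * s2 s (d 0) (d 0) y
  + (a (E 0) y * b (E 1) y + a (E 1) y * b (E 0) y) * s2 s (d 0) (d 1) y
  + a (E 1) y * b (E 1) y * s2 s (d 1) (d 1) y.
Proof.
have L1 b' f a1 a2 : s2 s (lc f a1 a2) b' y = f y * s2 s a1 b' y + s2 s a2 b' y.
  by rewrite s2_lin.
have E1 a' b' := @oneform_expand R M W u E oW fW y Wy (fun a => s2 s a b' y) (L1 b') a'.
rewrite (E1 a b) !(s2_sym s (d _) b) !(E1 b) (s2_sym s (d 1) (d 0)).
ring.
Qed.

End Frame.
End SymVectors.

(** * The Chern connection *)

Section CubicAction.
Variable T : comPzRingType.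
Implicit Types a b p q r s : T.

(* The adjugate of the matrix of the action [gl2_action] of gl_2 on binary
   cubics, whose determinant is the discriminant. *)
Definition gl2_p a0 a1 a2 a3 b0 b1 b2 b3 : T :=
  (5 * a1 * a2 * a3 - a0 * a3 * a3 - 4 * a2 * a2 * a2) * b0
  + (2 * a1 * a2 * a2 - 2 * a1 * a1 * a3) * b1
  + (a0 * a1 * a3 - a1 * a1 * a2) * b2 + (2 * a1 * a1 * a1 - 2 * a0 * a1 * a2) * b3.
Definition gl2_q a0 a1 a2 a3 b0 b1 b2 b3 : T :=
  (a0 * a2 * a3 - 4 * a1 * a1 * a3 + 3 * a1 * a2 * a2) * b0
  + (2 * a0 * a1 * a3 - 2 * a0 * a2 * a2) * b1
  + (a0 * a1 * a2 - a0 * a0 * a3) * b2 + (2 * a0 * a0 * a2 - 2 * a0 * a1 * a1) * b3.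
Definition gl2_r a0 a1 a2 a3 b0 b1 b2 b3 : T :=
  (2 * a1 * a3 * a3 - 2 * a2 * a2 * a3) * b0
  + (a1 * a2 * a3 - a0 * a3 * a3) * b1
  + (2 * a0 * a2 * a3 - 2 * a1 * a1 * a3) * b2
  + (a0 * a1 * a3 - 4 * a0 * a2 * a2 + 3 * a1 * a1 * a2) * b3.
Definition gl2_s a0 a1 a2 a3 b0 b1 b2 b3 : T :=
  (2 * a2 * a2 * a2 - 2 * a1 * a2 * a3) * b0
  + (a0 * a2 * a3 - a1 * a2 * a2) * b1
  + (2 * a1 * a1 * a2 - 2 * a0 * a2 * a2) * b2
  + (5 * a0 * a1 * a2 - a0 * a0 * a3 - 4 * a1 * a1 * a1) * b3.

(** The matrix with rows (p, q) and (r, s) acting as a derivation on the cubic; the first and last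
    equations are divided by their common factor 3. *)
Definition gl2_action a0 a1 a2 a3 b0 b1 b2 b3 p q r s :=
  [/\ p * a0 + q * a1 = b0, r * a0 + s * a1 + 2 * (p * a1 + q * a2) = b1,
      2 * (r * a1 + s * a2) + p * a2 + q * a3 = b2 & r * a2 + s * a3 = b3].

(** Solves p_l = G 0 l 0 - w_l/3, q_l = G 0 l 1, r_l = G 1 l 0, s_l = G 1 l 1 - w_l/3 for symmetric
    G. The symmetries G 0 0 1 = G 0 1 0 and G 1 0 1 = G 1 1 0 force w_1 = 3 (q_0 - p_1) and w_0 = 3
    (r_1 - s_0), which is [chern_form], and then fix the diagonal symbols. *)
Definition christoffel (p q r s : 'I_2 -> T) (k i j : 'I_2) : T :=
  if k == 0 then
    if i == 0 then (if j == 0 then p 0 + r 1 - s 0 else q 0)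
    else (if j == 0 then q 0 else q 1)
  else
    if i == 0 then (if j == 0 then r 0 else r 1)
    else (if j == 0 then r 1 else s 1 + q 0 - p 1).

Definition chern_form (p q r s : 'I_2 -> T) (l : 'I_2) : T :=
  if l == 0 then 3 * (r 1 - s 0) else 3 * (q 0 - p 1).

Lemma christoffel_sym (p q r s : 'I_2 -> T) k i j :
  christoffel p q r s k i j = christoffel p q r s k j i.
Proof. by rewrite /christoffel; case: eqP => _; case: eqP => _; case: eqP. Qed.

End CubicAction.

Section CubicActionField.
Variable F : realType.
Implicit Types p q r s : F.

Lemma gl2_solve (a0 a1 a2 a3 b0 b1 b2 b3 : F) p q r s :
  gl2_action a0 a1 a2 a3 b0 b1 b2 b3 p q r s ->
  [/\ discr a0 a1 a2 a3 * p = gl2_p a0 a1 a2 a3 b0 b1 b2 b3,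
      discr a0 a1 a2 a3 * q = gl2_q a0 a1 a2 a3 b0 b1 b2 b3,
      discr a0 a1 a2 a3 * r = gl2_r a0 a1 a2 a3 b0 b1 b2 b3 &
      discr a0 a1 a2 a3 * s = gl2_s a0 a1 a2 a3 b0 b1 b2 b3].
Proof.
by move=> [<- <- <- <-]; split; rewrite /discr /gl2_p /gl2_q /gl2_r /gl2_s; ring.
Qed.

Lemma gl2_solution (a0 a1 a2 a3 b0 b1 b2 b3 : F) : discr a0 a1 a2 a3 != 0 ->
  let i := (discr a0 a1 a2 a3)^-1 in
  gl2_action a0 a1 a2 a3 b0 b1 b2 b3 (i * gl2_p a0 a1 a2 a3 b0 b1 b2 b3)
    (i * gl2_q a0 a1 a2 a3 b0 b1 b2 b3) (i * gl2_r a0 a1 a2 a3 b0 b1 b2 b3)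
    (i * gl2_s a0 a1 a2 a3 b0 b1 b2 b3).
Proof.
move=> d0 i; have i1 : i * discr a0 a1 a2 a3 = 1 by rewrite mulVf.
(* Inserting the factor i discr = 1 on the right turns each equation into a polynomial identity with
   i opaque. *)
have key x b : x = i * discr a0 a1 a2 a3 * b -> x = b by move=> ->; rewrite i1 mul1r.
move: i i1 key => i _ key.
by split; apply: key; rewrite /discr /gl2_p /gl2_q /gl2_r /gl2_s; ring.
Qed.

(* The equation d_nabla sigma = omega (x) sigma in a commuting frame:
   [D l m] is the derivative of the m-th coefficient of sigma along the l-th
   field, [G] are the Christoffel symbols and [w] the components of omega. *)
Definition chern_system (a : nat -> F) (D : 'I_2 -> nat -> F)
    (G : 'I_2 -> 'I_2 -> 'I_2 -> F) (w : 'I_2 -> F) (l : 'I_2) : Prop :=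
  [/\ D l 0%N + 3 * (G 0 l 0 * a 0%N + G 0 l 1 * a 1%N) = w l * a 0%N,
      D l 1%N + (G 1 l 0 * a 0%N + G 1 l 1 * a 1%N)
        + 2 * (G 0 l 0 * a 1%N + G 0 l 1 * a 2%N) = w l * a 1%N,
      D l 2%N + 2 * (G 1 l 0 * a 1%N + G 1 l 1 * a 2%N)
        + (G 0 l 0 * a 2%N + G 0 l 1 * a 3%N) = w l * a 2%N &
      D l 3%N + 3 * (G 1 l 0 * a 2%N + G 1 l 1 * a 3%N) = w l * a 3%N].

(** The identity matrix acts on cubics as multiplication by 3, so omega is absorbed into the
    diagonal entries as w/3. *)
Lemma chern_systemP a D G w l : chern_system a D G w l <->
  gl2_action (a 0%N) (a 1%N) (a 2%N) (a 3%N)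
    (- D l 0%N / 3) (- D l 1%N) (- D l 2%N) (- D l 3%N / 3)
    (G 0 l 0 - w l / 3) (G 0 l 1) (G 1 l 0) (G 1 l 1 - w l / 3).
Proof.
by split=> -[e0 e1 e2 e3]; split; lra.
Qed.

(** Eight equations for six symmetric Christoffel symbols and two components of omega: freeness of
    the action fixes G up to the diagonal shift by w/3, and symmetry of G removes that freedom. *)
Lemma chern_system_unique a D G w G' w' :
  discr (a 0%N) (a 1%N) (a 2%N) (a 3%N) != 0 ->
  (forall k i j, G k i j = G k j i) -> (forall k i j, G' k i j = G' k j i) ->
  (forall l, chern_system a D G w l) -> (forall l, chern_system a D G' w' l) ->
  (forall k i j, G k i j = G' k i j) /\ forall l, w l = w' l.
Proof.
move=> d0 sG sG' S S'.
have key l : [/\ G 0 l 0 - w l / 3 = G' 0 l 0 - w' l / 3, G 0 l 1 = G' 0 l 1,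
    G 1 l 0 = G' 1 l 0 & G 1 l 1 - w l / 3 = G' 1 l 1 - w' l / 3].
  have /chern_systemP/gl2_solve [p q r s] := S l.
  have /chern_systemP/gl2_solve [p' q' r' s'] := S' l.
  by split; apply: (mulfI d0); rewrite ?p ?q ?r ?s.
have [p0 q0 r0 s0] := key 0; have [p1 q1 r1 s1] := key 1.
have := sG 0 0 1; have := sG 1 0 1; have := sG' 0 0 1; have := sG' 1 0 1.
move=> h1 h2 h3 h4.
have w0 : w 0 = w' 0 by lra.
have w1 : w 1 = w' 1 by lra.
split; last by move=> l; case: (ord2E l) => ->.
move=> k i j; case: (ord2E k) => ->; case: (ord2E i) => ->; case: (ord2E j) => ->; lra.
Qed.

Lemma chern_system_solution a D (p q r s : 'I_2 -> F) :
  (forall l, gl2_action (a 0%N) (a 1%N) (a 2%N) (a 3%N)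
    (- D l 0%N / 3) (- D l 1%N) (- D l 2%N) (- D l 3%N / 3) (p l) (q l) (r l) (s l)) ->
  forall l, chern_system a D (christoffel p q r s) (chern_form p q r s) l.
Proof.
move=> H l; apply/chern_systemP; have := H l.
case: (ord2E l) => ->; rewrite /christoffel /chern_form /= => -[<- <- <- <-]; split; lra.
Qed.

End CubicActionField.

(** * Affine connections in a frame *)

Section ChernConnection.
Variables (R : realType) (M : oriented_surface R).
Local Notation C := (Cinf M).
Local Notation vfield := (vfield M).
Local Notation oneform := (oneform M).
Implicit Types (X Y : vfield) (a b c : oneform) (N : connection vfield).

Lemma s3_lin2 (s : symvec M 3) f a b b' c :
  s3 s a (lc f b b') c = f * s3 s a b c + s3 s a b' c.
Proof. by rewrite s3_sym01 s3_lin !(s3_sym01 s a). Qed.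

Lemma s3_lin3 (s : symvec M 3) f a b c c' :
  s3 s a b (lc f c c') = f * s3 s a b c + s3 s a b c'.
Proof. by rewrite s3_sym12 s3_lin2 !(s3_sym12 s a b). Qed.

Lemma connection_eq (V : lmodType C) (D D' : connection V) :
  (forall X s, D X s = D' X s) -> D = D'.
Proof.
case: D D' => [D a b c] [D' a' b' c'] /= E.
have {}E : D = D' by apply/funext => X; apply/funext => s.
by subst D'; congr MkConnection; exact: Prop_irrelevance.
Qed.

Lemma Cinf_natE n (y : M) : (n%:R : C) y = n%:R.
Proof. by elim: n => [//|n IH]; rewrite -!natr1 CinfDE IH. Qed.

Lemma lieE X Y f : lie X Y f = X (Y f) - Y (X f).
Proof. by []. Qed.

Lemma frame_ex (x : M) : exists W, exists (c : chart R M) u E,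
  [/\ open W, W x, frame_on W u E & forall y, W y -> coordinates_at c y u].
Proof.
have [c ac cx] := atlas_cover x; have [W [u [E H]]] := frame_exists ac cx.
by exists W, c, u, E.
Qed.

(** An origin to which the correction tensor of the Chern connection will be added. The flat
    connections of the local frames are averaged; since fields are derivations, the averaging is
    done on the functions obtained for each triple X, Y, g. *)
Lemma affine_exists : exists N : connection vfield, True.
Proof.
have [W HW] := choice frame_ex.
have oW x : open (W x) by have [c [u [E []]]] := HW x.
have Wx x : W x x by have [c [u [E []]]] := HW x.
have [w [m pw]] := partition_of_unity oW Wx.
have loc n : exists Dn : vfield -> vfield -> vfield, forall y, w n y != 0 ->
    [/\ forall f X Y Z g, Dn (f *: X + Y) Z g y = f y * Dn X Z g y + Dn Y Z g y,
        forall X Y Z g, Dn X (Y + Z) g y = Dn X Y g y + Dn X Z g y &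
        forall X f Y g, Dn X (f *: Y) g y = X f y * Y g y + f y * Dn X Y g y].
  case: (pw) => /(_ n) [[z Hz]|w0] _ _; last by exists (fun _ _ => 0) => y; rewrite w0 eqxx.
  have [_ [u [E [_ _ fW _]]]] := HW z.
  exists (fun X Y => X (Y (u 0)) *: E 0 + X (Y (u 1)) *: E 1) => y /Hz Wy.
  split=> [f X Y Z g|X Y Z g|X f Y g]; rewrite !vfield_addE !vfield_scaleE ?vfield_addE ?vfield_scaleE ?vfieldD ?vfieldM !CinfE.
  - ring.
  - ring.
  - rewrite (frame_eval fW Wy Y g); ring.
have [D0 HD0] := choice loc.
have gl XYg : exists t : C, forall x, t x = \sum_(n < m x) w n x * D0 n XYg.1.1 XYg.1.2 XYg.2 x.
  exact: (partition_glueC pw (fun n => D0 n XYg.1.1 XYg.1.2 XYg.2)).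
have [D' HD'] := choice gl.
pose D X Y g := D' (X, Y, g).
have HD X Y g x : D X Y g x = \sum_(n < m x) w n x * D0 n X Y g x by exact: (HD' (X, Y, g)).
have DD X Y f g : D X Y (f + g) = D X Y f + D X Y g.
  apply: CinfP => x; rewrite CinfDE !HD -big_split; apply: eq_bigr => n _.
  by rewrite vfieldD CinfDE mulrDr.
have DM X Y f g : D X Y (f * g) = D X Y f * g + f * D X Y g.
  apply: CinfP => x; rewrite CinfDE !CinfME !HD mulr_suml mulr_sumr -big_split; apply: eq_bigr => n _.
  by rewrite /= vfieldM CinfDE !CinfME; ring.
have DZ X Y r f : D X Y (cstC M r * f) = cstC M r * D X Y f.
  apply: CinfP => x; rewrite CinfME !HD mulr_sumr; apply: eq_bigr => n _.
  by rewrite vfieldZ CinfME; ring.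
pose N X Y := MkVfield (DD X Y) (DZ X Y) (DM X Y).
have N1 f X Y Z : N (f *: X + Y) Z = f *: N X Z + N Y Z.
  apply: vfieldP => g; apply: CinfP => x; rewrite vfield_addE vfield_scaleE CinfDE CinfME /= !HD mulr_sumr -big_split /=.
  transitivity (\sum_(n < m x) w n x * (f x * D0 n X Z g x + D0 n Y Z g x)).
    by apply: (@partition_eq _ _ w m (fun n => D0 n (f *: X + Y) Z g x) (fun n => f x * D0 n X Z g x + D0 n Y Z g x) x) => n /HD0 [].
  by apply: eq_bigr => n _; ring.
have N2 X Y Z : N X (Y + Z) = N X Y + N X Z.
  apply: vfieldP => g; apply: CinfP => x; rewrite vfield_addE CinfDE /= !HD -big_split /=.
  transitivity (\sum_(n < m x) w n x * (D0 n X Y g x + D0 n X Z g x)).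
    by apply: (@partition_eq _ _ w m (fun n => D0 n X (Y + Z) g x) (fun n => D0 n X Y g x + D0 n X Z g x) x) => n /HD0 [].
  by apply: eq_bigr => n _; ring.
have N3 X f Y : N X (f *: Y) = X f *: Y + f *: N X Y.
  apply: vfieldP => g; apply: CinfP => x; rewrite vfield_addE !vfield_scaleE CinfDE !CinfME /= !HD.
  rewrite -[X f x * _](partition_cst pw _ x) mulr_sumr -big_split /=.
  transitivity (\sum_(n < m x) w n x * (X f x * Y g x + f x * D0 n X Y g x)).
    by apply: (@partition_eq _ _ w m (fun n => D0 n X (f *: Y) g x) (fun n => X f x * Y g x + f x * D0 n X Y g x) x) => n /HD0 [].
  by apply: eq_bigr => n _; ring.
by exists (MkConnection N1 N2 N3).
Qed.

Lemma cov1E N X a Y : cov1 N X a Y = X (a Y) - a (N X Y).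
Proof. by []. Qed.

Lemma cov1_vfield N f X Y a : cov1 N (f *: X + Y) a = lc f (cov1 N X a) (cov1 N Y a).
Proof.
apply: oneformP => Z; rewrite lcE !cov1E nabla_vfield oneform_lin vfield_addE vfield_scaleE; ring.
Qed.

Lemma cov1_lc N X f a b : cov1 N X (lc f a b) = lc f (cov1 N X a) (lc (X f) a (cov1 N X b)).
Proof. by apply: oneformP => Z; rewrite !(lcE, cov1E) vfieldD vfieldM; ring. Qed.

Lemma cov_tri N X (s : symvec M 3) a b c : cov_symvec N X s (tri a b c) =
  X (s3 s a b c) - (s3 s (cov1 N X a) b c + s3 s a (cov1 N X b) c + s3 s a b (cov1 N X c)).
Proof. by rewrite /cov_symvec sum3 tri_set0 tri_set1 tri_set2. Qed.

Section Frame.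
Variables (W : set M) (u : 'I_2 -> C) (E : 'I_2 -> vfield).
Hypotheses (oW : open W) (fW : frame_on W u E).
Variables (y : M) (Wy : W y).
Local Notation d i := (differential (u i)).

(** The function [E i (u j)] is constant near y. Hence brackets of frame fields vanish, and no
    derivative of the frame enters the component formulas. *)
Lemma frame_vfield_const X i j : X (E i (u j)) y = 0.
Proof.
rewrite (@vfield_local _ _ X _ (cstC M (i == j)%:R)) ?vfield_cst //.
by apply: filterS (open_near oW Wy) => z Wz; rewrite (frame_delta fW Wz).
Qed.

Lemma oneform_frame (a : oneform) X : a X y = X (u 0) y * a (E 0) y + X (u 1) y * a (E 1) y.
Proof.
apply: (vfield_expand oW fW Wy (psi := fun X => a X y)) => f X' Y'.
by rewrite oneform_lin.
Qed.

Lemma trilinear_zero (K : oneform -> oneform -> oneform -> R) :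
  (forall f a a' b c, K (lc f a a') b c = f y * K a b c + K a' b c) ->
  (forall a b c, K a b c = K b a c) -> (forall a b c, K a b c = K a c b) ->
  K (d 0) (d 0) (d 0) = 0 -> K (d 1) (d 0) (d 0) = 0 ->
  K (d 1) (d 1) (d 0) = 0 -> K (d 1) (d 1) (d 1) = 0 ->
  forall a b c, K a b c = 0.
Proof.
move=> L S01 S12 K0 K1 K2 K3 a b c.
have E1 a' b' c' := @oneform_expand R M W u E oW fW y Wy (fun a => K a b' c') (fun f a1 a2 => L f a1 a2 b' c') a'.
rewrite (E1 a b c) !(S01 (d _) b c) !(E1 b) !(S12 _ (d _) c) !(S01 _ c) !(E1 c).
rewrite !(S12 (d 0) (d 0) (d 1)) !(S01 (d 0) (d 1)) !(S12 (d 1) (d 0) (d 1)).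
by rewrite K0 K1 K2 K3; ring.
Qed.

Definition coef_fun (s : symvec M 3) (m : nat) : C :=
  match m with
  | 0 => s3 s (d 0) (d 0) (d 0)
  | 1 => s3 s (d 1) (d 0) (d 0)
  | 2 => s3 s (d 1) (d 1) (d 0)
  | _ => s3 s (d 1) (d 1) (d 1)
  end.

Lemma coef_funE (s : symvec M 3) (z : M) :
  [/\ coef_fun s 0 z = cubic_coef s u z 0, coef_fun s 1 z = cubic_coef s u z 1,
      coef_fun s 2 z = cubic_coef s u z 2 & coef_fun s 3 z = cubic_coef s u z 3].
Proof. by have [-> -> -> ->] := cubic_coefE s u z. Qed.

Definition chern_eq_at (s : symvec M 3) N (w : vfield -> R) (z : M) :=
  forall X a b c, cov_symvec N X s (tri a b c) z = w X * s3 s a b c z.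

Definition frame_system (s : symvec M 3) N (w : vfield -> R) := forall l,
  chern_system (cubic_coef s u y) (fun l m => E l (coef_fun s m) y)
    (fun k i j => N (E i) (E j) (u k) y) (fun l => w (E l)) l.

(** The difference of the two sides is linear over functions in the field and in the three forms,
    since derivatives of the coefficients cancel, and it is symmetric in the forms. It therefore
    vanishes as soon as its four components along each frame field do. *)
Lemma chern_eq_frame (s : symvec M 3) N (w : vfield -> R) :
  (forall f X Y, w (f *: X + Y) = f y * w X + w Y) ->
  chern_eq_at s N w y <-> frame_system s N w.
Proof.
move=> wl.
have c1 l i m : cov1 N (E l) (d i) (E m) y = - N (E l) (E m) (u i) y.
  by rewrite cov1E !differentialE CinfDE CinfNE frame_vfield_const sub0r.
have dd i m : d i (E m) y = (m == i)%:R by rewrite differentialE (frame_delta fW Wy).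
have [A0 A1 A2 A3] := cubic_coefE s u y.
have key l : [/\ cov_symvec N (E l) s (tri (d 0) (d 0) (d 0)) y =
    E l (coef_fun s 0) y + 3 * (N (E l) (E 0) (u 0) y * cubic_coef s u y 0 + N (E l) (E 1) (u 0) y * cubic_coef s u y 1),
  cov_symvec N (E l) s (tri (d 1) (d 0) (d 0)) y =
    E l (coef_fun s 1) y + (N (E l) (E 0) (u 1) y * cubic_coef s u y 0 + N (E l) (E 1) (u 1) y * cubic_coef s u y 1)
    + 2 * (N (E l) (E 0) (u 0) y * cubic_coef s u y 1 + N (E l) (E 1) (u 0) y * cubic_coef s u y 2),
  cov_symvec N (E l) s (tri (d 1) (d 1) (d 0)) y =
    E l (coef_fun s 2) y + 2 * (N (E l) (E 0) (u 1) y * cubic_coef s u y 1 + N (E l) (E 1) (u 1) y * cubic_coef s u y 2)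
    + (N (E l) (E 0) (u 0) y * cubic_coef s u y 2 + N (E l) (E 1) (u 0) y * cubic_coef s u y 3) &
  cov_symvec N (E l) s (tri (d 1) (d 1) (d 1)) y =
    E l (coef_fun s 3) y + 3 * (N (E l) (E 0) (u 1) y * cubic_coef s u y 2 + N (E l) (E 1) (u 1) y * cubic_coef s u y 3)].
  by split; rewrite cov_tri !CinfE !(s3_expand oW fW Wy) !c1 !dd /cub /=; ring.
split=> H.
  move=> l; have [k0 k1 k2 k3] := key l.
  split; rewrite -?k0 -?k1 -?k2 -?k3 H; congr (_ * _); by rewrite ?A0 ?A1 ?A2 ?A3.
pose K X a b c := cov_symvec N X s (tri a b c) y - w X * s3 s a b c y.
suff K0 X a b c : K X a b c = 0 by move=> X a b c; apply/eqP; rewrite -subr_eq0; apply/eqP/K0.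
have KX f X' Y' a' b' c' : K (f *: X' + Y') a' b' c' = f y * K X' a' b' c' + K Y' a' b' c'.
  rewrite /K !cov_tri !cov1_vfield wl vfield_addE vfield_scaleE.
  rewrite s3_lin s3_lin2 s3_lin3 !CinfE; ring.
have KE l : forall a b c, K (E l) a b c = 0.
  have [k0 k1 k2 k3] := key l; have [h0 h1 h2 h3] := H l.
  apply: trilinear_zero.
  - move=> f a1 a2 b' c'; rewrite /K !cov_tri cov1_lc !s3_lin vfieldD vfieldM !CinfE; ring.
  - move=> a' b' c'; rewrite /K !cov_tri !CinfE (s3_sym01 s b' a') (s3_sym01 s b' (cov1 _ _ a')).
    rewrite (s3_sym01 s (cov1 _ _ b')) (s3_sym01 s b' a' (cov1 _ _ _)); ring.
  - move=> a' b' c'; rewrite /K !cov_tri !CinfE (s3_sym12 s _ c' b') (s3_sym12 s (cov1 _ _ a') c').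
    rewrite (s3_sym12 s a' c' (cov1 _ _ b')) (s3_sym12 s a' (cov1 _ _ c')); ring.
  - by rewrite /K k0 h0 A0 subrr.
  - by rewrite /K k1 h1 A1 subrr.
  - by rewrite /K k2 h2 A2 subrr.
  - by rewrite /K k3 h3 A3 subrr.
rewrite (vfield_expand oW fW Wy (psi := fun X => K X a b c) (fun f X' Y' => KX f X' Y' a b c)).
by rewrite !KE !mulr0 addr0.
Qed.

Definition torsion_free_at N (z : M) := forall X Y f, (N X Y - N Y X) f z = lie X Y f z.

(** Torsion is linear over functions in both fields, and the frame fields commute. *)
Lemma torsion_frame N : torsion_free_at N y <->
  forall k i j, N (E i) (E j) (u k) y = N (E j) (E i) (u k) y.
Proof.
have sub X Y f : (X - Y) f y = X f y - Y f y.
  by rewrite vfield_addE CinfDE -scaleN1r vfield_scaleE CinfME CinfNE Cinf1E mulN1r.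
split=> [H k i j|H X Y f].
  apply/eqP; rewrite -subr_eq0 -sub H lieE CinfDE CinfNE !frame_vfield_const subrr.
  exact: eqxx.
pose T X Y f := (N X Y - N Y X) f y - lie X Y f y.
suff T0 : T X Y f = 0 by apply/eqP; rewrite -subr_eq0; apply/eqP.
have TX g X' Y' Z : T (g *: X' + Y') Z f = g y * T X' Z f + T Y' Z f.
  rewrite /T !sub !lieE nabla_vfield nablaD nabla_leibniz !(vfield_addE, vfield_scaleE) vfieldD vfieldM !CinfE; ring.
have TA X' Y' : T X' Y' f = - T Y' X' f.
  by rewrite /T !sub !lieE !CinfE; ring.
have T1 X' Y' : T X' Y' f = X' (u 0) y * T (E 0) Y' f + X' (u 1) y * T (E 1) Y' f.
  by apply: (vfield_expand oW fW Wy (psi := fun X => T X Y' f)).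
have TE i j : T (E i) (E j) f = 0.
  by rewrite /T -sub (frame_eval fW Wy) !sub !lieE !CinfE !frame_vfield_const (H 0 i j) (H 1 i j); ring.
by rewrite T1 (TA (E 0)) (TA (E 1)) !(T1 Y) !TE; ring.
Qed.

(** The difference of two connections is linear over functions in both fields. *)
Lemma connection_frame_eq N N' :
  (forall k i j, N (E i) (E j) (u k) y = N' (E i) (E j) (u k) y) ->
  forall X Y f, N X Y f y = N' X Y f y.
Proof.
move=> H X Y f; apply/eqP; rewrite -subr_eq0; apply/eqP.
pose T X Y := N X Y f y - N' X Y f y.
have TX g X' Y' Z : T (g *: X' + Y') Z = g y * T X' Z + T Y' Z.
  by rewrite /T !nabla_vfield !(vfield_addE, vfield_scaleE) !CinfE; ring.
have TY g X' Y' Z : T Z (g *: X' + Y') = g y * T Z X' + T Z Y'.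
  by rewrite /T !nablaD !nabla_leibniz !(vfield_addE, vfield_scaleE) !CinfE; ring.
rewrite -/(T X Y) (vfield_expand oW fW Wy (psi := fun X => T X Y)) //.
rewrite !(vfield_expand oW fW Wy (psi := fun Y => T _ Y) (fun g X' Y' => TY g X' Y' _) Y).
have TE i j : T (E i) (E j) = 0.
  by rewrite /T (frame_eval fW Wy (N (E i) (E j)) f) (frame_eval fW Wy (N' (E i) (E j)) f) (H 0 i j) (H 1 i j) subrr.
by rewrite !TE; ring.
Qed.

End Frame.
End ChernConnection.

Section Evaluation.
Variables (R : realType) (M : oriented_surface R).
Implicit Types p q r v : 'I_2 -> Cinf M.

Lemma christoffel_eval p q r v (y : M) k i j : christoffel p q r v k i j y =
  christoffel (p^~ y) (q^~ y) (r^~ y) (v^~ y) k i j.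
Proof.
by rewrite /christoffel; case: eqP => _; case: eqP => _; case: eqP => _; rewrite ?CinfE.
Qed.

Lemma chern_form_eval p q r v (y : M) l : chern_form p q r v l y =
  chern_form (p^~ y) (q^~ y) (r^~ y) (v^~ y) l.
Proof. by rewrite /chern_form; case: eqP => _; rewrite !(Cinf_natE, CinfE). Qed.

(** The solution formulas make sense over any commutative ring: over smooth functions they yield
    smooth coefficients, whose values are by conversion the same formulas over the reals. *)
Lemma gl2_eval (a0 a1 a2 a3 b0 b1 b2 b3 : Cinf M) (y : M) :
  [/\ gl2_p a0 a1 a2 a3 b0 b1 b2 b3 y = gl2_p (a0 y) (a1 y) (a2 y) (a3 y) (b0 y) (b1 y) (b2 y) (b3 y),
      gl2_q a0 a1 a2 a3 b0 b1 b2 b3 y = gl2_q (a0 y) (a1 y) (a2 y) (a3 y) (b0 y) (b1 y) (b2 y) (b3 y),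
      gl2_r a0 a1 a2 a3 b0 b1 b2 b3 y = gl2_r (a0 y) (a1 y) (a2 y) (a3 y) (b0 y) (b1 y) (b2 y) (b3 y) &
      gl2_s a0 a1 a2 a3 b0 b1 b2 b3 y = gl2_s (a0 y) (a1 y) (a2 y) (a3 y) (b0 y) (b1 y) (b2 y) (b3 y)].
Proof.
by split; reflexivity.
Qed.

End Evaluation.

Section ChernExistence.
Variables (R : realType) (M : oriented_surface R) (s : symvec M 3).
Hypothesis reg : regular s.
Local Notation C := (Cinf M).
Local Notation vfield := (vfield M).
Local Notation oneform := (oneform M).
Implicit Types (X Y : vfield) (a b : oneform) (N : connection vfield).

Lemma regular_discr (c : chart R M) y u : coordinates_at c y u ->
  discr (cubic_coef s u y 0) (cubic_coef s u y 1) (cubic_coef s u y 2) (cubic_coef s u y 3) != 0.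
Proof. exact: reg. Qed.

(** Uniqueness at one point, from the equations at that point alone; this is what lets local
    solutions be glued. *)
Lemma chern_unique_at N N' (w w' : vfield -> R) (y : M) :
  (forall f X Y, w (f *: X + Y) = f y * w X + w Y) ->
  (forall f X Y, w' (f *: X + Y) = f y * w' X + w' Y) ->
  torsion_free_at N y -> torsion_free_at N' y ->
  chern_eq_at s N w y -> chern_eq_at s N' w' y ->
  (forall X Y f, N X Y f y = N' X Y f y) /\ forall X, w X = w' X.
Proof.
move=> wl wl' tN tN' cN cN'; have [W [c [u [E [oW Wy fW co]]]]] := frame_ex y.
have sN := (torsion_frame oW fW Wy N).1 tN.
have sN' := (torsion_frame oW fW Wy N').1 tN'.
have fN := (chern_eq_frame oW fW Wy s N wl).1 cN.
have fN' := (chern_eq_frame oW fW Wy s N' wl').1 cN'.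
have [G w_eq] := chern_system_unique (regular_discr (co y Wy)) sN sN' fN fN'.
split; first exact: (connection_frame_eq oW fW Wy G).
move=> X; rewrite (vfield_expand oW fW Wy wl) (vfield_expand oW fW Wy wl').
by rewrite !w_eq.
Qed.

Lemma chern_unique N N' : is_chern s N -> is_chern s N' -> N = N'.
Proof.
move=> [tN [w cN]] [tN' [w' cN']]; apply: connection_eq => X Y; apply: vfieldP => f.
apply: CinfP => y.
have [||||||H _] := @chern_unique_at N N' (fun X => w X y) (fun X => w' X y) y.
- by move=> g X' Y'; rewrite oneform_lin.
- by move=> g X' Y'; rewrite oneform_lin.
- by move=> X' Y' g; rewrite tN.
- by move=> X' Y' g; rewrite tN'.
- by move=> X' a b c; rewrite cN.
- by move=> X' a b c; rewrite cN'.
exact: H.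
Qed.

Lemma chern_local (x : M) : exists (N : connection vfield) (om : vfield -> C), exists Q,
  [/\ open Q, Q x, forall f X Y, om (f *: X + Y) = f * om X + om Y &
      forall y, Q y -> torsion_free_at N y /\ chern_eq_at s N (fun X => om X y) y].
Proof.
have [N0 _] := affine_exists M.
have [W [c [u [E [oW Wx fW co]]]]] := frame_ex x.
pose cc := coef_fun u s.
pose dl : C := 6 * cc 0%N * cc 1%N * cc 2%N * cc 3%N - 4 * (cc 0%N * cc 2%N ^+ 3 + cc 3%N * cc 1%N ^+ 3)
  + 3 * cc 1%N ^+ 2 * cc 2%N ^+ 2 - cc 0%N ^+ 2 * cc 3%N ^+ 2.
have ccE z : [/\ cc 0%N z = cubic_coef s u z 0, cc 1%N z = cubic_coef s u z 1,
      cc 2%N z = cubic_coef s u z 2 & cc 3%N z = cubic_coef s u z 3] by exact: coef_funE.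
have dlE z : dl z = discr (cubic_coef s u z 0) (cubic_coef s u z 1) (cubic_coef s u z 2) (cubic_coef s u z 3).
  by have [<- <- <- <-] := ccE z; rewrite /dl !exprS !expr0 !(Cinf_natE, CinfE) /discr; ring.
have dl0 z : W z -> dl z != 0 by move=> Wz; rewrite dlE; apply: regular_discr; exact: co.
(* A global smooth function that is the inverse of the discriminant near x only; the equations are
   claimed on that neighborhood [Q]. *)
have [i [Q [oQ Qx QW iE]]] := local_ext oW Wx (smooth_on_inv oW dl0 (Cinf_smooth_on dl oW)).
have [p pE] : exists p : 'I_2 -> C, forall l y, p l y = i y * gl2_p (cc 0%N y) (cc 1%N y) (cc 2%N y) (cc 3%N y)
    (- E l (cc 0%N) y / 3) (- E l (cc 1%N) y) (- E l (cc 2%N) y) (- E l (cc 3%N) y / 3).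
  exists (fun l => i * gl2_p (cc 0%N) (cc 1%N) (cc 2%N) (cc 3%N) (- E l (cc 0%N) * cstC M (3^-1))
    (- E l (cc 1%N)) (- E l (cc 2%N)) (- E l (cc 3%N) * cstC M (3^-1))) => l y.
  by rewrite CinfME; have [-> _ _ _] := gl2_eval (cc 0%N) (cc 1%N) (cc 2%N) (cc 3%N) (- E l (cc 0%N) * cstC M (3^-1))
    (- E l (cc 1%N)) (- E l (cc 2%N)) (- E l (cc 3%N) * cstC M (3^-1)) y.
have [q qE] : exists q : 'I_2 -> C, forall l y, q l y = i y * gl2_q (cc 0%N y) (cc 1%N y) (cc 2%N y) (cc 3%N y)
    (- E l (cc 0%N) y / 3) (- E l (cc 1%N) y) (- E l (cc 2%N) y) (- E l (cc 3%N) y / 3).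
  exists (fun l => i * gl2_q (cc 0%N) (cc 1%N) (cc 2%N) (cc 3%N) (- E l (cc 0%N) * cstC M (3^-1))
    (- E l (cc 1%N)) (- E l (cc 2%N)) (- E l (cc 3%N) * cstC M (3^-1))) => l y.
  by rewrite CinfME; have [_ -> _ _] := gl2_eval (cc 0%N) (cc 1%N) (cc 2%N) (cc 3%N) (- E l (cc 0%N) * cstC M (3^-1))
    (- E l (cc 1%N)) (- E l (cc 2%N)) (- E l (cc 3%N) * cstC M (3^-1)) y.
have [r rE] : exists r : 'I_2 -> C, forall l y, r l y = i y * gl2_r (cc 0%N y) (cc 1%N y) (cc 2%N y) (cc 3%N y)
    (- E l (cc 0%N) y / 3) (- E l (cc 1%N) y) (- E l (cc 2%N) y) (- E l (cc 3%N) y / 3).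
  exists (fun l => i * gl2_r (cc 0%N) (cc 1%N) (cc 2%N) (cc 3%N) (- E l (cc 0%N) * cstC M (3^-1))
    (- E l (cc 1%N)) (- E l (cc 2%N)) (- E l (cc 3%N) * cstC M (3^-1))) => l y.
  by rewrite CinfME; have [_ _ -> _] := gl2_eval (cc 0%N) (cc 1%N) (cc 2%N) (cc 3%N) (- E l (cc 0%N) * cstC M (3^-1))
    (- E l (cc 1%N)) (- E l (cc 2%N)) (- E l (cc 3%N) * cstC M (3^-1)) y.
have [v vE] : exists v : 'I_2 -> C, forall l y, v l y = i y * gl2_s (cc 0%N y) (cc 1%N y) (cc 2%N y) (cc 3%N y)
    (- E l (cc 0%N) y / 3) (- E l (cc 1%N) y) (- E l (cc 2%N) y) (- E l (cc 3%N) y / 3).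
  exists (fun l => i * gl2_s (cc 0%N) (cc 1%N) (cc 2%N) (cc 3%N) (- E l (cc 0%N) * cstC M (3^-1))
    (- E l (cc 1%N)) (- E l (cc 2%N)) (- E l (cc 3%N) * cstC M (3^-1))) => l y.
  by rewrite CinfME; have [_ _ _ ->] := gl2_eval (cc 0%N) (cc 1%N) (cc 2%N) (cc 3%N) (- E l (cc 0%N) * cstC M (3^-1))
    (- E l (cc 1%N)) (- E l (cc 2%N)) (- E l (cc 3%N) * cstC M (3^-1)) y.
have [G GE] : exists G : 'I_2 -> 'I_2 -> 'I_2 -> C, forall y k j l,
    G k j l y = christoffel (p^~ y) (q^~ y) (r^~ y) (v^~ y) k j l.
  by exists (christoffel p q r v) => y k j l; exact: christoffel_eval.
have [w wE] : exists w : 'I_2 -> C, forall y l, w l y = chern_form (p^~ y) (q^~ y) (r^~ y) (v^~ y) l.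
  by exists (chern_form p q r v) => y l; exact: chern_form_eval.
(* The tensor that moves the Christoffel symbols of [N0] to the prescribed [G]. *)
pose S k X Y : C := \sum_j \sum_l (G k j l - N0 (E j) (E l) (u k)) * (X (u j) * Y (u l)).
pose T X Y := S 0 X Y *: E 0 + S 1 X Y *: E 1.
have S1 k f X Y Z : S k (f *: X + Y) Z = f * S k X Z + S k Y Z.
  by rewrite /S !sum2 !(vfield_addE, vfield_scaleE); ring.
have S2 k X Y Z : S k X (Y + Z) = S k X Y + S k X Z.
  by rewrite /S !sum2 !(vfield_addE, vfield_scaleE); ring.
have S3 k f X Y : S k X (f *: Y) = f * S k X Y.
  by rewrite /S !sum2 !(vfield_addE, vfield_scaleE); ring.
have N1 f X Y Z : N0 (f *: X + Y) Z + T (f *: X + Y) Z = f *: (N0 X Z + T X Z) + (N0 Y Z + T Y Z).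
  apply: vfieldP => g; rewrite nabla_vfield /T !S1 !(vfield_addE, vfield_scaleE); ring.
have N2 X Y Z : N0 X (Y + Z) + T X (Y + Z) = (N0 X Y + T X Y) + (N0 X Z + T X Z).
  apply: vfieldP => g; rewrite nablaD /T !S2 !(vfield_addE, vfield_scaleE); ring.
have N3 X f Y : N0 X (f *: Y) + T X (f *: Y) = X f *: Y + f *: (N0 X Y + T X Y).
  apply: vfieldP => g; rewrite nabla_leibniz /T !S3 !(vfield_addE, vfield_scaleE); ring.
pose N := @MkConnection _ _ vfield (fun X Y => N0 X Y + T X Y) N1 N2 N3.
pose om X := X (u 0) * w 0 + X (u 1) * w 1.
have omL f X Y : om (f *: X + Y) = f * om X + om Y.
  by rewrite /om !(vfield_addE, vfield_scaleE); ring.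
exists N, om, Q; split=> // y Qy; have Wy := QW _ Qy.
have NE k j l : N (E j) (E l) (u k) y = G k j l y.
  have dE (a b : 'I_2) : E a (u b) y = (a == b)%:R by exact: (frame_delta fW Wy).
  rewrite [N _ _]/(N0 (E j) (E l) + T (E j) (E l)) /T !(vfield_addE, vfield_scaleE) /S !sum2 !CinfE !dE.
  by case: (ord2E k) => ->; case: (ord2E j) => ->; case: (ord2E l) => -> /=; ring.
have formE l : om (E l) y = w l y.
  have dE (a b : 'I_2) : E a (u b) y = (a == b)%:R by exact: (frame_delta fW Wy).
  rewrite /om !CinfE !dE.
  by case: (ord2E l) => -> /=; ring.
split.
  apply/(torsion_frame oW fW Wy) => k j l; rewrite !NE (GE y k j) (GE y k l); exact: christoffel_sym.
apply/(chern_eq_frame oW fW Wy); first by move=> f X Y; rewrite omL !CinfE.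
move=> l; have sol l' : gl2_action (cubic_coef s u y 0) (cubic_coef s u y 1) (cubic_coef s u y 2) (cubic_coef s u y 3)
    (- E l' (cc 0%N) y / 3) (- E l' (cc 1%N) y) (- E l' (cc 2%N) y) (- E l' (cc 3%N) y / 3)
    (p l' y) (q l' y) (r l' y) (v l' y).
  have := gl2_solution (- E l' (cc 0%N) y / 3) (- E l' (cc 1%N) y) (- E l' (cc 2%N) y) (- E l' (cc 3%N) y / 3) (regular_discr (co y Wy)).
  rewrite -dlE -iE // /=; have [<- <- <- <-] := ccE y.
  by rewrite pE qE rE vE.
have := @chern_system_solution R (cubic_coef s u y) (fun l m => E l (cc m) y) _ _ _ _ sol l.
by rewrite /chern_system !formE !NE !GE !wE.
Qed.

(** Local solutions agree where they overlap, by [chern_unique_at], so the values at x of the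
    solution around x form a connection and a form; their algebraic laws hold point by point. *)
Lemma chern_exists : exists N, is_chern s N.
Proof.
have [Nx H1] := choice chern_local; have [omx H2] := choice H1; have [Q H] := choice H2.
have oQ x : open (Q x) by case: (H x).
have Qx x : Q x x by case: (H x).
have omL x f X Y : omx x (f *: X + Y) = f * omx x X + omx x Y by case: (H x) => _ _ ->.
have ch x y : Q x y -> torsion_free_at (Nx x) y /\ chern_eq_at s (Nx x) (fun X => omx x X y) y.
  by case: (H x) => _ _ _; apply.
have omL' x (y : M) f X Y : omx x (f *: X + Y) y = f y * omx x X y + omx x Y y by rewrite omL.
have uniq x y : Q x y -> (forall X Y f, Nx y X Y f y = Nx x X Y f y) /\ forall X, omx y X y = omx x X y.
  move=> Qy; have [t1 c1] := ch _ _ Qy; have [t2 c2] := ch _ _ (Qx y).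
  exact: chern_unique_at t2 t1 c2 c1.
have glN X Y f : exists g : C, forall x, g x = Nx x X Y f x.
  apply: (glueC (F := fun x => Nx x X Y f)) => x; apply: filterS (open_near (oQ x) (Qx x)) => y /uniq [+ _].
  exact.
have [N' HN'] := choice (fun t : vfield * vfield * C => glN t.1.1 t.1.2 t.2).
pose D X Y f := N' (X, Y, f).
have DE X Y f x : D X Y f x = Nx x X Y f x by exact: (HN' (X, Y, f)).
have DD X Y f g : D X Y (f + g) = D X Y f + D X Y g.
  by apply: CinfP => x; rewrite CinfDE !DE vfieldD.
have DM X Y f g : D X Y (f * g) = D X Y f * g + f * D X Y g.
  by apply: CinfP => x; rewrite CinfDE !CinfME !DE vfieldM.
have DZ X Y r f : D X Y (cstC M r * f) = cstC M r * D X Y f.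
  by apply: CinfP => x; rewrite CinfME !DE vfieldZ.
pose NN X Y := MkVfield (DD X Y) (DZ X Y) (DM X Y).
have NE X Y f x : NN X Y f x = Nx x X Y f x by exact: DE.
have N1 f X Y Z : NN (f *: X + Y) Z = f *: NN X Z + NN Y Z.
  by apply: vfieldP => g; apply: CinfP => x; rewrite vfield_addE vfield_scaleE CinfDE CinfME !NE nabla_vfield.
have N2 X Y Z : NN X (Y + Z) = NN X Y + NN X Z.
  by apply: vfieldP => g; apply: CinfP => x; rewrite vfield_addE CinfDE !NE nablaD.
have N3 X f Y : NN X (f *: Y) = X f *: Y + f *: NN X Y.
  by apply: vfieldP => g; apply: CinfP => x; rewrite vfield_addE !vfield_scaleE CinfDE !CinfME !NE nabla_leibniz.
pose N := MkConnection N1 N2 N3.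
have NNE X Y f x : N X Y f x = Nx x X Y f x by exact: NE.
have glom X : exists g : C, forall x, g x = omx x X x.
  apply: (glueC (F := fun x => omx x X)) => x; apply: filterS (open_near (oQ x) (Qx x)) => y /uniq [_ +].
  exact.
have [om' Hom'] := choice glom.
have [om Hom] : exists om : oneform, forall X, om X = om' X.
  apply: mk_oneform => f X Y; apply: CinfP => x.
  by rewrite CinfDE CinfME !Hom' omL'.
exists N; split.
  move=> X Y; apply: vfieldP => f; apply: CinfP => x.
  have [t _] := ch x x (Qx x); rewrite -t.
  by rewrite -!scaleN1r !(vfield_addE, vfield_scaleE) !CinfE !NNE.
exists om => X al; apply: CinfP => x; rewrite (tri_eta al) CinfME Hom Hom'.
have [_ c] := ch x x (Qx x); rewrite -[symvec_fun _ _ _]/(s3 s (al o30) (al o31) (al o32) x) -c.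
have [W [_ [u [E [oW Wx fW _]]]]] := frame_ex x.
(* [glN] compares the connections at x only; a form applied to a field depends at x only on the
   value of the field there. *)
have covE a Y : cov1 N X a Y x = cov1 (Nx x) X a Y x.
  rewrite !cov1E !CinfE; congr (_ - _).
  by rewrite (oneform_frame oW fW Wx a (N X Y)) (oneform_frame oW fW Wx a (Nx x X Y)) !NNE.
by rewrite !cov_tri !CinfE !(s3_expand oW fW Wx) !covE.
Qed.

End ChernExistence.

(** * Quantization and symbols *)

Section Quantization.
Variables (R : realType) (M : oriented_surface R) (xi : line_bundle M).
Local Notation C := (Cinf M).
Local Notation vfield := (vfield M).
Local Notation oneform := (oneform M).
Local Notation Gamma := (lbsection xi).
Implicit Types (X Y Z : vfield) (a b c : oneform) (s : Gamma) (f k l : C).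

Lemma nabla_cst (D : connection Gamma) X r s : D X (cstC M r *: s) = cstC M r *: D X s.
Proof. by rewrite nabla_leibniz vfield_cst scale0r add0r. Qed.

Lemma nabla_add (D : connection Gamma) X Y s : D (X + Y) s = D X s + D Y s.
Proof. by have := nabla_vfield D 1 X Y s; rewrite !scale1r. Qed.

Lemma nabla_zero (D : connection Gamma) s : D 0 s = 0.
Proof. by apply: (addrI (D 0 s)); rewrite -nabla_add !addr0. Qed.

Lemma nabla_scale (D : connection Gamma) f X s : D (f *: X) s = f *: D X s.
Proof. by rewrite -[f *: X]addr0 nabla_vfield nabla_zero addr0. Qed.

Section Iterated.
Variables (N : connection vfield) (D : connection Gamma).

(** [hess] and [grad3] are covariant derivatives, [sym2] and [sym3] their symmetrizations: the
    explicit forms of [symd_iter] in degrees 2 and 3, with the weights 1/2 and 1/3 of [symd]. *)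
Definition hess X Y s : Gamma := D X (D Y s) - D (N X Y) s.
Definition sym2 X Y s : Gamma := cstC M (2%:R^-1) *: (hess X Y s + hess Y X s).
Definition grad3 X Y Z s : Gamma :=
  D X (sym2 Y Z s) - sym2 (N X Y) Z s - sym2 Y (N X Z) s.
Definition sym3 X Y Z s : Gamma :=
  cstC M (3%:R^-1) *: (grad3 X Y Z s + grad3 Y X Z s + grad3 Z X Y s).

Lemma symd_iter2 s (V : 'I_2 -> vfield) : symd_iter N D s V = sym2 (V 0) (V 1) s.
Proof.
rewrite [LHS]/= /symd sum2 /sym2 /hess /covd !big_ord1.
have l0 : lift 0 ord0 = 1 :> 'I_2 by exact: val_inj.
have l1 : lift 1 ord0 = 0 :> 'I_2 by exact: val_inj.
have c1 : cstC M 1^-1 = 1 by apply: CinfP => y; rewrite cstCE invr1.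
by rewrite !big_ord0 !subr0 c1 !scale1r /= l0 l1.
Qed.

Lemma symd_iter3 s (V : 'I_3 -> vfield) :
  symd_iter N D s V = sym3 (V o30) (V o31) (V o32) s.
Proof.
have covE X (V' : 'I_2 -> vfield) : covd N D X (symd_iter N D s (k := 2)) V' = grad3 X (V' 0) (V' 1) s.
  by rewrite /covd sum2 !symd_iter2 /grad3 /= opprD addrA.
rewrite -[LHS]/(symd N D (symd_iter N D s (k := 2)) V) /symd sum3 !covE /sym3.
have l00 : lift o30 0 = o31 :> 'I_3 by exact: val_inj.
have l01 : lift o30 1 = o32 :> 'I_3 by exact: val_inj.
have l10 : lift o31 0 = o30 :> 'I_3 by exact: val_inj.
have l11 : lift o31 1 = o32 :> 'I_3 by exact: val_inj.
have l20 : lift o32 0 = o30 :> 'I_3 by exact: val_inj.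
have l21 : lift o32 1 = o31 :> 'I_3 by exact: val_inj.
by rewrite l00 l01 l10 l11 l20 l21.
Qed.

Lemma hess_lin1 f X Y Z s : hess (f *: X + Y) Z s = f *: hess X Z s + hess Y Z s.
Proof.
rewrite /hess !nabla_vfield; apply: sv_ext => z.
by rewrite !(svD, svN, svZ); ring.
Qed.

Lemma hess_lin2 f X Y Z s : hess Z (f *: X + Y) s = f *: hess Z X s + hess Z Y s.
Proof.
rewrite /hess nabla_vfield !nablaD !nabla_leibniz !nabla_add !nabla_scale.
by apply: sv_ext => z; rewrite !(svD, svN, svZ); ring.
Qed.

Lemma sym2_sym X Y s : sym2 X Y s = sym2 Y X s.
Proof. by rewrite /sym2 addrC. Qed.

Lemma sym2_lin f X Y Z s : sym2 (f *: X + Y) Z s = f *: sym2 X Z s + sym2 Y Z s.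
Proof.
rewrite /sym2 hess_lin1 hess_lin2; apply: sv_ext => z.
by rewrite !(svD, svN, svZ); ring.
Qed.

Lemma sym2_add X Y Z s : sym2 (X + Y) Z s = sym2 X Z s + sym2 Y Z s.
Proof. by have := sym2_lin 1 X Y Z s; rewrite !scale1r. Qed.

Lemma sym2_scale f X Z s : sym2 (f *: X) Z s = f *: sym2 X Z s.
Proof.
have z0 : sym2 0 Z s = 0 by apply: (addrI (sym2 0 Z s)); rewrite -sym2_add !addr0.
by rewrite -[f *: X]addr0 sym2_lin z0 addr0.
Qed.

Lemma grad3_lin1 f X Y Z V s : grad3 (f *: X + Y) Z V s = f *: grad3 X Z V s + grad3 Y Z V s.
Proof.
rewrite /grad3 !nabla_vfield sym2_lin !(sym2_sym Z) sym2_lin.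
by apply: sv_ext => z; rewrite !(svD, svN, svZ); ring.
Qed.

Lemma grad3_sym X Y Z s : grad3 X Y Z s = grad3 X Z Y s.
Proof.
by rewrite /grad3 (sym2_sym Y Z) (sym2_sym (N X Y)) (sym2_sym Y (N X Z)) addrAC.
Qed.

Lemma grad3_lin2 f X Y Z V s : grad3 V (f *: X + Y) Z s = f *: grad3 V X Z s + grad3 V Y Z s.
Proof.
rewrite /grad3 sym2_lin !nablaD !nabla_leibniz !sym2_add !sym2_scale.
by apply: sv_ext => z; rewrite !(svD, svN, svZ); ring.
Qed.

Lemma sym3_lin f X Y Z V s : sym3 (f *: X + Y) Z V s = f *: sym3 X Z V s + sym3 Y Z V s.
Proof.
rewrite /sym3 grad3_lin1 !grad3_lin2.
by apply: sv_ext => z; rewrite !(svD, svN, svZ); ring.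
Qed.

Lemma sym3_sym01 X Y Z s : sym3 X Y Z s = sym3 Y X Z s.
Proof. by rewrite /sym3 [grad3 X Y Z s + _]addrC (grad3_sym Z). Qed.

Lemma sym3_sym12 X Y Z s : sym3 X Y Z s = sym3 X Z Y s.
Proof. by rewrite /sym3 (grad3_sym X) addrAC. Qed.

Lemma sym3_lin2 f X Y Z V s : sym3 Z (f *: X + Y) V s = f *: sym3 Z X V s + sym3 Z Y V s.
Proof. by rewrite sym3_sym01 sym3_lin !(sym3_sym01 Z). Qed.

Lemma sym3_lin3 f X Y Z V s : sym3 Z V (f *: X + Y) s = f *: sym3 Z V X s + sym3 Z V Y s.
Proof. by rewrite sym3_sym12 sym3_lin2 !(sym3_sym12 Z V). Qed.

End Iterated.

Section Leibniz.
Variables (N : connection vfield).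

Definition dd1 X Y f : C := X (Y f) - N X Y f.
Definition dd2 X Y f : C := cstC M (2%:R^-1) * (dd1 X Y f + dd1 Y X f).

(** The coefficient of order zero in the double commutator of [grad3] with f and k. It depends on
    the affine connection but not on the connection in xi. *)
Definition cc3 X Y Z f k : C :=
  X (Y f * Z k + Z f * Y k) + X k * dd2 Y Z f + X f * dd2 Y Z k
  - (N X Y f * Z k + Z f * N X Y k) - (Y f * N X Z k + N X Z f * Y k).

Definition cc33 X Y Z f k : C :=
  cstC M (3%:R^-1) * (cc3 X Y Z f k + cc3 Y X Z f k + cc3 Z X Y f k).

Variable (D : connection Gamma).

Lemma hess_mul X Y f s : hess N D X Y (f *: s) =
  f *: hess N D X Y s + (X f *: D Y s + Y f *: D X s + dd1 X Y f *: s).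
Proof.
rewrite /hess /dd1 !nabla_leibniz nablaD !nabla_leibniz.
by apply: sv_ext => z; rewrite !(svD, svN, svZ) !CinfE; ring.
Qed.

Lemma sym2_mul X Y f s : sym2 N D X Y (f *: s) =
  f *: sym2 N D X Y s + (X f *: D Y s + Y f *: D X s + dd2 X Y f *: s).
Proof.
rewrite /sym2 !hess_mul /dd2; apply: sv_ext => z.
rewrite !(svD, svN, svZ) !CinfE.
by field.
Qed.

Definition grad3_comm X Y Z f s : Gamma :=
  X f *: sym2 N D Y Z s + D X (Y f *: D Z s + Z f *: D Y s + dd2 Y Z f *: s)
  - (N X Y f *: D Z s + Z f *: D (N X Y) s + dd2 (N X Y) Z f *: s)
  - (Y f *: D (N X Z) s + N X Z f *: D Y s + dd2 Y (N X Z) f *: s).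

Lemma grad3_mul X Y Z f s : grad3 N D X Y Z (f *: s) =
  f *: grad3 N D X Y Z s + grad3_comm X Y Z f s.
Proof.
rewrite /grad3 !sym2_mul nablaD nabla_leibniz /grad3_comm; apply: sv_ext => z.
by rewrite !(svD, svN, svZ); ring.
Qed.

Lemma grad3_comm_mul X Y Z f k s : grad3_comm X Y Z f (k *: s) =
  k *: grad3_comm X Y Z f s +
  ((Y f * Z k + Z f * Y k) *: D X s + (X f * Y k + Y f * X k) *: D Z s
   + (X f * Z k + Z f * X k) *: D Y s + cc3 X Y Z f k *: s).
Proof.
rewrite /grad3_comm sym2_mul !nablaD !nabla_leibniz !nablaD !nabla_leibniz /cc3 vfieldD !vfieldM.
by apply: sv_ext => z; rewrite !(svD, svN, svZ) !CinfE; ring.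
Qed.

Definition sym3_comm X Y Z f s : Gamma :=
  cstC M (3%:R^-1) *: (grad3_comm X Y Z f s + grad3_comm Y X Z f s + grad3_comm Z X Y f s).

Lemma sym3_mul X Y Z f s : sym3 N D X Y Z (f *: s) =
  f *: sym3 N D X Y Z s + sym3_comm X Y Z f s.
Proof.
rewrite /sym3 !grad3_mul /sym3_comm; apply: sv_ext => z.
by rewrite !(svD, svN, svZ); ring.
Qed.

(** The double commutator of [sym3] with f and k has order one: f and k each use up a derivative,
    the third falls on s. This is the only place where [D] remains. *)
Lemma sym3_comm_mul X Y Z f k s : sym3_comm X Y Z f (k *: s) =
  k *: sym3_comm X Y Z f s +
  ((Y f * Z k + Z f * Y k) *: D X s + (X f * Y k + Y f * X k) *: D Z s
   + (X f * Z k + Z f * X k) *: D Y s + cc33 X Y Z f k *: s).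
Proof.
rewrite /sym3_comm !grad3_comm_mul /cc33.
move: (cc3 X Y Z f k) (cc3 Y X Z f k) (cc3 Z X Y f k) => c1 c2 c3.
move: (grad3_comm X Y Z f s) (grad3_comm Y X Z f s) (grad3_comm Z X Y f s) => g1 g2 g3.
move: (D X s) (D Y s) (D Z s) (X f) (Y f) (Z f) (X k) (Y k) (Z k) => u1 u2 u3 v1 v2 v3 w1 w2 w3.
apply: sv_ext => z; rewrite !(svD, svZ) !CinfE.
by field.
Qed.

End Leibniz.
End Quantization.

Lemma sum_ffun3 (V : nmodType) (G : 'I_2 -> 'I_2 -> 'I_2 -> V) :
  \sum_(I : {ffun 'I_3 -> 'I_2}) G (I o30) (I o31) (I o32) =
  \sum_i \sum_j \sum_k G i j k.
Proof.
rewrite pair_big pair_big /=.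
pose h (t : 'I_2 * 'I_2 * 'I_2) : {ffun 'I_3 -> 'I_2} := [ffun i => tri t.1.1 t.1.2 t.2 i].
rewrite (reindex h) /=; first by apply: eq_bigr => t _; rewrite /h !ffunE.
exists (fun I : {ffun 'I_3 -> 'I_2} => (I o30, I o31, I o32)) => [[[i j] k] _|I _].
  by rewrite /h !ffunE.
by apply/ffunP; apply: ord3P; rewrite ffunE.
Qed.

Lemma codom2 (T : Type) (f : 'I_2 -> T) : codom f = [:: f 0; f 1].
Proof.
rewrite codomE /= enum_ordSl enum_ordSl /=.
by rewrite (_ : enum 'I_0 = [::]) /=; [congr [:: _; f _]; exact: val_inj|apply/size0nil; rewrite size_enum_ord].
Qed.

Lemma codom3 (T : Type) (f : 'I_3 -> T) : codom f = [:: f o30; f o31; f o32].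
Proof.
rewrite codomE /= !enum_ordSl /=.
rewrite (_ : enum 'I_0 = [::]) /=; last by apply/size0nil; rewrite size_enum_ord.
by congr [:: f _; f _; f _]; exact: val_inj.
Qed.

(** * Existence and double commutators of the quantization *)

Section QuantizationExists.
Variables (R : realType) (M : oriented_surface R) (xi : line_bundle M).
Local Notation C := (Cinf M).
Local Notation vfield := (vfield M).
Local Notation oneform := (oneform M).
Local Notation Gamma := (lbsection xi).
Implicit Types (X Y Z : vfield) (a b c : oneform) (s : Gamma) (f : C).
Variables (N : connection vfield) (D : connection Gamma) (sigma : symvec M 3).

Section Frame.
Variables (W : set M) (u : 'I_2 -> C) (F : 'I_2 -> vfield).
Hypotheses (oW : open W) (fW : frame_on W u F).
Variables (y : M) (Wy : W y).
Local Notation d i := (differential (u i)).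

(** A trace does not depend on the dual bases: the matrix of the forms [eps] on the frame and that
    of the fields [E] in the coordinates are inverse to each other. *)
Lemma dual_trace (E : 'I_2 -> vfield) (eps : 'I_2 -> oneform) (B : oneform -> vfield -> R) :
  (forall i j, eps i (E j) y = (i == j)%:R) ->
  (forall f a b X, B (lc f a b) X = f y * B a X + B b X) ->
  (forall f X Y a, B a (f *: X + Y) = f y * B a X + B a Y) ->
  \sum_i B (eps i) (E i) = \sum_i B (d i) (F i).
Proof.
move=> dual B1 B2.
pose A : 'M[R]_2 := \matrix_(i, k) eps i (F k) y.
pose P : 'M[R]_2 := \matrix_(k, j) E j (u k) y.
have AP : A *m P = 1%:M.
  apply/matrixP => i j; rewrite !mxE sum2 !mxE -dual (oneform_frame oW fW Wy (eps i) (E j)); ring.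
(* Duality gives one product of the two matrices; the sum to be simplified contains the other one,
   which is the identity because the matrices are square. *)
have PA (l k : 'I_2) : E 0 (u l) y * eps 0 (F k) y + E 1 (u l) y * eps 1 (F k) y = (l == k)%:R.
  by have /matrixP /(_ l k) := mulmx1C AP; rewrite !mxE sum2 !mxE.
have BE i : B (eps i) (E i) = eps i (F 0) y * (E i (u 0) y * B (d 0) (F 0) + E i (u 1) y * B (d 0) (F 1))
    + eps i (F 1) y * (E i (u 0) y * B (d 1) (F 0) + E i (u 1) y * B (d 1) (F 1)).
  rewrite (oneform_expand oW fW Wy (psi := fun a => B a (E i))); last by move=> f a b; exact: B1.
  by congr (_ * _ + _ * _); apply: (vfield_expand oW fW Wy (psi := fun X => B _ X)) => f X Y; exact: B2.
rewrite !sum2 !BE.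
transitivity (\sum_k \sum_l (E 0 (u l) y * eps 0 (F k) y + E 1 (u l) y * eps 1 (F k) y) * B (d k) (F l)).
  rewrite !sum2; ring.
by rewrite !sum2 !PA /= !mul1r !mul0r addr0 add0r.
Qed.

Definition qsum (E : 'I_2 -> vfield) (eps : 'I_2 -> oneform) s : R :=
  \sum_i \sum_j \sum_k s3 sigma (eps i) (eps j) (eps k) y * sval_at y (sym3 N D (E i) (E j) (E k) s).

(** [dual_trace] is applied to one of the three contracted slots at a time. *)
Lemma qsum_indep (E : 'I_2 -> vfield) (eps : 'I_2 -> oneform) s :
  (forall i j, eps i (E j) y = (i == j)%:R) ->
  qsum E eps s = qsum F (fun i => d i) s.
Proof.
move=> dual; rewrite /qsum.
transitivity (\sum_i \sum_j \sum_k s3 sigma (eps i) (eps j) (d k) y * sval_at y (sym3 N D (E i) (E j) (F k) s)).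
  apply: eq_bigr => i _; apply: eq_bigr => j _.
  apply: (@dual_trace E eps (fun a X => s3 sigma (eps i) (eps j) a y * sval_at y (sym3 N D (E i) (E j) X s)) dual).
    by move=> f a b X; rewrite s3_lin3 CinfDE CinfME; ring.
  by move=> f X Y a; rewrite sym3_lin3 svD svZ; ring.
transitivity (\sum_i \sum_j \sum_k s3 sigma (eps i) (d j) (d k) y * sval_at y (sym3 N D (E i) (F j) (F k) s)).
  apply: eq_bigr => i _.
  apply: (@dual_trace E eps (fun a X => \sum_k s3 sigma (eps i) a (d k) y * sval_at y (sym3 N D (E i) X (F k) s)) dual).
    by move=> f a b X; rewrite !sum2 !s3_lin2 !CinfDE !CinfME; ring.
  by move=> f X Y a; rewrite !sum2 !sym3_lin2 !svD !svZ; ring.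
apply: (@dual_trace E eps (fun a X => \sum_j \sum_k s3 sigma a (d j) (d k) y * sval_at y (sym3 N D X (F j) (F k) s)) dual).
  by move=> f a b X; rewrite !sum2 !s3_lin !CinfDE !CinfME; ring.
by move=> f X Y a; rewrite !sum2 !sym3_lin !svD !svZ; ring.
Qed.

Lemma s3_frame (i j k : 'I_2) :
  s3 sigma (d i) (d j) (d k) y = cubic_coef sigma u y (i + j + k).
Proof.
have [c0 c1 c2 c3] := cubic_coefE sigma u y.
case: (ord2E i) => ->; case: (ord2E j) => ->; case: (ord2E k) => -> /=.
- by rewrite c0.
- by rewrite s3_sym12 s3_sym01 c1.
- by rewrite s3_sym01 c1.
- by rewrite s3_sym01 s3_sym12 c2.
- by rewrite c1.
- by rewrite s3_sym12 c2.
- by rewrite c2.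
- by rewrite c3.
Qed.

End Frame.

Lemma fact3 : 3`!%:R = 6 :> R. Proof. by []. Qed.

Lemma is_pairingE s t : is_pairing sigma (@symd_iter _ _ N _ D s 3) t <->
  forall y (E : 'I_2 -> vfield) (eps : 'I_2 -> oneform),
    (forall i j, eps i (E j) y = (i == j)%:R) -> sval_at y t = 6 * qsum y E eps s.
Proof.
have key y E eps : fcoord (\sum_(I : {ffun 'I_3 -> 'I_2}) (3`!%:R * sigma (eps \o I) y) *:
    @symd_iter _ _ N _ D s 3 (E \o I) y) = 6 * qsum y E eps s.
  rewrite /qsum -(sum_ffun3 (fun i j k => s3 sigma (eps i) (eps j) (eps k) y * sval_at y (sym3 N D (E i) (E j) (E k) s))).
  have fs (r : seq {ffun 'I_3 -> 'I_2}) (G : {ffun 'I_3 -> 'I_2} -> xi y) :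
      fcoord (\sum_(I <- r) G I) = \sum_(I <- r) fcoord (G I).
    elim: r => [|I r IH]; last by rewrite !big_cons fcoordD IH.
    by rewrite !big_nil; apply/eqP; rewrite fcoord_eq0.
  rewrite fs mulr_sumr; apply: eq_bigr => I _.
  by rewrite fcoordZ fact3 symd_iter3 mulrA (tri_eta (eps \o I)).
split=> H y E eps dual; first by rewrite /sval_at (H y E eps dual) key.
by apply: fcoord_inj; rewrite key; exact: H.
Qed.

(** The contraction is written in a frame around each point and glued; independence of the dual
    bases gives the agreement. *)
Lemma quantization_exists : exists Q, is_quantization N D sigma Q.
Proof.
have [W H1] := choice (@frame_ex R M); have [c H2] := choice H1.
have [u H3] := choice H2; have [F H] := choice H3.
have oW x : open (W x) by case: (H x).
have Wx x : W x x by case: (H x).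
have fW x : frame_on (W x) (u x) (F x) by case: (H x).
pose e x i := differential (u x i).
have de x y : W x y -> forall i j, e x i (F x j) y = (i == j)%:R.
  by move=> Wy i j; rewrite /e differentialE (frame_delta (fW x) Wy) eq_sym.
have ex s : exists t, is_pairing sigma (@symd_iter _ _ N _ D s 3) t.
  pose tx x : Gamma := \sum_i \sum_j \sum_k (cstC M 6 * s3 sigma (e x i) (e x j) (e x k)) *: sym3 N D (F x i) (F x j) (F x k) s.
  have txE x y : sval_at y (tx x) = 6 * qsum y (F x) (e x) s.
    rewrite /tx /qsum !sum2 !svD !svZ !CinfE; ring.
  have [|t Ht] := @glue_section _ _ _ tx.
    move=> x; apply: filterS (open_near (oW x) (Wx x)) => y Wy; rewrite !txE; congr (_ * _).
    exact: (qsum_indep (oW x) (fW x) Wy s (de y y (Wx y))).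
  exists t; apply/is_pairingE => y E eps dual; rewrite Ht txE; congr (_ * _).
  by rewrite (qsum_indep (oW y) (fW y) (Wx y) s dual).
have [t Ht] := choice ex.
by exists (fun s => cstC M (3`!%:R^-1) *: t s) => s; exists (t s).
Qed.

Section Values.
Variables (Q : Gamma -> Gamma).
Hypothesis qQ : is_quantization N D sigma Q.

Lemma quantization_val W u F y s : open W -> frame_on W u F -> W y ->
  sval_at y (Q s) = qsum y F (fun i => differential (u i)) s.
Proof.
move=> oW fW Wy; have [t /is_pairingE Ht ->] := qQ s.
rewrite svZ cstCE fact3 (Ht y F (fun i => differential (u i))); first by rewrite mulKf.
by move=> i j; rewrite differentialE (frame_delta fW Wy) eq_sym.
Qed.

(** Each triple of frame fields contributes six first order monomials; contracted with the symmetric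
    coefficients of sigma they coincide, whence the factor 6. The term in [cc33] is free of [D]: it
    cancels in the triple commutator and under a change of [D]. *)
Lemma quantization_comm2 W u F y f k s : open W -> frame_on W u F -> W y ->
  sval_at y (commutator (commutator Q f) k s) =
  6 * cub (cubic_coef sigma u y) (F 0 f y) (F 1 f y) (F 0 k y) (F 1 k y)
    (sval_at y (D (F 0) s)) (sval_at y (D (F 1) s))
  + (\sum_(i < 2) \sum_(j < 2) \sum_(l < 2) cubic_coef sigma u y (i + j + l) * cc33 N (F i) (F j) (F l) f k y) * sval_at y s.
Proof.
move=> oW fW Wy; rewrite /commutator !(svD, svN, svZ) !(quantization_val _ oW fW Wy) /qsum.
have E i j l : sval_at y (sym3 N D (F i) (F j) (F l) (f *: (k *: s)))
    - f y * sval_at y (sym3 N D (F i) (F j) (F l) (k *: s))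
    - k y * (sval_at y (sym3 N D (F i) (F j) (F l) (f *: s)) - f y * sval_at y (sym3 N D (F i) (F j) (F l) s)) =
    (F j f y * F l k y + F l f y * F j k y) * sval_at y (D (F i) s)
    + (F i f y * F j k y + F j f y * F i k y) * sval_at y (D (F l) s)
    + (F i f y * F l k y + F l f y * F i k y) * sval_at y (D (F j) s)
    + cc33 N (F i) (F j) (F l) f k y * sval_at y s.
  rewrite !sym3_mul sym3_comm_mul; move: (sym3 _ _ _ _ _ _) (sym3_comm _ _ _ _ _ _ _) (cc33 _ _ _ _ _ _) => v1 v2 v3.
  by rewrite !(svD, svZ) !CinfE; ring.
transitivity (\sum_(i < 2) \sum_(j < 2) \sum_(l < 2) cubic_coef sigma u y (i + j + l) *
  (sval_at y (sym3 N D (F i) (F j) (F l) (f *: (k *: s)))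
    - f y * sval_at y (sym3 N D (F i) (F j) (F l) (k *: s))
    - k y * (sval_at y (sym3 N D (F i) (F j) (F l) (f *: s)) - f y * sval_at y (sym3 N D (F i) (F j) (F l) s)))).
  rewrite !mulrBr !mulr_sumr -!sumrB; apply: eq_bigr => i _; rewrite !mulr_sumr -!sumrB; apply: eq_bigr => j _.
  rewrite !mulr_sumr -!sumrB; apply: eq_bigr => l _; rewrite !(s3_frame); ring.
under eq_bigr do under eq_bigr do under eq_bigr do rewrite E.
rewrite !sum2 /= /cub; ring.
Qed.

End Values.
End QuantizationExists.

(** * Symbols of operators of order two *)

Section Symbols.
Variables (R : realType) (M : oriented_surface R) (xi : line_bundle M).
Local Notation C := (Cinf M).
Local Notation vfield := (vfield M).
Local Notation oneform := (oneform M).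
Local Notation Gamma := (lbsection xi).
Implicit Types (X Y Z : vfield) (a b c : oneform) (s t : Gamma) (f g h : C).

Lemma nonvanishing_section (y : M) : exists s, sval_at y s != 0.
Proof. by have [Z [e [h [_ Zy e0 _]]]] := local_section xi y; exists e; exact: e0. Qed.

Lemma scale_sec_inj f g : (forall s, f *: s = g *: s) -> f = g.
Proof.
move=> H; apply: CinfP => y; have [s s0] := nonvanishing_section y.
by apply: (mulIf s0); rewrite -!svZ H.
Qed.

(** Linearity over functions makes T local, and locally every section is a multiple of one
    nonvanishing section; its image determines the factor, and the factors agree on overlaps. *)
Lemma Clinear_op_mul (T : Gamma -> Gamma) :
  (forall s t, T (s + t) = T s + T t) -> (forall f s, T (f *: s) = f *: T s) ->
  exists f, forall s, T s = f *: s.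
Proof.
move=> TD TZ.
have loc y s t : (\forall z \near y, sval_at z s = sval_at z t) ->
    sval_at y (T s) = sval_at y (T t).
  move=> /sv_near_ext [b [b1 E]]; have := congr1 (fun r => sval_at y (T r)) E.
  by rewrite !TZ !svZ b1 !mul1r.
have [Z HZ] := choice (@local_section R M xi).
have [e He] := choice HZ; have [h H] := choice He.
have oZ x : open (Z x) by case: (H x).
have Zx x : Z x x by case: (H x).
have e0 x y : Z x y -> sval_at y (e x) != 0 by case: (H x) => _ _ + _; apply.
have hE x y s : Z x y -> sval_at y s = h x s y * sval_at y (e x) by case: (H x) => _ _ _; apply.
have TE x y s : Z x y -> sval_at y (T s) = h x (T (e x)) y * sval_at y s.
  move=> Zy; rewrite (loc y s (h x s *: e x)).
    by rewrite TZ svZ (hE x y (T (e x)) Zy) (hE x y s Zy); ring.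
  by apply: filterS (open_near (oZ x) Zy) => z Zz; rewrite svZ (hE x z s Zz).
have [|f Hf] := @glueC _ M (fun x => h x (T (e x))).
  move=> x; apply: filterS (open_near (oZ x) (Zx x)) => y Zy.
  by apply: (mulIf (e0 x y Zy)); rewrite -(TE x y _ Zy) -(TE y y _ (Zx y)).
exists f => s; apply: sv_ext => y.
by rewrite svZ Hf (TE y y).
Qed.

Lemma commutator_sub (A B : Gamma -> Gamma) f :
  commutator (fun s => A s - B s) f = fun s => commutator A f s - commutator B f s.
Proof.
apply/funext => s; rewrite /commutator scalerBr opprB.
by apply: sv_ext => z; rewrite !(svD, svN, svZ); ring.
Qed.

Section Quantization.
Variables (N : connection vfield) (D : connection Gamma) (sigma : symvec M 3).
Variables (Q : Gamma -> Gamma).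
Hypothesis qQ : is_quantization N D sigma Q.

Lemma sym3_linear X Y Z (r : R) s t :
  sym3 N D X Y Z (cstC M r *: s + t) = cstC M r *: sym3 N D X Y Z s + sym3 N D X Y Z t.
Proof.
have hl X' Y' : hess N D X' Y' (cstC M r *: s + t) = cstC M r *: hess N D X' Y' s + hess N D X' Y' t.
  rewrite /hess !nablaD !nabla_cst.
  by apply: sv_ext => z; rewrite !(svD, svN, svZ); ring.
have sl X' Y' : sym2 N D X' Y' (cstC M r *: s + t) = cstC M r *: sym2 N D X' Y' s + sym2 N D X' Y' t.
  by rewrite /sym2 !hl; apply: sv_ext => z; rewrite !(svD, svN, svZ); ring.
have gl X' Y' Z' : grad3 N D X' Y' Z' (cstC M r *: s + t) = cstC M r *: grad3 N D X' Y' Z' s + grad3 N D X' Y' Z' t.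
  rewrite /grad3 !sl !nablaD !nabla_cst.
  by apply: sv_ext => z; rewrite !(svD, svN, svZ); ring.
by rewrite /sym3 !gl; apply: sv_ext => z; rewrite !(svD, svN, svZ); ring.
Qed.

Lemma quantization_linear (r : R) s t : Q (cstC M r *: s + t) = cstC M r *: Q s + Q t.
Proof.
apply: sv_ext => y; have [W [c [u [F [oW Wy fW _]]]]] := frame_ex y.
rewrite svD svZ cstCE !(quantization_val qQ _ oW fW Wy) /qsum !mulr_sumr -big_split.
apply: eq_bigr => i _; rewrite mulr_sumr -big_split; apply: eq_bigr => j _.
rewrite mulr_sumr -big_split; apply: eq_bigr => l _ /=.
by rewrite sym3_linear svD svZ cstCE; ring.
Qed.

Lemma quantization_comm3 f g h s :
  commutator (commutator (commutator Q f) g) h s =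
  (6 * s3 sigma (differential f) (differential g) (differential h)) *: s.
Proof.
apply: sv_ext => y; have [W [c [u [F [oW Wy fW _]]]]] := frame_ex y.
rewrite [LHS](_ : _ = sval_at y (commutator (commutator Q f) g (h *: s)) - h y * sval_at y (commutator (commutator Q f) g s)); last first.
  by rewrite /commutator !(svD, svN, svZ).
rewrite !(quantization_comm2 qQ _ _ _ oW fW Wy) !nabla_leibniz !svD !svZ CinfME (s3_expand oW fW Wy).
rewrite !differentialE -[(6 : C) y]/(6 : R) /cub.
move: (\sum_(i < 2) _) => v; ring.
Qed.

End Quantization.

Section OrderTwo.
Variable B : Gamma -> Gamma.
Hypothesis dB : diffop 2 B.

Let comm2 f g s := commutator (commutator B f) g s.

Let BD s t : B (s + t) = B s + B t.
Proof. by have [H _] := dB; have := H 1 s t; rewrite -[cstC M 1](_ : 1 = _) ?scale1r //; exact: CinfP. Qed.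

Let B0 : B 0 = 0.
Proof. by apply: (addrI (B 0)); rewrite -BD !addr0. Qed.

Let BZ (r : R) s : B (cstC M r *: s) = cstC M r *: B s.
Proof. by have [H _] := dB; have := H r s 0; rewrite B0 !addr0. Qed.

Lemma comm2E f g s : comm2 f g s = B ((f * g) *: s) - f *: B (g *: s) - g *: B (f *: s) + (f * g) *: B s.
Proof.
rewrite /comm2 /commutator scalerA; apply: sv_ext => z; rewrite !(svD, svN, svZ) CinfME; ring.
Qed.

Let comm2_mul f g h s : comm2 f g (h *: s) = h *: comm2 f g s.
Proof. by have [_ /(_ f g h s)] := dB; rewrite /= /commutator => /eqP; rewrite subr_eq0 => /eqP. Qed.

Let comm2_add f g s t : comm2 f g (s + t) = comm2 f g s + comm2 f g t.
Proof.
by rewrite !comm2E !scalerDr !BD !scalerDr; apply: sv_ext => z; rewrite !(svD, svN, svZ); ring.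
Qed.

Let comm2_sym f g s : comm2 f g s = comm2 g f s.
Proof. by rewrite !comm2E mulrC [_ - f *: _ - _]addrAC. Qed.

Let comm2_prod f g h s : comm2 f (g * h) s = h *: comm2 f g s + g *: comm2 f h s.
Proof.
rewrite -comm2_mul /comm2 /commutator -!scalerA.
by apply: sv_ext => z; rewrite !(svD, svN, svZ); ring.
Qed.

Let comm2_sum f g h s : comm2 f (g + h) s = comm2 f g s + comm2 f h s.
Proof.
rewrite !comm2E !mulrDr !scalerDl !BD !scalerDr.
by apply: sv_ext => z; rewrite !(svD, svN, svZ); ring.
Qed.

Let comm2_cst f (r : R) g s : comm2 f (cstC M r * g) s = cstC M r *: comm2 f g s.
Proof.
rewrite !comm2E mulrCA -!scalerA !BZ.
by apply: sv_ext => z; rewrite !(svD, svN, svZ); ring.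
Qed.

(** The double commutator is multiplication by S f g, where S is symmetric and a derivation in each
    argument. To extend it from differentials to arbitrary forms: V f = S f is a vector field, f |->
    a (V f) is again a derivation U a, and b (U a) is defined for all forms. The factor 1/2
    compensates the 2! of [is_symbol]. *)
Lemma symbol2_exists : exists tau : symvec M 2, is_symbol B tau.
Proof.
have [S HS] : exists S : C -> C -> C, forall f g s, comm2 f g s = S f g *: s.
  have H fg : exists p : C, forall s, comm2 fg.1 fg.2 s = p *: s.
    by apply: Clinear_op_mul => [s t|h s]; [exact: comm2_add|exact: comm2_mul].
  have [S HS] := choice H; exists (fun f g => S (f, g)) => f g s; exact: (HS (f, g)).
have Ssym f g : S f g = S g f.
  by apply: scale_sec_inj => s; rewrite -!HS; exact: comm2_sym.
have SD f g h : S f (g + h) = S f g + S f h.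
  by apply: scale_sec_inj => s; rewrite scalerDl -!HS; exact: comm2_sum.
have SM f g h : S f (g * h) = S f g * h + g * S f h.
  by apply: scale_sec_inj => s; rewrite scalerDl [S f g * h]mulrC -!scalerA -!HS; exact: comm2_prod.
have SZ f (r : R) g : S f (cstC M r * g) = cstC M r * S f g.
  by apply: scale_sec_inj => s; rewrite -!scalerA -!HS; exact: comm2_cst.
pose V f := MkVfield (SD f) (SZ f) (SM f).
have VE f g : V f g = S f g by [].
have VD f g : V (f + g) = V f + V g.
  by apply: vfieldP => h; rewrite vfield_addE !VE Ssym SD !(Ssym h).
have VM f g : V (f * g) = g *: V f + f *: V g.
  apply: vfieldP => h; rewrite vfield_addE !vfield_scaleE !VE Ssym SM !(Ssym h).
  by rewrite [S f h * g]mulrC.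
have VZ (r : R) f : V (cstC M r * f) = cstC M r *: V f.
  by apply: vfieldP => h; rewrite vfield_scaleE !VE Ssym SZ !(Ssym h).
have UD a f g : a (V (f + g)) = a (V f) + a (V g) by rewrite VD oneformD.
have UZ a (r : R) f : a (V (cstC M r * f)) = cstC M r * a (V f) by rewrite VZ oneformZ.
have UM a f g : a (V (f * g)) = a (V f) * g + f * a (V g).
  by rewrite VM oneformD !oneformZ [g * _]mulrC.
pose U a := MkVfield (UD a) (UZ a) (UM a).
have UE a f : U a f = a (V f) by [].
pose T a b : C := cstC M (2^-1) * b (U a).
have [|| tau Htau] := @mk_symvec2 R M T.
(* The construction treats a and b differently; expanded in a frame, the symmetry is that of S on
   the coordinates. *)
- move=> a b; rewrite /T; congr (_ * _); apply: CinfP => y.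
  have [W [c [u [F [oW Wy fW _]]]]] := frame_ex y.
  rewrite (oneform_frame oW fW Wy b (U a)) (oneform_frame oW fW Wy a (U b)) !UE.
  rewrite !(oneform_frame oW fW Wy _ (V _)) !VE (Ssym (u 1) (u 0)); ring.
- move=> f a a' b; rewrite /T.
  have -> : U (lc f a a') = f *: U a + U a' by apply: vfieldP => g.
  by rewrite oneform_lin; ring.
exists tau; split=> // f s; rewrite codom2 /= -/(comm2 _ _ s) HS Htau.
rewrite -[T _ _]/(cstC M (2^-1) * S (f 1) (f 0)) mulrA Ssym.
have -> : 2`!%:R * cstC M 2^-1 = 1 :> C.
  apply: CinfP => y; rewrite -[LHS]/((2 : R) * 2^-1); exact: mulfV.
by rewrite mul1r.
Qed.

Lemma symbol2E (tau : symvec M 2) f g s : is_symbol B tau ->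
  comm2 f g s = (2 * s2 tau (differential f) (differential g)) *: s.
Proof.
move=> [_ /(_ (duo f g) s)]; rewrite codom2.
rewrite -[LHS]/(comm2 f g s) => ->.
congr ((_ * symvec_fun tau _) *: s); apply/funext; exact: ord2P.
Qed.

End OrderTwo.
End Symbols.

(** * The Wagner metric *)

Section HessianCovariant.
Variable R : realType.
Implicit Types c : nat -> R.

(** Coefficients of the Hessian covariant of the cubic. [hess01] is the coefficient of the mixed
    term, hence twice the value of the bilinear form [hessian] on the two basis covectors. *)
Definition hess00 c : R := c 0%N * c 2%N - c 1%N ^+ 2.
Definition hess01 c : R := c 0%N * c 3%N - c 1%N * c 2%N.
Definition hess11 c : R := c 1%N * c 3%N - c 2%N ^+ 2.

Definition hessian c (a0 a1 b0 b1 : R) : R :=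
  a0 * b0 * hess00 c + 2^-1 * (a0 * b1 + a1 * b0) * hess01 c + a1 * b1 * hess11 c.

(** The discriminant of the cubic is minus that of its Hessian, so its weight follows from the
    weight of the Hessian. *)
Lemma discr_hess c : discr (c 0%N) (c 1%N) (c 2%N) (c 3%N) = 4 * hess00 c * hess11 c - hess01 c ^+ 2.
Proof. by rewrite /discr /hess00 /hess01 /hess11; ring. Qed.

Lemma inv_cbrt_neq0 (d : R) : d != 0 -> inv_cbrt d != 0.
Proof.
by move=> d0; rewrite /inv_cbrt mulf_neq0 ?sgr_eq0 // gt_eqF // powR_gt0 // normr_gt0.
Qed.

(** The origin of the exponent -1/3: under a change of coordinates with Jacobian k the discriminant
    gains k^6 and the Hessian k^2, and the factor k^(-2) found here restores invariance. *)
Lemma inv_cbrt_scale (k d : R) : k != 0 -> inv_cbrt (k ^+ 6 * d) = k ^- 2 * inv_cbrt d.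
Proof.
move=> k0; have k2 : 0 < k ^+ 2 by rewrite exprn_even_gt0.
have k6 : 0 < k ^+ 6 by rewrite exprn_even_gt0.
rewrite /inv_cbrt sgrM gtr0_sg // mul1r normrM gtr0_norm // powRM ?normr_ge0 ?(ltW k6) // mulrCA.
congr (_ * _); rewrite (exprM k 2 3) -powR_mulrn ?(ltW k2) // -powRrM mulrN mulfV // powR_inv1 //.
exact: ltW.
Qed.

Section Transformation.
Variables (c c' : nat -> R) (x0 x1 y0 y1 : R).
Hypotheses (e0 : c' 0%N = cub c x0 x1 x0 x1 x0 x1) (e1 : c' 1%N = cub c y0 y1 x0 x1 x0 x1)
  (e2 : c' 2%N = cub c y0 y1 y0 y1 x0 x1) (e3 : c' 3%N = cub c y0 y1 y0 y1 y0 y1).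
Let k := x0 * y1 - x1 * y0.

Lemma hess00_transf : hess00 c' = k ^+ 2 * hessian c x0 x1 x0 x1.
Proof. by rewrite /hess00 e0 e1 e2 /hessian /hess00 /hess01 /hess11 /cub /k; field. Qed.

Lemma hess01_transf : hess01 c' = 2 * (k ^+ 2 * hessian c x0 x1 y0 y1).
Proof. by rewrite /hess01 e0 e1 e2 e3 /hessian /hess00 /hess01 /hess11 /cub /k; field. Qed.

Lemma hess11_transf : hess11 c' = k ^+ 2 * hessian c y0 y1 y0 y1.
Proof. by rewrite /hess11 e1 e2 e3 /hessian /hess00 /hess01 /hess11 /cub /k; field. Qed.

Lemma discr_transf : discr (c' 0%N) (c' 1%N) (c' 2%N) (c' 3%N) =
  k ^+ 6 * discr (c 0%N) (c 1%N) (c 2%N) (c 3%N).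
Proof.
rewrite !discr_hess hess00_transf hess01_transf hess11_transf /hessian /k.
by move: (hess00 c) (hess01 c) (hess11 c) => p q r; field.
Qed.

Hypotheses (d' : discr (c' 0%N) (c' 1%N) (c' 2%N) (c' 3%N) != 0).
Let m := inv_cbrt (discr (c 0%N) (c 1%N) (c 2%N) (c 3%N)).
Let m' := inv_cbrt (discr (c' 0%N) (c' 1%N) (c' 2%N) (c' 3%N)).

Let k0 : k != 0.
Proof. by apply: contraNneq d'; rewrite discr_transf => ->; rewrite expr0n mul0r. Qed.

Let m'E : m' = k ^- 2 * m.
Proof. by rewrite /m' discr_transf inv_cbrt_scale. Qed.

Lemma wagner_transf :
  [/\ m * hessian c x0 x1 x0 x1 = m' * hess00 c',
      2 * (m * hessian c x0 x1 y0 y1) = m' * hess01 c' &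
      m * hessian c y0 y1 y0 y1 = m' * hess11 c'].
Proof.
rewrite m'E hess00_transf hess01_transf hess11_transf.
move: (hessian _ _ _ _ _) (hessian _ _ _ _ _) (hessian _ _ _ _ _) m k0 => p q r n kn.
by split; field.
Qed.

(** Bilinear extension of [wagner_transf]: on the left the covectors with components a, b in the new
    coordinates are rewritten in the old ones. *)
Lemma wagner_invariant (a0 a1 b0 b1 : R) :
  m * hessian c (x0 * a0 + y0 * a1) (x1 * a0 + y1 * a1) (x0 * b0 + y0 * b1) (x1 * b0 + y1 * b1) =
  m' * hessian c' a0 a1 b0 b1.
Proof.
have [w0 w1 w2] := wagner_transf.
transitivity (a0 * b0 * (m * hessian c x0 x1 x0 x1)
  + 2^-1 * (a0 * b1 + a1 * b0) * (2 * (m * hessian c x0 x1 y0 y1))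
  + a1 * b1 * (m * hessian c y0 y1 y0 y1)).
  by rewrite /hessian; move: (hess00 c) (hess01 c) (hess11 c) m => p q r n; field.
by rewrite w0 w1 w2 /hessian; ring.
Qed.

End Transformation.
End HessianCovariant.

Section WagnerMetric.
Variables (R : realType) (M : oriented_surface R) (s : symvec M 3).
Hypothesis reg : regular s.
Local Notation C := (Cinf M).
Local Notation vfield := (vfield M).
Local Notation oneform := (oneform M).
Implicit Types (a b : oneform).

Definition coef_discr u (y : M) : R :=
  discr (cubic_coef s u y 0) (cubic_coef s u y 1) (cubic_coef s u y 2) (cubic_coef s u y 3).

Lemma coef_discrE (u : 'I_2 -> C) : exists dl : C, forall y, dl y = coef_discr u y.
Proof.
pose cc := coef_fun u s.
exists (6 * cc 0%N * cc 1%N * cc 2%N * cc 3%N - 4 * (cc 0%N * cc 2%N ^+ 3 + cc 3%N * cc 1%N ^+ 3)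
  + 3 * cc 1%N ^+ 2 * cc 2%N ^+ 2 - cc 0%N ^+ 2 * cc 3%N ^+ 2) => y.
by rewrite /coef_discr; have [<- <- <- <-] := coef_funE u s y.
Qed.

Lemma coef_transf (W : set M) u (E : 'I_2 -> vfield) (y : M) (u' : 'I_2 -> C) :
  open W -> frame_on W u E -> W y ->
  let x0 := E 0 (u' 0) y in let x1 := E 1 (u' 0) y in
  let y0 := E 0 (u' 1) y in let y1 := E 1 (u' 1) y in
  let c := cubic_coef s u y in let c' := cubic_coef s u' y in
  [/\ c' 0%N = cub c x0 x1 x0 x1 x0 x1, c' 1%N = cub c y0 y1 x0 x1 x0 x1,
      c' 2%N = cub c y0 y1 y0 y1 x0 x1 & c' 3%N = cub c y0 y1 y0 y1 y0 y1].
Proof.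
move=> oW fW Wy /=; have [-> -> -> ->] := cubic_coefE s u' y.
by split; rewrite (s3_expand oW fW Wy).
Qed.

Lemma wagner_exists : exists g, is_wagner s g.
Proof.
have [W H1] := choice (@frame_ex R M); have [c H2] := choice H1.
have [u H3] := choice H2; have [F H] := choice H3.
have oW x : open (W x) by case: (H x).
have Wx x : W x x by case: (H x).
have fW x : frame_on (W x) (u x) (F x) by case: (H x).
have co x y : W x y -> coordinates_at (c x) y (u x) by case: (H x) => _ _ _; apply.
pose wag x a b (y : M) := inv_cbrt (coef_discr (u x) y) *
  hessian (cubic_coef s (u x) y) (a (F x 0) y) (a (F x 1) y) (b (F x 0) y) (b (F x 1) y).
have loc x : exists k : C, \forall y \near x, k y = inv_cbrt (coef_discr (u x) y).
  have [dl dlE] := coef_discrE (u x).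
  have dl0 y : W x y -> dl y != 0 by move=> Wy; rewrite dlE; exact: (reg (co x y Wy)).
  have [k [Q [oQ Qx _ kE]]] := local_ext (oW x) (Wx x) (smooth_on_inv_cbrt (oW x) dl0 (Cinf_smooth_on dl (oW x))).
  by exists k; apply: filterS (open_near oQ Qx) => y /kE; rewrite dlE.
have [k Hk] := choice loc.
have [G GE] : exists G : M -> oneform -> oneform -> C, forall x a b y, G x a b y = k x y *
    hessian (cubic_coef s (u x) y) (a (F x 0) y) (a (F x 1) y) (b (F x 0) y) (b (F x 1) y).
  exists (fun x a b => let cc := coef_fun (u x) s in k x * (a (F x 0) * b (F x 0) * (cc 0%N * cc 2%N - cc 1%N ^+ 2)
    + cstC M (2^-1) * (a (F x 0) * b (F x 1) + a (F x 1) * b (F x 0)) * (cc 0%N * cc 3%N - cc 1%N * cc 2%N)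
    + a (F x 1) * b (F x 1) * (cc 1%N * cc 3%N - cc 2%N ^+ 2))) => x a b y.
  by rewrite /hessian /hess00 /hess01 /hess11; have [<- <- <- <-] := coef_funE (u x) s y.
have Gwag x a b : G x a b x = wag x a b x by rewrite GE (nbhs_singleton (Hk x)).
(* The frames around x and y are compared at y by expressing the coordinates of the second in the
   first; the expression is the same in both, so the local ones glue. *)
have inv x y a b : W x y -> wag y a b y = wag x a b y.
  move=> Wy; have [t0 t1 t2 t3] := coef_transf (u y) (oW x) (fW x) Wy.
  have := wagner_invariant t0 t1 t2 t3 (reg (co y y (Wx y))) (a (F y 0) y) (a (F y 1) y) (b (F y 0) y) (b (F y 1) y).
  rewrite /wag => <-; congr (_ * _).
  by rewrite !(oneform_frame (oW y) (fW y) (Wx y) _ (F x _)).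
have gl ab : exists g : C, forall x, g x = wag x ab.1 ab.2 x.
  have [|g Hg] := @glueC _ M (fun x => G x ab.1 ab.2).
    move=> x; apply: filterS2 (open_near (oW x) (Wx x)) (Hk x) => y Wy ky.
    by rewrite Gwag (inv x y) // GE ky.
  by exists g => x; rewrite Hg Gwag.
have [B HB] := choice gl.
have BE a b x : B (a, b) x = wag x a b x by exact: (HB (a, b)).
have [|| g Hg] := @mk_symvec2 R M (fun a b => B (a, b)).
- move=> a b; apply: CinfP => x; rewrite !BE /wag /hessian; ring.
- by move=> f a a' b; apply: CinfP => x; rewrite CinfDE CinfME !BE /wag /hessian !lcE !CinfDE !CinfME; ring.
exists g => c' x u' co' /=.
have [t0 t1 t2 t3] := coef_transf u' (oW x) (fW x) (Wx x).
have [w0 w1 w2] := wagner_transf t0 t1 t2 t3 (reg co').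
have qE i j : quadratic_coef g u' x i j = wag x (differential (u' i)) (differential (u' j)) x.
  by rewrite /quadratic_coef Hg BE.
by rewrite !qE; split; [exact: w0|exact: w1|exact: w2].
Qed.

End WagnerMetric.

(** * Splitting of the subsymbol *)

Section Subsymbol.
Variables (R : realType) (M : oriented_surface R) (xi : line_bundle M).
Local Notation C := (Cinf M).
Local Notation vfield := (vfield M).
Local Notation oneform := (oneform M).
Local Notation Gamma := (lbsection xi).
Local Notation d f := (differential f).
Implicit Types (X Y : vfield) (a b : oneform) (s t : Gamma) (f h : C) (sigma : symvec M 3).

Lemma symbol3_unique (A : Gamma -> Gamma) sigma sigma' :
  is_symbol A sigma -> is_symbol A sigma' -> sigma = sigma'.
Proof.
move=> [_ H] [_ H']; apply: symvec_eq => al.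
have E (f : 'I_3 -> C) : sigma (fun i => d (f i)) = sigma' (fun i => d (f i)).
  have E6 : 3`!%:R * sigma (fun i => d (f i)) = 3`!%:R * sigma' (fun i => d (f i)).
    by apply: (scale_sec_inj (xi := xi)) => s; exact: etrans (esym (H f s)) (H' f s).
  apply: CinfP => y; have := congr1 (fun k : C => k y) E6.
  by rewrite !CinfME -[(_%:R : C) y]/(6 : R); apply: mulfI.
apply: CinfP => y; have [W [c [u [F [oW Wy fW _]]]]] := frame_ex y.
rewrite (tri_eta al) -/(s3 sigma _ _ _) -/(s3 sigma' _ _ _) !(s3_expand oW fW Wy).
by rewrite /cub /cubic_coef !E.
Qed.

Lemma symbol3_comm (A : Gamma -> Gamma) sigma f g h s : is_symbol A sigma ->
  commutator (commutator (commutator A f) g) h s = (6 * s3 sigma (d f) (d g) (d h)) *: s.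
Proof.
move=> [_ /(_ (tri f g h) s)]; rewrite codom3.
rewrite -[LHS]/(commutator (commutator (commutator A f) g) h s) => ->.
by congr ((_ * symvec_fun sigma _) *: s); apply/funext; exact: ord3P.
Qed.

(** Both triple commutators are multiplication by 6 sigma(df, dg, dh), so those of the difference
    vanish. *)
Lemma symbol_sub_quantization (A Q : Gamma -> Gamma) N (D : connection Gamma) sigma :
  is_symbol A sigma -> is_quantization N D sigma Q -> diffop 2 (fun s => A s - Q s).
Proof.
move=> sA qQ; split.
  move=> r s t; have [[Al _] _] := sA.
  rewrite Al (quantization_linear qQ); apply: sv_ext => z; rewrite !(svD, svN, svZ); ring.
move=> f g h s; rewrite (commutator_sub A Q) (commutator_sub (commutator A f)).
rewrite (commutator_sub (commutator (commutator A f) g)) (symbol3_comm f g h s sA).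
by rewrite (quantization_comm3 qQ) subrr.
Qed.

Definition shift_connection (D : connection Gamma) (th : oneform) : connection Gamma.
Proof.
exists (fun X s => D X s + th X *: s).
- abstract (move=> f X Y s; rewrite nabla_vfield oneform_lin;
    apply: sv_ext => z; rewrite !(svD, svZ) !CinfE; ring).
- abstract (move=> X s t; rewrite nablaD; apply: sv_ext => z; rewrite !(svD, svZ); ring).
- abstract (move=> X f s; rewrite nabla_leibniz; apply: sv_ext => z; rewrite !(svD, svZ); ring).
Defined.

Lemma shift_connectionE D th X s : shift_connection D th X s = D X s + th X *: s.
Proof. by []. Qed.

(** In a difference of connections the Leibniz terms cancel; by [Clinear_op_mul] it multiplies by a
    function, which depends linearly on the field. *)
Lemma connection_shift (D D' : connection Gamma) : exists th, D' = shift_connection D th.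
Proof.
have H X : exists f : C, forall s, D' X s - D X s = f *: s.
  apply: Clinear_op_mul => [s t|f s].
    by rewrite !nablaD; apply: sv_ext => z; rewrite !(svD, svN); ring.
  by rewrite !nabla_leibniz; apply: sv_ext => z; rewrite !(svD, svN, svZ); ring.
have [th' Hth'] := choice H.
have [th Hth] : exists th : oneform, forall X, th X = th' X.
  apply: mk_oneform => f X Y; apply: (scale_sec_inj (xi := xi)) => s.
  rewrite scalerDl -scalerA -(Hth' X) -(Hth' Y) -(Hth' (f *: X + Y)) !nabla_vfield.
  by apply: sv_ext => z; rewrite !(svD, svN, svZ); ring.
exists th; apply: connection_eq => X s.
by rewrite shift_connectionE Hth -Hth' addrC subrK.
Qed.

(** Only the first order term of [quantization_comm2] sees the connection in xi, and theta enters
    its third slot. *)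
Lemma quantization_shift N (D : connection Gamma) th sigma (Q Q' : Gamma -> Gamma) f h s :
  is_quantization N D sigma Q -> is_quantization N (shift_connection D th) sigma Q' ->
  commutator (commutator Q' f) h s =
  commutator (commutator Q f) h s + (6 * s3 sigma (d f) (d h) th) *: s.
Proof.
move=> qQ qQ'; apply: sv_ext => y; have [W [c [u [F [oW Wy fW _]]]]] := frame_ex y.
rewrite svD svZ (quantization_comm2 qQ _ _ _ oW fW Wy) (quantization_comm2 qQ' _ _ _ oW fW Wy).
rewrite !shift_connectionE !svD !svZ CinfME (s3_expand oW fW Wy) -[(6 : C) y]/(6 : R) !differentialE /cub.
by move: (\sum_(i < 2) _) => v; ring.
Qed.

(** The double commutator is twice the symbol, which turns the 6 of [quantization_shift] into 3; the
    sign reflects that the quantization is subtracted from A. *)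
Lemma subsymbol_shift (A : Gamma -> Gamma) N (D : connection Gamma) th sigma (Q Q' : Gamma -> Gamma)
    (tau tau' : symvec M 2) f h :
  is_quantization N D sigma Q -> is_quantization N (shift_connection D th) sigma Q' ->
  is_symbol (fun s => A s - Q s) tau -> is_symbol (fun s => A s - Q' s) tau' ->
  s2 tau (d f) (d h) = 3 * s3 sigma (d f) (d h) th + s2 tau' (d f) (d h).
Proof.
move=> qQ qQ' st st'.
have E : 2 * s2 tau (d f) (d h) = 6 * s3 sigma (d f) (d h) th + 2 * s2 tau' (d f) (d h).
  apply: (scale_sec_inj (xi := xi)) => s; rewrite scalerDl -(symbol2E f h s st) -(symbol2E f h s st').
  rewrite (commutator_sub A Q) (commutator_sub A Q') !(commutator_sub (commutator A f)).
  rewrite (quantization_shift f h s qQ qQ').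
  by apply: sv_ext => z; rewrite !(svD, svN); ring.
apply: CinfP => y.
have Ey : 2 * s2 tau (d f) (d h) y = 6 * s3 sigma (d f) (d h) th y + 2 * s2 tau' (d f) (d h) y
  := congr1 (fun k : C => k y) E.
rewrite -[RHS]/(3 * s3 sigma (d f) (d h) th y + s2 tau' (d f) (d h) y); lra.
Qed.

End Subsymbol.

Definition det3 (T : pzRingType) (a0 a1 a2 b0 b1 b2 c0 c1 c2 : T) : T :=
  a0 * (b1 * c2 - b2 * c1) - a1 * (b0 * c2 - b2 * c0) + a2 * (b0 * c1 - b1 * c0).

(** Cramer's rule: replacing a row by the linear combination of all three rows multiplies the
    determinant by the coefficient of that row, and here the combination is zero. *)
Lemma det3_free (K : fieldType) (a0 a1 a2 b0 b1 b2 c0 c1 c2 x y z : K) :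
  det3 a0 a1 a2 b0 b1 b2 c0 c1 c2 != 0 ->
  x * a0 + y * b0 + z * c0 = 0 -> x * a1 + y * b1 + z * c1 = 0 ->
  x * a2 + y * b2 + z * c2 = 0 -> [/\ x = 0, y = 0 & z = 0].
Proof.
move=> D0; set e0 := (X in X = _ -> _); set e1 := (X in _ -> X = _ -> _).
set e2 := (X in _ -> _ -> X = _ -> _) => E0 E1 E2.
split; apply: (mulIf D0); rewrite mul0r.
- by transitivity (det3 e0 e1 e2 b0 b1 b2 c0 c1 c2);
    [rewrite /det3 /e0 /e1 /e2|rewrite /det3 E0 E1 E2]; ring.
- by transitivity (det3 a0 a1 a2 e0 e1 e2 c0 c1 c2);
    [rewrite /det3 /e0 /e1 /e2|rewrite /det3 E0 E1 E2]; ring.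
- by transitivity (det3 a0 a1 a2 b0 b1 b2 e0 e1 e2);
    [rewrite /det3 /e0 /e1 /e2|rewrite /det3 E0 E1 E2]; ring.
Qed.

Section WagnerSplitting.
Variables (R : realType) (M : oriented_surface R) (sigma : symvec M 3).
Hypothesis reg : regular sigma.
Local Notation C := (Cinf M).
Local Notation vfield := (vfield M).
Local Notation oneform := (oneform M).
Local Notation d f := (differential f).
Implicit Types (X Y : vfield) (a b th : oneform) (f h : C) (tau g : symvec M 2).

Definition splits_at tau g th (l : R) (y : M) := forall f h,
  s2 tau (d f) (d h) y = 3 * s3 sigma (d f) (d h) th y + l * s2 g (d f) (d h) y.

(** The 2 x 2 minors of the first two rows are h_11, h_01 and h_00, the coefficients of the Hessian.
    Expansion along the last row pairs the Hessian with itself and gives m (4 h_00 h_11 - h_01^2) /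
    2, where m is the inverse cube root of the discriminant. *)
Lemma wagner_det u (c : chart R M) y g : is_wagner sigma g -> coordinates_at c y u ->
  let A := cubic_coef sigma u y in
  det3 (A 0%N) (A 1%N) (A 2%N) (A 1%N) (A 2%N) (A 3%N)
    (s2 g (d (u 0)) (d (u 0)) y) (s2 g (d (u 0)) (d (u 1)) y) (s2 g (d (u 1)) (d (u 1)) y) != 0.
Proof.
move=> wg co /=.
have qE i j : quadratic_coef g u y i j = s2 g (d (u i)) (d (u j)) y.
  by rewrite /quadratic_coef /s2; congr (symvec_fun g _ y); apply/funext; exact: ord2P.
have [] := wg _ _ _ co; rewrite !qE => w0 w1 w2.
have D0 : cubic_discr sigma u y != 0 := reg co.
have i0 := inv_cbrt_neq0 D0.
set m := inv_cbrt _ in w0 w1 w2 i0.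
set A := cubic_coef sigma u y in w0 w1 w2 *.
have w1' : s2 g (d (u 0)) (d (u 1)) y = 2^-1 * (m * (A 0%N * A 3%N - A 1%N * A 2%N)).
  by rewrite -w1 mulKf.
rewrite w0 w1' w2.
have -> : det3 (A 0%N) (A 1%N) (A 2%N) (A 1%N) (A 2%N) (A 3%N)
    (m * (A 0%N * A 2%N - A 1%N ^+ 2)) (2^-1 * (m * (A 0%N * A 3%N - A 1%N * A 2%N)))
    (m * (A 1%N * A 3%N - A 2%N ^+ 2)) = m * cubic_discr sigma u y / 2.
  by rewrite /cubic_discr -/A /discr /det3; move: (m) => k; field.
by apply: mulf_neq0; [exact: mulf_neq0 i0 D0|rewrite invr_neq0].
Qed.

Lemma splits_frame (W : set M) (u : 'I_2 -> C) (F : 'I_2 -> vfield) tau g th l (y : M) :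
  open W -> frame_on W u F -> W y ->
  let A := cubic_coef sigma u y in
  splits_at tau g th l y <->
  [/\ s2 tau (d (u 0)) (d (u 0)) y = 3 * (th (F 0) y * A 0%N + th (F 1) y * A 1%N) + l * s2 g (d (u 0)) (d (u 0)) y,
      s2 tau (d (u 0)) (d (u 1)) y = 3 * (th (F 0) y * A 1%N + th (F 1) y * A 2%N) + l * s2 g (d (u 0)) (d (u 1)) y &
      s2 tau (d (u 1)) (d (u 1)) y = 3 * (th (F 0) y * A 2%N + th (F 1) y * A 3%N) + l * s2 g (d (u 1)) (d (u 1)) y].
Proof.
move=> oW fW Wy A; split=> [H|[t0 t1 t2] f h].
  have dd i j : d (u i) (F j) y = (j == i)%:R by rewrite differentialE (frame_delta fW Wy).
  by split; rewrite H (s3_expand oW fW Wy) !dd /cub -/A /=; ring.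
rewrite (s2_expand oW fW Wy tau) (s2_expand oW fW Wy g) (s3_expand oW fW Wy) t0 t1 t2 /cub -/A.
ring.
Qed.

Lemma splits_unique tau g g' th th' l l' (y : M) :
  is_wagner sigma g -> is_wagner sigma g' ->
  splits_at tau g th l y -> splits_at tau g' th' l' y ->
  (forall X, th X y = th' X y) /\ l = l'.
Proof.
move=> wg wg' S S'; have [W [c [u [F [oW Wy fW co]]]]] := frame_ex y.
have dg := wagner_det wg (co y Wy).
have qE (k : symvec M 2) i j : quadratic_coef k u y i j = s2 k (d (u i)) (d (u j)) y.
  by rewrite /quadratic_coef /s2; congr (symvec_fun k _ y); apply/funext; exact: ord2P.
have [g0 g1 g2] := wg _ _ _ (co y Wy); have [g0' g1' g2'] := wg' _ _ _ (co y Wy).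
rewrite !qE in g0 g1 g2 g0' g1' g2'.
(* [is_wagner] prescribes the components in every chart, so the two metrics coincide at y and a
   single linear system remains. *)
have G0 : s2 g' (d (u 0)) (d (u 0)) y = s2 g (d (u 0)) (d (u 0)) y by rewrite g0 g0'.
have G1 : s2 g' (d (u 0)) (d (u 1)) y = s2 g (d (u 0)) (d (u 1)) y.
  have n2 : (2 : R) != 0 by [].
  by apply: (mulfI n2); rewrite g1 g1'.
have G2 : s2 g' (d (u 1)) (d (u 1)) y = s2 g (d (u 1)) (d (u 1)) y by rewrite g2 g2'.
have /(splits_frame _ _ _ _ oW fW Wy) [t0 t1 t2] := S.
have /(splits_frame _ _ _ _ oW fW Wy) [t0' t1' t2'] := S'.
rewrite t0 G0 in t0'; rewrite t1 G1 in t1'; rewrite t2 G2 in t2'.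
move: dg t0' t1' t2' => /=; set A := cubic_coef sigma u y.
move: (s2 g _ _ y) (s2 g _ _ y) (s2 g _ _ y) => p q r dg e0 e1 e2.
set x := th (F 0) y in e0 e1 e2; set z := th (F 1) y in e0 e1 e2.
set x' := th' (F 0) y in e0 e1 e2; set z' := th' (F 1) y in e0 e1 e2.
have [x0 z0 l0] : [/\ 3 * (x' - x) = 0, 3 * (z' - z) = 0 & l' - l = 0].
  apply: (det3_free dg).
  - by move/esym/eqP: e0; rewrite -subr_eq0 => /eqP <-; ring.
  - by move/esym/eqP: e1; rewrite -subr_eq0 => /eqP <-; ring.
  - by move/esym/eqP: e2; rewrite -subr_eq0 => /eqP <-; ring.
have E0 : x = x' by lra.
have E1 : z = z' by lra.
split; last by lra.
by move=> X; rewrite (oneform_frame oW fW Wy th) (oneform_frame oW fW Wy th') -/x -/x' -/z -/z' E0 E1.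
Qed.

Lemma splits_local tau g (x : M) : is_wagner sigma g ->
  exists (th : oneform) (l : C), \forall y \near x, splits_at tau g th (l y) y.
Proof.
move=> wg; have [W [c [u [F [oW Wx fW co]]]]] := frame_ex x.
pose A := coef_fun u sigma.
pose p := s2 g (d (u 0)) (d (u 0)); pose q := s2 g (d (u 0)) (d (u 1)); pose r := s2 g (d (u 1)) (d (u 1)).
pose t0 := s2 tau (d (u 0)) (d (u 0)); pose t1 := s2 tau (d (u 0)) (d (u 1)); pose t2 := s2 tau (d (u 1)) (d (u 1)).
pose D := det3 (A 0%N) (A 1%N) (A 2%N) (A 1%N) (A 2%N) (A 3%N) p q r.
(* Cramer's numerators, as smooth functions. [X0] and [X1] give three times the components of theta,
   hence the factor 1/3 below. *)
pose X0 := det3 t0 t1 t2 (A 1%N) (A 2%N) (A 3%N) p q r.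
pose X1 := det3 (A 0%N) (A 1%N) (A 2%N) t0 t1 t2 p q r.
pose L := det3 (A 0%N) (A 1%N) (A 2%N) (A 1%N) (A 2%N) (A 3%N) t0 t1 t2.
have D0 y : W y -> D y != 0.
  move=> Wy; have := wagner_det wg (co y Wy) => /=.
  by have [<- <- <- <-] := coef_funE u sigma y.
have [k [Q [oQ Qx QW kE]]] := local_ext oW Wx (smooth_on_inv oW D0 (Cinf_smooth_on D oW)).
have [th Hth] : exists th : oneform, forall X, th X = cstC M (3^-1) * k * (X (u 0) * X0 + X (u 1) * X1).
  apply: mk_oneform => f X Y; rewrite !vfield_addE !vfield_scaleE; ring.
have [l lE] : exists l : C, forall y, l y = k y * L y by exists (k * L).
exists th, l; apply: filterS (open_near oQ Qx) => y Qy; have Wy := QW y Qy.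
have kD : k y * D y = 1 by rewrite kE // mulVf // D0.
have thE i : th (F i) y = 3^-1 * k y * (if i == 0 then X0 y else X1 y).
  have := congr1 (fun h : C => h y) (Hth (F i)).
  have -> : (cstC M 3^-1 * k * (F i (u 0) * X0 + F i (u 1) * X1)) y =
     3^-1 * k y * (F i (u 0) y * X0 y + F i (u 1) y * X1 y) by [].
  rewrite !(frame_delta fW Wy) => ->.
  by case: (ord2E i) => ->; rewrite /= ?(mul1r, mul0r, add0r, addr0).
have sel0 (v w : R) : (if (0 : 'I_2) == 0 then v else w) = v by [].
have sel1 (v w : R) : (if (1 : 'I_2) == 0 then v else w) = w by [].
have th0 : th (F 0) y = 3^-1 * k y * X0 y by rewrite thE (sel0 (X0 y) (X1 y)).
have th1 : th (F 1) y = 3^-1 * k y * X1 y by rewrite thE (sel1 (X0 y) (X1 y)).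
apply/(splits_frame _ _ _ _ oW fW Wy); rewrite th0 th1.
have [<- <- <- <-] := coef_funE u sigma y; rewrite -/A.
rewrite -[s2 tau (d (u 0)) (d (u 0)) y]/(t0 y) -[s2 tau (d (u 0)) (d (u 1)) y]/(t1 y).
rewrite -[s2 tau (d (u 1)) (d (u 1)) y]/(t2 y).
rewrite -[s2 g (d (u 0)) (d (u 0)) y]/(p y) -[s2 g (d (u 0)) (d (u 1)) y]/(q y).
rewrite -[s2 g (d (u 1)) (d (u 1)) y]/(r y).
have DE : D y = det3 (A 0%N y) (A 1%N y) (A 2%N y) (A 1%N y) (A 2%N y) (A 3%N y) (p y) (q y) (r y) by [].
have X0E : X0 y = det3 (t0 y) (t1 y) (t2 y) (A 1%N y) (A 2%N y) (A 3%N y) (p y) (q y) (r y) by [].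
have X1E : X1 y = det3 (A 0%N y) (A 1%N y) (A 2%N y) (t0 y) (t1 y) (t2 y) (p y) (q y) (r y) by [].
have LE : L y = det3 (A 0%N y) (A 1%N y) (A 2%N y) (A 1%N y) (A 2%N y) (A 3%N y) (t0 y) (t1 y) (t2 y) by [].
rewrite lE X0E X1E LE; rewrite DE in kD; move: kD.
move: (k y) (A 0%N y) (A 1%N y) (A 2%N y) (A 3%N y) (t0 y) (t1 y) (t2 y) (p y) (q y) (r y).
move=> k' A0 A1 A2 A3 s0 s1 s2' p' q' r' kD; split.
- by rewrite -[LHS]mul1r -[X in X * _ = _]kD /det3; field.
- by rewrite -[LHS]mul1r -[X in X * _ = _]kD /det3; field.
- by rewrite -[LHS]mul1r -[X in X * _ = _]kD /det3; field.
Qed.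

(** Local solutions agree by [splits_unique], so their values at each point define a smooth form and
    a smooth multiplier. *)
Lemma splits_exists tau g : is_wagner sigma g ->
  exists (th : oneform) (l : C), forall y, splits_at tau g th (l y) y.
Proof.
move=> wg; have [thx H1] := choice (fun x => splits_local tau x wg).
have [lx H] := choice H1.
have U x : \forall y \near x, (forall X, thx y X y = thx x X y) /\ lx y y = lx x y.
  by apply: filterS (H x) => y Sy; exact: (splits_unique wg wg (nbhs_singleton (H y)) Sy).
have [l Hl] : exists l : C, forall x, l x = lx x x.
  by apply: glueC => x; apply: filterS (U x) => y [].
have gth X : exists k : C, forall x, k x = thx x X x.
  by apply: (@glueC _ _ (fun x => thx x X)) => x; apply: filterS (U x) => y [->].
have [t Ht] := choice gth.
have [|th Hth] := @mk_oneform _ M t.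
  move=> f X Y; apply: CinfP => y; rewrite CinfDE CinfME !Ht; exact: (congr1 (fun k : C => k y) (oneform_lin (thx y) f X Y)).
exists th, l => y f h; rewrite Hl (nbhs_singleton (H y) f h).
have [W [c [u [F [oW Wy fW _]]]]] := frame_ex y.
by rewrite !(s3_expand oW fW Wy) !Hth !Ht.
Qed.

End WagnerSplitting.

Theorem theorem19 (R : realType) (M : oriented_surface R) (xi : line_bundle M)
    (A : lbsection xi -> lbsection xi) (sigma3 : symvec M 3) :
  diffop 3 A -> is_symbol A sigma3 -> regular sigma3 ->
  exists! Nxi : connection (lbsection xi),
    exists (lambda : Cinf M) (sigma2 g : symvec M 2),
      [/\ is_subsymbol A Nxi sigma2, is_wagner sigma3 g &
          forall al, sigma2 al = lambda * g al].
Proof.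
move=> _ sA reg.
have [N cN] := chern_exists reg; have [D _] := connection_exists xi.
have [Q qQ] := quantization_exists N D sigma3.
have [tau st] := symbol2_exists (symbol_sub_quantization sA qQ).
have [g wg] := wagner_exists reg; have [th [l S]] := splits_exists reg tau wg.
(* Passing from D to D + theta subtracts 3 sigma(., ., theta) from tau, which leaves exactly the
   multiple of g. *)
exists (shift_connection D th); split.
  have [Q' qQ'] := quantization_exists N (shift_connection D th) sigma3.
  have [sigma2 st'] := symbol2_exists (symbol_sub_quantization sA qQ').
  exists l, sigma2, g; split=> //; first by exists sigma3, N, Q'.
  have E (f h : Cinf M) y : s2 sigma2 (differential f) (differential h) y
      = l y * s2 g (differential f) (differential h) y.
    apply: (addrI (3 * s3 sigma3 (differential f) (differential h) th y)); rewrite -S.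
    by rewrite (subsymbol_shift f h qQ qQ' st st').
  move=> al; apply: CinfP => y; have [W [c [u [F [oW Wy fW _]]]]] := frame_ex y.
  have V (k : symvec M 2) : k al y = s2 k (al 0) (al 1) y by rewrite {1}(duo_eta al).
  rewrite CinfME (V sigma2) (V g) (s2_expand oW fW Wy sigma2) (s2_expand oW fW Wy g).
  rewrite (E (u 0) (u 0)) (E (u 0) (u 1)) (E (u 1) (u 1)).
  move: (s2 g _ _ y) (s2 g _ _ y) (s2 g _ _ y) (l y) => g0 g1 g2 l0; ring.
move=> D' [l' [sigma2 [g' [[sigma3' [N' [Q' [sA' cN' qQ' st']]]] wg' E]]]].
(* The subsymbol of the competing connection comes with its own principal symbol and Chern
   connection; uniqueness of both brings them back to [sigma3] and [N]. *)
have e3 := symbol3_unique sA' sA; rewrite e3 in cN' qQ'.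
rewrite -(chern_unique reg cN cN') in qQ'; have [th' eD] := connection_shift D D'.
rewrite eD in qQ' *; apply: connection_eq => X s.
rewrite !shift_connectionE; congr (_ + _ *: _); apply: CinfP => y.
(* With the competitor written as D + th', its condition is a second splitting of the same tau, and
   uniqueness at y identifies th' with th. *)
have S' : splits_at sigma3 tau g' th' (l' y) y.
  by move=> f h; rewrite (subsymbol_shift f h qQ qQ' st st') [s2 sigma2 _ _]E.
by have [-> //] := splits_unique reg wg wg' (S y) S'.
Qed.
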